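(* Let $E$ be a separable real Banach space. Let $F\colon I\times E\multimap E$ be a set-valued map such that: (H1) the set $F(t,x)$ is nonempty, closed and bounded for every $(t,x)\in I\times E$; (H2) the map $F(\cdot,x)$ is $\Sigma$-measurable for every $x\in E$; (H3) there exists $\alpha\in L^1(I,\mathbb{R})$ such that $d_H(F(t,x),F(t,y))\leqslant\alpha(t)|x-y|$ for all $x,y\in E$, a.e. in $I$; (H4) there exists $\beta\in L^1(I,\mathbb{R})$ such that $d(0,F(t,0))\leqslant\beta(t)$ a.e. in $I$. Let $k\colon\triangle\to\mathcal{L}(E)$ be such that: (k5) $k(t,\cdot)\in L^\infty([0,t],\mathcal{L}(E))$ for every $t\in I$; (k6) the function $I\ni t\mapsto k(t,\cdot)\in L^\infty([0,t],\mathcal{L}(E))$ is continuous in the norm $\|\cdot\|_\infty$ of the space $L^\infty(I,\mathcal{L}(E))$. For $h\in C(I,E)$ put $$\mathcal{S}_F^1(h)=\left\{w\in L^1(I,E)\colon w(t)\in F\left(t,h(t)+\int_0^tk(t,s)w(s)\,ds\right)\text{ for a.a. }t\in I\right\}.$$ Then for every $h\in C(I,E)$ the set $\mathcal{S}_F^1(h)$ is an absolute retract. Moreover, the map $\mathcal{S}_F^1\colon C(I,E)\multimap L^1(I,E)$ admits a continuous singlevalued selection, i.e. there is a continuous $f\colon C(I,E)\to L^1(I,E)$ with $f(h)\in\mathcal{S}_F^1(h)$ for every $h\in C(I,E)$.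
   Context: $I=[0,T]$, $\triangle=\{(t,s)\in I\times I\colon 0\leqslant s\leqslant t\leqslant T\}$, $\Sigma$ is the $\sigma$-algebra of Lebesgue measurable subsets of $I$. $E$ has norm $|\cdot|$; $\mathcal{L}(E)$ is the space of bounded linear endomorphisms of $E$ with the operator norm. $C(I,E)$ carries the maximum norm; $L^1(I,E)$ is the space of Bochner integrable maps with its usual norm, and $\mathcal{S}_F^1(h)$ has the induced metric topology. $d(x,A)=\inf\{|x-y|\colon y\in A\}$ and $d_H(A,B)=\max\{\sup_{x\in A}d(x,B),\sup_{y\in B}d(y,A)\}$ is the Hausdorff distance. A set-valued map $G\colon I\multimap E$ is $\Sigma$-measurable if $\{t\in I\colon G(t)\subset C\}\in\Sigma$ for every open $C\subset E$. In (k6), $k(t,\cdot)$ is regarded as an element of $L^\infty(I,\mathcal{L}(E))$ by extending it by $0$ outside $[0,t]$. ''Absolute retract'' (AR) is meant in the class of metrizable spaces. *)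

(* Defs.v *)
From HB Require Import structures.
From mathcomp Require Import all_boot all_order all_algebra.
From mathcomp Require Import all_classical all_reals all_analysis.
From mathcomp Require Import ess_sup_inf measurable_realfun.

Set Implicit Arguments.
Unset Strict Implicit.
Unset Printing Implicit Defensive.

Import Order.TTheory GRing.Theory Num.Theory.
Import numFieldNormedType.Exports.

Local Open Scope classical_set_scope.
Local Open Scope ring_scope.

Definition separable (X : topologicalType) :=
  exists2 S : set X, countable S & dense S.

Section hausdorff_distance.
Context {R : realType} {E : normedModType R}.
Implicit Types (x : E) (A B : set E).

Definition dist_set x A : \bar R := ereal_inf [set `|x - y|%:E | y in A].

Definition hausdorff_dist A B : \bar R :=
  maxe (ereal_sup [set dist_set x B | x in A])
       (ereal_sup [set dist_set y A | y in B]).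

End hausdorff_distance.

Section absolute_retracts.
Variable R : realType.

Definition metrizable (X : topologicalType) :=
  exists d : X -> X -> R,
    [/\ forall x y, d x y = 0 <-> x = y,
        forall x y, d x y = d y x,
        forall x y z, d x z <= d x y + d y z &
        forall x (U : set X), nbhs x U <->
          exists2 e, 0 < e & [set y | d x y < e] `<=` U].

Definition closed_embedding (X Y : topologicalType) (i : X -> Y) :=
  [/\ injective i, continuous i,
      forall U, open U -> exists2 V, open V & i @` U = V `&` range i &
      closed (range i)].

Definition retract_of (Y : topologicalType) (A : set Y) :=
  exists r : Y -> Y,
    [/\ continuous r, forall y, A (r y) & forall y, A y -> r y = y].

(* Absolute retract for the class of metrizable spaces. *)
Definition absolute_retract (X : topologicalType) :=
  metrizable X /\
  forall (Y : metricType R) (i : X -> Y),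
    closed_embedding i -> retract_of (range i).

End absolute_retracts.

Section simple_functions.
Context d {T : measurableType d}.

Definition simple_fun {V : Type} (s : T -> V) :=
  finite_set (range s) /\ forall y, measurable (s @^-1` [set y]).

Lemma simple_fun_op2 {V1 V2 W : Type} (g : V1 -> V2 -> W) s1 s2 :
  simple_fun s1 -> simple_fun s2 -> simple_fun (fun t => g (s1 t) (s2 t)).
Proof.
move=> [f1 m1] [f2 m2]; split.
  apply: (@sub_finite_set _ _
      ((fun z => g z.1 z.2) @` (range s1 `*` range s2))).
    by move=> _ [t _ <-]; exists (s1 t, s2 t) => //; split; exists t.
  exact/finite_image/finite_setX.
move=> y; rewrite (_ : _ @^-1` _ =
    \bigcup_(z in [set z | (range s1 `*` range s2) z /\ g z.1 z.2 = y])
      (s1 @^-1` [set z.1] `&` s2 @^-1` [set z.2])); last first.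
  apply/seteqP; split=> [t /= gy|t [[a b] [/= _ gab] [/= sa sb]]].
    by exists (s1 t, s2 t) => //=; do !split => //; exists t.
  by rewrite /= sa sb.
apply: fin_bigcup_measurable; last by move=> z _; exact: measurableI.
apply: (@sub_finite_set _ _ (range s1 `*` range s2)); first by move=> z [].
exact: finite_setX.
Qed.

Lemma simple_fun_cst {V : Type} (v : V) : simple_fun (fun _ : T => v).
Proof.
split; first by apply: (@sub_finite_set _ _ [set v]) => // _ [t _ <-].
move=> y; have [vy|vy] := pselect (v = y).
  by rewrite (_ : _ @^-1` _ = setT)//; apply/seteqP; split.
by rewrite (_ : _ @^-1` _ = set0)//; apply/seteqP; split.
Qed.

Lemma simple_fun_measurable {R : realType} (D : set T) (s : T -> R) :
  measurable D -> simple_fun s -> measurable_fun D s.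
Proof.
move=> mD [fs ms] _ B mB; apply: measurableI => //.
rewrite (_ : _ @^-1` _ = \bigcup_(y in range s `&` B) s @^-1` [set y]).
  apply: fin_bigcup_measurable => //.
  by apply: (sub_finite_set _ fs) => y [].
apply/seteqP; split=> [t /= Bt|t [y [_ By] /= ->]//].
by exists (s t) => //; split => //; exists t.
Qed.

End simple_functions.

Section bochner.
Context d {T : measurableType d} {R : realType} (mu : {measure set T -> \bar R}).
Context {E : normedModType R}.
Variable D : set T.
Implicit Types (f g : T -> E) (s : (T -> E)^nat).

Definition strongly_measurable f :=
  exists s, (forall n, simple_fun (s n)) /\
    {ae mu, forall t, D t -> s n t @[n --> \oo] --> f t}.

Definition bochner_approx f s :=
  [/\ forall n, simple_fun (s n),
      forall n, (\int[mu]_(t in D) `|s n t|%:E < +oo)%E &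
      (\int[mu]_(t in D) `|f t - s n t|%:E)%E @[n --> \oo] --> 0%E].

Definition bochner_integrable f :=
  strongly_measurable f /\ exists s, bochner_approx f s.

Definition simple_integral (s : T -> E) : E :=
  \sum_(y \in range s) fine (mu (D `&` s @^-1` [set y])) *: y.

(* The point x below exists and is unique when E is complete and f is
   Bochner integrable. *)
Definition bochner_integral f : E :=
  get [set x | exists s, bochner_approx f s /\
                 simple_integral (s n) @[n --> \oo] --> x].

Definition Linfty_norm f : \bar R :=
  ess_sup mu (patch (fun=> 0%E) D (fun t => `|f t|%:E)).

Definition in_Linfty f := strongly_measurable f /\ (Linfty_norm f < +oo)%E.

Lemma strongly_measurable_comb (a : R) f g :
  strongly_measurable f -> strongly_measurable g ->
  strongly_measurable (a *: f + g).
Proof.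
move=> [s [ms sf]] [s' [ms' sg]].
exists (fun n t => a *: s n t + s' n t); split=> [n|].
  by apply: (simple_fun_op2 (fun u v => a *: u + v)).
apply: filterS2 sf sg => t sf sg Dt.
by apply: cvgD; [apply: cvgZl_tmp; exact: sf|exact: sg].
Qed.

Hypothesis cmu : measure_is_complete mu.
Hypothesis mD : measurable D.

Lemma measurable_norm f : strongly_measurable f ->
  measurable_fun D (fun t => `|f t|).
Proof.
move=> [s [ms [A [mA A0 sf]]]].
rewrite -[in X in measurable_fun X _](setUIDK D A) setUC.
apply/measurable_funU => //; [exact: measurableD|exact: measurableI|split].
- apply: (@measurable_fun_cvg _ _ _ _ (fun n t => `|s n t|)) => [n|t [Dt At]].
    apply: simple_fun_measurable; first exact: measurableD.
    exact: (simple_fun_op2 (fun u (_ : E) => `|u|) (ms n) (ms n)).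
  apply: cvg_norm; apply: contrapT => nsf; apply/At/sf => /= h.
  by apply: nsf; exact: h.
- move=> _ B mB; apply: cmu; exists A; split => //.
  by apply: subset_trans (@subIsetl _ _ _) _; exact: subIsetr.
Qed.

Lemma measurable_normE f : strongly_measurable f ->
  measurable_fun D (fun t => `|f t|%:E).
Proof. by move=> mf; apply/measurable_EFinP; exact: measurable_norm. Qed.

Lemma simple_strongly_measurable (s : T -> E) :
  simple_fun s -> strongly_measurable s.
Proof.
move=> ss; exists (fun=> s); split => //.
by apply: aeW => t _; exact: cvg_cst.
Qed.

Lemma integral_norm_comb (a : R) f g :
  strongly_measurable f -> strongly_measurable g ->
  (\int[mu]_(t in D) `|(a *: f + g) t|%:E <=
   `|a|%:E * (\int[mu]_(t in D) `|f t|%:E) + \int[mu]_(t in D) `|g t|%:E)%E.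
Proof.
move=> mf mg; rewrite -ge0_integralZl//; last exact: measurable_normE.
rewrite -ge0_integralD//; last 2 first.
- by apply: measurable_funeM; exact: measurable_normE.
- exact: measurable_normE.
apply: ge0_le_integral => //.
- by apply: measurable_normE; exact: strongly_measurable_comb.
- apply: emeasurable_funD; last exact: measurable_normE.
  by apply: measurable_funeM; exact: measurable_normE.
- by move=> t _; rewrite -EFinM -EFinD lee_fin -normrZ ler_normD.
Qed.

Lemma bochner_integrable_fin f : bochner_integrable f ->
  (\int[mu]_(t in D) `|f t|%:E)%E \is a fin_num.
Proof.
move=> [mf [s [ss sfin sf]]].
rewrite ge0_fin_numE; last exact: integral_ge0.
have /fine_cvgP[[N _ /(_ N (leqnn N)) fsN] _] := sf.
have mss := simple_strongly_measurable (ss N).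
have mfs := strongly_measurable_comb (-1) mss mf.
have := integral_norm_comb 1 mfs mss.
rewrite scale1r scaleN1r addrAC addNr add0r normr1 mul1e => /le_lt_trans.
apply; rewrite lte_add_pinfty ?sfin//.
rewrite -ge0_fin_numE; last exact: integral_ge0.
by under eq_integral do rewrite /= addrC.
Qed.

Lemma bochner_integrable_comb (a : R) f g :
  bochner_integrable f -> bochner_integrable g ->
  bochner_integrable (a *: f + g).
Proof.
move=> [mf [s [ss sfin sf]]] [mg [s' [ss' s'fin s'g]]].
split; first exact: strongly_measurable_comb.
have mss n := simple_strongly_measurable (ss n).
have mss' n := simple_strongly_measurable (ss' n).
have fin_norm (h : T -> E) : (\int[mu]_(t in D) `|h t|%:E < +oo)%E ->
    (\int[mu]_(t in D) `|h t|%:E)%E \is a fin_num.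
  by move=> hoo; rewrite ge0_fin_numE//; exact: integral_ge0.
exists (fun n => a *: s n + s' n); split=> [n|n|].
- by apply: (simple_fun_op2 (fun u v => a *: u + v)).
- have := integral_norm_comb a (mss n) (mss' n).
  move=> /le_lt_trans; apply.
  by rewrite lte_add_pinfty// -(fineK (fin_norm _ (sfin n))) -EFinM ltry.
apply: (@squeeze_cvge _ _ _ _ (cst 0%E) _ (fun n =>
    `|a|%:E * (\int[mu]_(t in D) `|f t - s n t|%:E) +
    \int[mu]_(t in D) `|g t - s' n t|%:E)%E).
- near=> n; rewrite integral_ge0//=.
  have mfs := strongly_measurable_comb (-1) (mss n) mf.
  have mgs := strongly_measurable_comb (-1) (mss' n) mg.
  have := integral_norm_comb a mfs mgs.
  under [in X in (X <= _)%E -> _]eq_integral => t _.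
    rewrite (_ : _ t = (a *: f + g) t - (a *: s n + s' n) t); last first.
      rewrite !fctE /= !scaleN1r scalerDr scalerN opprD.
      by rewrite addrACA addrC.
    over.
  under [in X in (_ <= _ * X + _)%E -> _]eq_integral => t _.
    rewrite fctE /= scaleN1r addrC.
    over.
  under [in X in (_ <= _ + X)%E -> _]eq_integral => t _.
    rewrite fctE /= scaleN1r addrC.
    over.
  by [].
- exact: cvg_cst.
- rewrite -[X in _ --> X]adde0 -[X in _ --> (X + _)%E](mule0 `|a|%:E).
  by apply: cvgeD => //; apply: cvgeZl.
Unshelve. all: by end_near. Qed.

Lemma bochner_integrable0 : bochner_integrable 0.
Proof.
have s0 : simple_fun (0 : T -> E) by exact: simple_fun_cst.
split; first exact: simple_strongly_measurable.
exists (fun=> 0); split => //.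
  by move=> _; under eq_integral do rewrite normr0; rewrite integral0.
under eq_fun do (under eq_integral do rewrite subrr normr0; rewrite integral0).
exact: cvg_cst.
Qed.

Lemma integral_norm_eq0 f : strongly_measurable f ->
  (\int[mu]_(t in D) `|f t|%:E = 0)%E -> {ae mu, forall t, D t -> f t = 0}.
Proof.
move=> mf f0.
have : (\int[mu]_(t in D) `| `|f t|%:E | = 0)%E.
  by rewrite -f0; apply: eq_integral => t _; rewrite /= normr_id.
move/(ae_eq_integral_abs mu mD (measurable_normE mf)).
by apply: filterS => t /[apply] -[/normr0_eq0].
Qed.

Lemma integral_norm_ae f g : strongly_measurable f -> strongly_measurable g ->
  {ae mu, forall t, D t -> f t = g t} ->
  (\int[mu]_(t in D) `|f t|%:E = \int[mu]_(t in D) `|g t|%:E)%E.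
Proof.
move=> mf mg fg; apply: ge0_ae_eq_integral => //.
- exact: measurable_normE.
- exact: measurable_normE.
- by apply: filterS fg => t fg Dt; rewrite fg.
Qed.

End bochner.

Section bounded_endomorphisms.
Context {R : realType} (E : normedModType R).

Definition bounded_linear : {pred E -> E} :=
  mem [set f | linear f /\ exists M, forall x, `|f x| <= M * `|x|].

Lemma bounded_linear_submod : submod_closed bounded_linear.
Proof.
split; rewrite ?inE /=.
  split; first by move=> a u v; rewrite scaler0 addr0.
  by exists 0 => x; rewrite normr0 mul0r.
move=> a f g; rewrite !inE/= => -[lf [M fM]] [lg [M' gM']]; split.
  move=> b u v; rewrite !fctE lf lg !scalerDr addrACA; congr (_ + _ + _).
  by rewrite !scalerA mulrC.
exists (`|a| * M + M') => x; rewrite !fctE.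
rewrite (le_trans (ler_normD _ _))// mulrDl lerD// normrZ -mulrA.
by rewrite ler_wpM2l.
Qed.

HB.instance Definition _ :=
  GRing.isSubmodClosed.Build R (E -> E) bounded_linear bounded_linear_submod.

Record bounded_endo := BoundedEndo {
  bounded_endo_fun :> E -> E;
  _ : bounded_endo_fun \in bounded_linear }.

HB.instance Definition _ := [isSub for bounded_endo_fun].
HB.instance Definition _ := [Choice of bounded_endo by <:].
HB.instance Definition _ := [SubChoice_isSubLmodule of bounded_endo by <:].

Definition opnorm (f : bounded_endo) : R :=
  sup [set `|f x| | x in [set x | `|x| <= 1]].

Lemma bounded_endoP (f : bounded_endo) :
  linear f /\ exists M, forall x, `|f x| <= M * `|x|.
Proof. by have := valP f; rewrite inE. Qed.

Lemma opnorm_has_sup (f : bounded_endo) :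
  has_sup [set `|f x| | x in [set x | `|x| <= 1]].
Proof.
split; first by exists `|f 0|, 0; rewrite //= normr0.
have [_ [M fM]] := bounded_endoP f; exists `|M| => _ [x /= x1 <-].
rewrite (le_trans (fM x))// (le_trans (ler_norm _))// normrM normr_id.
by rewrite ler_piMr.
Qed.

Lemma opnorm_le (f : bounded_endo) M :
  (forall x, `|x| <= 1 -> `|f x| <= M) -> opnorm f <= M.
Proof.
move=> fM; apply: ge_sup; first by have [] := opnorm_has_sup f.
by move=> _ [x x1 <-]; exact: fM.
Qed.

Lemma le_opnorm (f : bounded_endo) x : `|x| <= 1 -> `|f x| <= opnorm f.
Proof.
by move=> x1; apply: (sup_upper_bound (opnorm_has_sup f)); exists x.
Qed.

Lemma opnorm_ge0 (f : bounded_endo) : 0 <= opnorm f.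
Proof. by rewrite (le_trans _ (@le_opnorm f 0 _))// normr0. Qed.

Lemma opnormD (f g : bounded_endo) : opnorm (f + g) <= opnorm f + opnorm g.
Proof.
apply: opnorm_le => x x1.
by rewrite (le_trans (ler_normD _ _))// lerD// le_opnorm.
Qed.

Lemma opnormZ_le (a : R) (f : bounded_endo) : opnorm (a *: f) <= `|a| * opnorm f.
Proof.
by apply: opnorm_le => x x1; rewrite normrZ ler_wpM2l// le_opnorm.
Qed.

Lemma opnormZ (a : R) (f : bounded_endo) : opnorm (a *: f) = `|a| * opnorm f.
Proof.
have [->|a0] := eqVneq a 0.
  apply/eqP; rewrite eq_le opnormZ_le/= normr0 mul0r; exact: opnorm_ge0.
apply/eqP; rewrite eq_le opnormZ_le/=.
have := opnormZ_le a^-1 (a *: f).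
rewrite scalerA mulVf// scale1r normfV.
by rewrite ler_pdivlMl// normr_gt0.
Qed.

Lemma opnorm_eq0 (f : bounded_endo) : opnorm f = 0 -> f = 0.
Proof.
move=> f0; apply/val_inj/funext => x /=.
have [->|x0] := eqVneq x 0.
  have [lf _] := bounded_endoP f.
  by have := lf (-1) 0 0; rewrite scaler0 addr0 scaleN1r addNr.
have := @le_opnorm f (`|x|^-1 *: x).
rewrite normrZ normfV normr_id mulVf ?normr_eq0// f0 => /(_ (lexx _)).
have [lf _] := bounded_endoP f.
have f00 : f 0 = 0.
  by have := lf (-1) 0 0; rewrite scaler0 addr0 scaleN1r addNr.
have -> : f (`|x|^-1 *: x) = `|x|^-1 *: f x.
  by have := lf `|x|^-1 x 0; rewrite f00 !addr0.
by rewrite normr_le0 scaler_eq0 invr_eq0 normr_eq0 (negbTE x0) => /eqP.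
Qed.

HB.instance Definition _ := Lmodule_isNormed.Build R bounded_endo
  opnormD opnormZ opnorm_eq0.

End bounded_endomorphisms.

Section continuous_functions.
Context {R : realType} (T : R) (E : normedModType R).

(* A map on [0, T] is encoded by its extension by 0 to the real line. *)
Definition continuous_on : {pred R -> E} :=
  mem [set h | {within `[0, T], continuous h} /\
               forall t, ~ `[0, T]%classic t -> h t = 0].

Lemma continuous_on_submod : submod_closed continuous_on.
Proof.
split; rewrite ?inE /=; first by split => // t; exact: cvg_cst.
move=> a f g; rewrite !inE/= => -[cf f0] [cg g0]; split=> [t|t tI].
  by apply: cvgD; [apply: cvgZl_tmp; exact: cf|exact: cg].
by rewrite !fctE f0// g0// scaler0 addr0.
Qed.

HB.instance Definition _ :=
  GRing.isSubmodClosed.Build R (R -> E) continuous_on continuous_on_submod.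

Record cont_space := ContSpace {
  cont_fun :> R -> E;
  _ : cont_fun \in continuous_on }.

HB.instance Definition _ := [isSub for cont_fun].
HB.instance Definition _ := [Choice of cont_space by <:].
HB.instance Definition _ := [SubChoice_isSubLmodule of cont_space by <:].

Definition maxnorm (h : cont_space) : R :=
  sup [set `|h t| | t in `[0, T]%classic].

Lemma cont_spaceP (h : cont_space) :
  {within `[0, T], continuous h} /\ forall t, ~ `[0, T]%classic t -> h t = 0.
Proof. by have := valP h; rewrite inE. Qed.

Lemma maxnorm_has_ubound (h : cont_space) :
  has_ubound [set `|h t| | t in `[0, T]%classic].
Proof.
have [ch _] := cont_spaceP h.
have [M [_ hM]] := compact_bounded
  (continuous_compact ch (@segment_compact R 0 T)).
exists (M + 1) => _ [t tI <-].
by apply: (hM (M + 1)); [rewrite ltrDl|exists t].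
Qed.

Lemma le_maxnorm (h : cont_space) t : `[0, T]%classic t -> `|h t| <= maxnorm h.
Proof. by move=> tI; apply: (ub_le_sup (maxnorm_has_ubound h)); exists t. Qed.

Lemma maxnorm_ge0 (h : cont_space) : 0 <= maxnorm h.
Proof.
have [T0|T0] := leP 0 T.
  by rewrite (le_trans _ (@le_maxnorm h 0 _))//= in_itv/= lexx.
rewrite /maxnorm (_ : [set _ | _ in _] = set0) ?sup0//.
apply/seteqP; split=> // y [t /=]; rewrite in_itv/= => /andP[t0 tT].
by move: (le_lt_trans tT T0); rewrite ltNge t0.
Qed.

Lemma maxnorm_le (h : cont_space) M : 0 <= M ->
  (forall t, `[0, T]%classic t -> `|h t| <= M) -> maxnorm h <= M.
Proof.
move=> M0 hM; have [A0|/set0P A0] :=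
  eqVneq [set `|h t| | t in `[0, T]%classic] set0.
  by rewrite /maxnorm A0 sup0.
by apply: ge_sup => // _ [t tI <-]; exact: hM.
Qed.

Lemma maxnormD (f g : cont_space) : maxnorm (f + g) <= maxnorm f + maxnorm g.
Proof.
apply: maxnorm_le => [|t tI]; first by rewrite addr_ge0// maxnorm_ge0.
by rewrite (le_trans (ler_normD _ _))// lerD// le_maxnorm.
Qed.

Lemma maxnormZ_le (a : R) (f : cont_space) :
  maxnorm (a *: f) <= `|a| * maxnorm f.
Proof.
apply: maxnorm_le => [|t tI]; first by rewrite mulr_ge0// maxnorm_ge0.
by rewrite normrZ ler_wpM2l// le_maxnorm.
Qed.

Lemma maxnormZ (a : R) (f : cont_space) : maxnorm (a *: f) = `|a| * maxnorm f.
Proof.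
have [->|a0] := eqVneq a 0.
  apply/eqP; rewrite eq_le maxnormZ_le/= normr0 mul0r; exact: maxnorm_ge0.
apply/eqP; rewrite eq_le maxnormZ_le/=.
have := maxnormZ_le a^-1 (a *: f).
rewrite scalerA mulVf// scale1r normfV.
by rewrite ler_pdivlMl// normr_gt0.
Qed.

Lemma maxnorm_eq0 (f : cont_space) : maxnorm f = 0 -> f = 0.
Proof.
move=> f0; apply/val_inj/funext => t /=.
have [_ fI] := cont_spaceP f.
have [tI|/fI//] := pselect (`[0, T]%classic t).
by have := le_maxnorm f tI; rewrite f0 normr_le0 => /eqP.
Qed.

HB.instance Definition _ := Lmodule_isNormed.Build R cont_space
  maxnormD maxnormZ maxnorm_eq0.

End continuous_functions.

Section lebesgue_sigma_algebra.
Context {R : realType}.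

(* Caratheodory measurability for the outer measure induced by the length of
   intervals: these are the measurable sets of completed_lebesgue_measure. *)
Definition lebesgue_measurable (A : set R) :=
  ((@wlength R idfun)^*)%mu.-cara.-measurable A.

Lemma lebesgue_measurable_itv (i : interval R) : lebesgue_measurable [set` i].
Proof.
by apply: sub_caratheodory; exact: (@measurable_itv R i).
Qed.

(* ae_filter_ringOfSetsType does not unify with completed_lebesgue_measure. *)
#[global] Instance ae_filter_lebesgue :
  Filter (almost_everywhere (@completed_lebesgue_measure R)).
Proof.
exact: (@ae_filter_ringOfSetsType _ _ R (@completed_lebesgue_measure R)).
Qed.

End lebesgue_sigma_algebra.

#[global] Hint Extern 0 (Filter (nbhs (almost_everywhere _))) =>
  (apply: ae_filter_lebesgue) : typeclass_instances.

Section L1_space.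
Local Open Scope quotient_scope.
Context {R : realType} (T : R) (E : normedModType R).
Local Notation I := `[0, T]%classic.
Local Notation lambda := (@completed_lebesgue_measure R).

Let clambda := @completed_lebesgue_measure_is_complete R.

Let mI := lebesgue_measurable_itv `[0, T].

Definition bochner_on : {pred R -> E} :=
  mem [set w | bochner_integrable lambda I w].

Lemma bochner_on_submod : submod_closed bochner_on.
Proof.
split; rewrite ?inE /=; first exact: bochner_integrable0.
move=> a f g; rewrite !inE/=; exact: bochner_integrable_comb.
Qed.

HB.instance Definition _ :=
  GRing.isSubmodClosed.Build R (R -> E) bochner_on bochner_on_submod.

Record bochner_fun := BochnerFun {
  bochner_fun_fun :> R -> E;
  _ : bochner_fun_fun \in bochner_on }.

HB.instance Definition _ := [isSub for bochner_fun_fun].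
HB.instance Definition _ := [Choice of bochner_fun by <:].
HB.instance Definition _ := [SubChoice_isSubLmodule of bochner_fun by <:].

Lemma bochner_funP (w : bochner_fun) : bochner_integrable lambda I w.
Proof. by have := valP w; rewrite inE. Qed.

Definition null_fun : {pred bochner_fun} :=
  mem [set w : bochner_fun | {ae lambda, forall t, I t -> w t = 0}].

Lemma null_fun_submod : submod_closed null_fun.
Proof.
split; rewrite ?inE /=; first exact: aeW.
move=> a f g; rewrite !inE/=; apply: filterS2 => t f0 g0 It.
by rewrite !fctE f0// g0// scaler0 addr0.
Qed.

HB.instance Definition _ :=
  GRing.isSubmodClosed.Build R bochner_fun null_fun null_fun_submod.

Definition L1 : Type := {ideal_quot null_fun}.

HB.instance Definition _ := GRing.Zmodule.on L1.
HB.instance Definition _ := EqQuotient.on L1.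

(* A class acts as a function through a chosen representative. *)
Definition L1_fun (w : L1) : R -> E := repr w.
Coercion L1_fun : L1 >-> Funclass.

Lemma L1_eqP (f g : bochner_fun) :
  \pi_L1 f = \pi_L1 g <-> {ae lambda, forall t, I t -> f t = g t}.
Proof.
split.
  move/eqP; rewrite piE Quotient.equivE inE /=.
  apply: filterS => t /[apply] /eqP; rewrite subr_eq0 => /eqP//.
move=> fg; apply/eqP; rewrite piE Quotient.equivE inE /=.
by apply: filterS fg => t /[apply] /eqP; rewrite -subr_eq0 => /eqP.
Qed.

Definition L1_scale (a : R) (w : L1) : L1 := \pi_L1 (a *: repr w).

Lemma L1_scale_pi a f : L1_scale a (\pi_L1 f) = \pi_L1 (a *: f).
Proof.
apply/L1_eqP; have /L1_eqP := reprK (\pi_L1 f).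
apply: filterS => t wf It.
by change (a *: repr (\pi_L1 f) t = a *: f t); rewrite wf.
Qed.

Lemma L1_piD f g : \pi_L1 (f + g) = \pi_L1 f + \pi_L1 g.
Proof. exact: Quotient.pi_add. Qed.

Lemma L1_ex (w : L1) : exists f, w = \pi_L1 f.
Proof. by exists (repr w); rewrite reprK. Qed.

Lemma L1_scaleA a b w : L1_scale a (L1_scale b w) = L1_scale (a * b) w.
Proof.
have [f ->] := L1_ex w.
by rewrite (L1_scale_pi b f) (L1_scale_pi a (b *: f)) (L1_scale_pi _ f) scalerA.
Qed.

Lemma L1_scale1 : left_id 1 L1_scale.
Proof. by move=> w; have [f ->] := L1_ex w; rewrite (L1_scale_pi 1 f) scale1r. Qed.

Lemma L1_scaleDr : right_distributive L1_scale +%R.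
Proof.
move=> a u v; have [f ->] := L1_ex u; have [g ->] := L1_ex v.
rewrite -L1_piD (L1_scale_pi a f) (L1_scale_pi a g) (L1_scale_pi a (f + g)).
by rewrite scalerDr L1_piD.
Qed.

Lemma L1_scaleDl w : {morph L1_scale^~ w : a b / a + b}.
Proof.
move=> a b; have [f ->] := L1_ex w.
rewrite (L1_scale_pi a f) (L1_scale_pi b f) (L1_scale_pi (a + b) f).
by rewrite scalerDl L1_piD.
Qed.

HB.instance Definition _ := GRing.Zmodule_isLmodule.Build R L1
  L1_scaleA L1_scale1 L1_scaleDr L1_scaleDl.

Definition L1_norm (w : L1) : R :=
  fine (\int[lambda]_(t in I) `|w t|%:E)%E.

Lemma L1_norm_pi f :
  L1_norm (\pi_L1 f) = fine (\int[lambda]_(t in I) `|f t|%:E)%E.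
Proof.
congr fine; apply: integral_norm_ae => //.
- by have [] := bochner_funP (repr (\pi_L1 f)).
- by have [] := bochner_funP f.
- by apply/L1_eqP; rewrite reprK.
Qed.

Lemma L1_normD u v : L1_norm (u + v) <= L1_norm u + L1_norm v.
Proof.
have [f ->] := L1_ex u; have [g ->] := L1_ex v.
rewrite -L1_piD (L1_norm_pi f) (L1_norm_pi g) (L1_norm_pi (f + g)).
have fin (h : bochner_fun) := bochner_integrable_fin clambda mI (bochner_funP h).
rewrite -lee_fin EFinD (fineK (fin (f + g))) (fineK (fin f)) (fineK (fin g)).
have [[mf _] [mg _]] := (bochner_funP f, bochner_funP g).
have := integral_norm_comb clambda mI 1 mf mg.
by rewrite scale1r normr1 mul1e.
Qed.

Lemma L1_normZ a w : L1_norm (a *: w) = `|a| * L1_norm w.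
Proof.
have [f ->] := L1_ex w.
rewrite (L1_scale_pi a f : a *: \pi_L1 f = _).
rewrite (L1_norm_pi f) (L1_norm_pi (a *: f)).
have fin (h : bochner_fun) := bochner_integrable_fin clambda mI (bochner_funP h).
have mf := measurable_normE clambda mI (bochner_funP f).1.
apply: EFin_inj; rewrite EFinM (fineK (fin (a *: f))) (fineK (fin f)).
rewrite -(ge0_integralZl _ mI mf)//.
by apply: eq_integral => t _; rewrite -EFinM -normrZ.
Qed.

Lemma L1_norm_eq0 w : L1_norm w = 0 -> w = 0.
Proof.
have [f ->] := L1_ex w; rewrite (L1_norm_pi f) => f0.
have fin := bochner_integrable_fin clambda mI (bochner_funP f).
transitivity (\pi_L1 0); last exact: (esym (piE _)).
apply/L1_eqP; apply: (integral_norm_eq0 clambda mI).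
  by have [] := bochner_funP f.
by rewrite -(fineK fin) f0.
Qed.

HB.instance Definition _ := Lmodule_isNormed.Build R L1
  L1_normD L1_normZ L1_norm_eq0.

End L1_space.

Section volterra_inclusion.
Context {R : realType} {T : R} {E : normedModType R}.
Local Notation I := `[0, T]%classic.
Local Notation lambda := (@completed_lebesgue_measure R).

Definition kernel_ext (k : R -> R -> bounded_endo E) (t : R) :
    R -> bounded_endo E := patch (fun=> 0) `[0, t] (k t).

Definition solution_set (F : R -> E -> set E) (k : R -> R -> bounded_endo E)
    (h : cont_space T E) : set (L1 T E) :=
  [set w | {ae lambda, forall t, I t ->
     F t (h t + bochner_integral lambda `[0, t] (fun s => k t s (w s))) (w t)}].

End volterra_inclusion.

(* Main.v *)
(** Integrable functions are glued along a parameter p as follows. Nonnegative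
    weights at p cut [0, 1] into intervals, and the glued function takes at t the
    value of its m-th piece when the fractional part of nu(p) t lies in the m-th
    interval. At almost every t it is locally constant in p, hence it depends
    continuously on p in L^1.

    Gluing measurable selections of F that are nearly closest to the current
    approximate solution gives a correction step whose defect is a prescribed
    continuous tolerance. The increments satisfy
      e_(n+1)(t) <= gamma(t) (K int_0^t e_n + c / 2^n),
    so iterating with tolerances delta / 2^n converges in L^1, locally uniformly
    in p, to exact solutions. With p = h in C(I, E) this is the continuous
    selection.

    For the retract property, let A be a closed copy of the solution set in a
    metric space Y and phi : A -> L^1 the inclusion. Off A, glue the functions
    phi(a_m), a_m dense in A, with weights supported in d(y, a_m) < 2 d(y, A) and
    frequencies nu(y) so high that
      int_(frac(nu t) in [a, b)) |phi(a_m) - phi(a_j)|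
        <= (b - a + 2^-m) int |phi(a_m) - phi(a_j)|
    for the pieces in use. Then the glued function tends to phi(a) as y -> a in A,
    its defect tends to 0, and correcting it with tolerance d(y, A) extends phi
    continuously by solutions. *)
Require Import Defs.
From mathcomp Require Import all_boot all_order all_algebra.
From mathcomp Require Import all_classical all_reals all_analysis.
From mathcomp Require Import ess_sup_inf measurable_realfun lra.

Set Implicit Arguments.
Unset Strict Implicit.
Unset Printing Implicit Defensive.

Import Order.TTheory GRing.Theory Num.Theory.
Import numFieldNormedType.Exports.

Local Open Scope classical_set_scope.
Local Open Scope ring_scope.

(** What survives is decomposability: a function that agrees at each t with one of several
    selections of [F] is again a selection. Hence weights become lengths of time intervals. The
    price is paid in L^1: a function glued from n pieces, each within D of v, can be n D away from
    v, and n is unbounded as y approaches A. Equidistribution replaces n D by 3 D, which is why the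
    frequency must grow. In the correction steps all estimates are pointwise in t, so frequency 1
    suffices there. Nearest points of F(t, x) need not exist, as closed bounded sets need not be
    compact; this forces selections with a tolerance. The constant K need not be small. The integral
    in the increment inequality runs over [0, t] only, so [0, T] can be cut into finitely many cells
    on which K int gamma <= 1/4; this gives decay at rate 2^-n with a constant that depends on gamma
    and K alone. Here gamma = 1 + |alpha| + |beta|. *)

Lemma countable_enum {T : choiceType} (A : set T) (x0 : T) :
  countable A -> exists e : nat -> T, forall x, A x -> exists n, e n = x.
Proof.
move=> /countable_injP[f finj].
exists (fun n => xget x0 [set x | A x /\ f x = n]) => x Ax; exists (f x).
by case: xgetP => [y _ [Ay fyx]|/(_ x)/not_andP[]//]; apply: finj; rewrite ?inE.
Qed.

Lemma separable_enum {X : topologicalType} (x0 : X) : separable X ->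
  exists e : nat -> X, forall U, open U -> U !=set0 -> exists n, U (e n).
Proof.
move=> [S cS dS]; have [e eS] := countable_enum x0 cS.
exists e => U oU U0; have [x [Ux Sx]] := dS _ U0 oU.
by have [n enx] := eS _ Sx; exists n; rewrite enx.
Qed.

(** * Simple functions and gluing of measurable functions *)

Section simple_functions.
Context d {T : measurableType d}.

Lemma simple_fun_in (B : set T) : measurable B ->
  simple_fun (fun t => t \in B).
Proof.
move=> mB; split.
  by apply: (@sub_finite_set _ _ setT) => //; exact: finite_finset.
case.
  by rewrite (_ : _ @^-1` _ = B)//; apply/seteqP; split=> t /=;
    [exact: set_mem|exact: mem_set].
rewrite (_ : _ @^-1` _ = ~` B); first exact: measurableC.
by apply/seteqP; split=> t /=; [move/negbT; rewrite notin_setE|exact: memNset].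
Qed.

Lemma simple_fun_if {V : Type} (B : set T) (s1 s2 : T -> V) :
  measurable B -> simple_fun s1 -> simple_fun s2 ->
  simple_fun (fun t => if t \in B then s1 t else s2 t).
Proof.
move=> mB ss1 ss2.
exact: (simple_fun_op2 (fun (b : bool) (p : V * V) => if b then p.1 else p.2)
  (simple_fun_in mB) (simple_fun_op2 pair ss1 ss2)).
Qed.

Lemma simple_fun_comp {V W : Type} (g : V -> W) (s : T -> V) :
  simple_fun s -> simple_fun (fun t => g (s t)).
Proof. by move=> ss; exact: (simple_fun_op2 (fun x _ => g x) ss ss). Qed.

Lemma measurable_fun_glue {R : realType} (D : set T) (c : T -> nat)
    (g : nat -> T -> R) : measurable D ->
  (forall n, measurable (D `&` c @^-1` [set n])) ->
  (forall n, measurable_fun D (g n)) -> measurable_fun D (fun t => g (c t) t).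
Proof.
move=> mD mc mg _ B mB.
rewrite (_ : _ `&` _ = \bigcup_n ((D `&` c @^-1` [set n]) `&` (D `&` g n @^-1` B))).
  by apply: bigcup_measurable => n _; apply: measurableI => //; exact: mg.
apply/seteqP; split=> [t [Dt gt]|t [n _ [[Dt cn] [_ gt]]]].
  by exists (c t) => //; do !split.
by split => //=; rewrite cn.
Qed.

End simple_functions.

(** * Strong measurability and the Bochner integral *)

Section strong_measurability.
Context d {T : measurableType d} {R : realType} (mu : {measure set T -> \bar R}).
Variable D : set T.
Hypothesis cmu : measure_is_complete mu.
Hypothesis mD : measurable D.

(** Off the exceptional null set this is a pointwise limit; on it, completeness of [mu] makes every
    preimage measurable. *)
Lemma ae_measurable_fun_cvg (f : nat -> T -> R) (g : T -> R) :
  (forall n, measurable_fun D (f n)) ->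
  {ae mu, forall t, D t -> f n t @[n --> \oo] --> g t} -> measurable_fun D g.
Proof.
move=> mf [A [mA A0 sf]].
rewrite -[in X in measurable_fun X _](setUIDK D A) setUC.
apply/measurable_funU => //; [exact: measurableD|exact: measurableI|split].
- apply: (@measurable_fun_cvg _ _ _ _ f) => [n|t [Dt At]].
    by apply: measurable_funS (mf n) => //; exact: subDsetl.
  apply: contrapT => nsf; apply/At/sf => /= h.
  by apply: nsf; exact: h.
- move=> _ B mB; apply: cmu; exists A; split => //.
  by apply: subset_trans (@subIsetl _ _ _) _; exact: subIsetr.
Qed.

Context {E : completeNormedModType R}.
Hypothesis sepE : separable E.
Implicit Types f g : T -> E.

Lemma strongly_measurableB {V : normedModType R} (f g : T -> V) :
  strongly_measurable mu D f ->
  strongly_measurable mu D g -> strongly_measurable mu D (fun t => f t - g t).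
Proof.
move=> mf mg; have := strongly_measurable_comb (-1) mg mf.
congr strongly_measurable; apply/funext => t.
by rewrite !fctE scaleN1r addrC.
Qed.

Lemma measurable_dist f g : strongly_measurable mu D f ->
  strongly_measurable mu D g -> measurable_fun D (fun t => `|f t - g t|).
Proof.
by move=> mf mg; apply: measurable_norm cmu mD _ _; exact: strongly_measurableB.
Qed.

Lemma measurable_distc f y : strongly_measurable mu D f ->
  measurable_fun D (fun t => `|f t - y|).
Proof.
move=> mf; apply: (measurable_dist mf).
exact/simple_strongly_measurable/simple_fun_cst.
Qed.

(* The approximation s n takes the nearest value of f among the first n terms
   of a dense sequence starting at 0. *)
Lemma pettis f : (forall y, measurable_fun D (fun t => `|f t - y|)) ->
  exists s : nat -> T -> E, [/\ forall n, simple_fun (s n),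
    forall t, D t -> s n t @[n --> \oo] --> f t &
    forall n t, D t -> `|s n t - f t| <= `|f t|].
Proof.
move=> mf; have [e' de'] := separable_enum (0 : E) sepE.
(* The extra term 0 makes the error of the nearest value at most [|f t|], the domination used for
   integrability. *)
pose e n := if n is m.+1 then e' m else 0.
pose fix c n : T -> nat := if n is m.+1 then
  (fun t => if t \in D `&` [set t | `|f t - e m| < `|f t - e (c m t)|]
            then m else c m t) else fun=> 0%N.
have sc n : simple_fun (c n).
  elim: n => [|n [fc mc]]; first exact: simple_fun_cst.
  apply: simple_fun_if; [|exact: simple_fun_cst|exact: (conj fc mc)].
  rewrite [X in measurable X](_ : _ =
    D `&` (fun t => `|f t - e n| < `|f t - e (c n t)|) @^-1` [set true])//.
  apply: (measurable_fun_ltr (mf _)) => //.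
  apply: (@measurable_fun_glue _ _ _ _ (c n) (fun k t => `|f t - e k|)) => //.
  by move=> k; apply: measurableI.
have cle n t : D t -> forall k, (k < n)%N -> `|f t - e (c n t)| <= `|f t - e k|.
  move=> Dt; elim: n => // n IHn k; rewrite ltnS leq_eqVlt => kn /=.
  have [tB|] := boolP (t \in _).
    move: tB; rewrite inE => -[_ /= lt1]; have [/eqP->//|kn'] := orP kn.
    exact: le_trans (ltW lt1) (IHn _ kn').
  rewrite notin_setE => /= tB; have [/eqP->//|kn'] := orP kn; last exact: IHn.
  by rewrite leNgt; apply/negP => lt1; exact: tB.
exists (fun n t => e (c n t)); split=> [n|t Dt|n t Dt].
- exact: simple_fun_comp.
- apply/cvgrPdist_lt => eps eps0.
  have oB : open (ball (f t) eps) by exact: ball_open.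
  have [|m fm] := de' _ oB; first by exists (f t); exact: ballxx.
  exists m.+2 => // n /= mn; apply: le_lt_trans (cle n t Dt m.+1 mn) _.
  by move: fm; rewrite -ball_normE.
- rewrite distrC; case: n => [|n]; first by rewrite subr0.
  by have := cle n.+1 t Dt 0%N isT; rewrite /= subr0.
Qed.

(** Separability reduces strong measurability to the scalar functions [|f t - y|], so that limits
    and countable gluings follow from the real-valued case. *)
Lemma strongly_measurable_pettis f :
  (forall y, measurable_fun D (fun t => `|f t - y|)) ->
  strongly_measurable mu D f.
Proof.
by move=> /pettis[s [ss sf _]]; exists s; split => //; exact: aeW.
Qed.

Lemma strongly_measurable_ae_cvg (f : nat -> T -> E) g :
  (forall n, strongly_measurable mu D (f n)) ->
  {ae mu, forall t, D t -> f n t @[n --> \oo] --> g t} ->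
  strongly_measurable mu D g.
Proof.
move=> mf fg; apply: strongly_measurable_pettis => y.
apply: (@ae_measurable_fun_cvg (fun n t => `|f n t - y|)).
  by move=> n; exact: measurable_distc.
apply: filterS fg => t fg Dt; apply: cvg_norm.
by apply: cvgB; [exact: fg|exact: cvg_cst].
Qed.

Lemma strongly_measurable_glue (c : T -> nat) (f : nat -> T -> E) :
  (forall n, measurable (D `&` c @^-1` [set n])) ->
  (forall n, strongly_measurable mu D (f n)) ->
  strongly_measurable mu D (fun t => f (c t) t).
Proof.
move=> mc mf; apply: strongly_measurable_pettis => y.
apply: (@measurable_fun_glue _ _ _ _ c (fun n t => `|f n t - y|)) => // n.
exact: measurable_distc.
Qed.

(** The approximations of [pettis] satisfy [|s n - f| <= |f|]. Hence [|s n| <= 2 |f|], and dominated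
    convergence applies with majorant [|f|]. *)
Lemma bochner_integrable_fin_norm f : strongly_measurable mu D f ->
  (\int[mu]_(t in D) `|f t|%:E < +oo)%E -> bochner_integrable mu D f.
Proof.
move=> mf foo; split => //.
have [s [ss sf sle]] := pettis (fun y => measurable_distc y mf).
exists s; have mss n := simple_strongly_measurable mu D (ss n).
have mnf := measurable_normE cmu mD mf.
split => // [n|].
- apply: (@le_lt_trans _ _ (\int[mu]_(t in D) (2%:E * `|f t|%:E))%E).
    apply: ge0_le_integral => //.
    + have := measurable_normE cmu mD (mss n).
      exact.
    + exact: measurable_funeM.
    + move=> t Dt; rewrite -EFinM lee_fin mulr_natl mulr2n.
      by rewrite -[s n t](subrK (f t)) (le_trans (ler_normD _ _))// lerD2r sle.
  by rewrite ge0_integralZl// lte_mul_pinfty.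
- have [|||||_ _] := @dominated_convergence _ _ _ mu D mD
    (fun n t => `|f t - s n t|%:E) (fun=> 0%E) (fun t => `|f t|%:E).
  + by move=> n; apply/measurable_EFinP; exact: measurable_dist.
  + exact: measurable_cst.
  + apply: aeW => t Dt; apply/fine_cvgP; split; first exact: nearW.
    rewrite -[X in _ --> X](normr0 E) -[in X in _ --> X](subrr (f t)).
    by apply: cvg_norm; apply: cvgB; [exact: cvg_cst|exact: sf].
  + apply/integrableP; split => //.
    by under eq_integral do rewrite abse_EFin normr_id.
  + apply: aeW => t n Dt; rewrite abse_EFin normr_id lee_fin distrC.
    exact: sle.
  by rewrite integral0.
Qed.

End strong_measurability.

Lemma cvge_lt_near {R : realType} {I : Type} (F : set_system I) {FF : Filter F}
    (u : I -> \bar R) (l x : \bar R) :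
  u n @[n --> F] --> l -> (l < x)%E -> \forall n \near F, (u n < x)%E.
Proof. by move=> ul lx; have := ul _ (open_ereal_lt' lx). Qed.

Section simple_integral.
Context d {T : measurableType d} {R : realType} (mu : {measure set T -> \bar R}).
Context {E : normedModType R}.
Variable D : set T.
Hypothesis mD : measurable D.
Hypothesis muD : (mu D < +oo)%E.
Implicit Types s : T -> E.

Let fin_muI (A : set T) : measurable A -> mu (D `&` A) \is a fin_num.
Proof.
move=> mA; rewrite ge0_fin_numE//; apply: le_lt_trans muD.
by apply: le_measure; rewrite ?inE//; exact: measurableI.
Qed.

(** The level sets of [p] refine those of [g \o p]. Pairing two simple functions into one [p] puts
    both on a common partition, where the integral is additive. *)
Lemma simple_integral_comp {V : choiceType} (p : T -> V) (g : V -> E) :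
  simple_fun p -> simple_integral mu D (g \o p) =
  \sum_(v \in range p) fine (mu (D `&` p @^-1` [set v])) *: g v.
Proof.
move=> [fp mp]; have sgp : simple_fun (g \o p).
  exact: simple_fun_comp (conj fp mp).
have [fgp mgp] := sgp.
pose F v y := fine (mu (D `&` (p @^-1` [set v] `&` (g \o p) @^-1` [set y]))) *: y.
transitivity (\sum_(y \in range (g \o p)) \sum_(v \in range p) F v y).
  apply: eq_fsbigr => y _; rewrite fsbig_finite//= /F -scaler_suml; congr (_ *: _).
  rewrite -fsbig_finite//= (_ : D `&` (g \o p) @^-1` [set y] =
    \bigcup_(v in range p)
      (D `&` (p @^-1` [set v] `&` (g \o p) @^-1` [set y]))); last first.
    apply/seteqP; split=> [t [Dt gpt]|t [v _ [Dt [_ ?]]]//].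
    by exists (p t) => //; exists t.
  rewrite measure_fin_bigcup//.
  - rewrite fsbig_finite//= fsbig_finite//= -sum_fine// => v _.
    by apply: fin_muI; exact: measurableI.
  - by move=> v w _ _ [t [[_ [<- _]] [_ [<- _]]]].
  - by move=> v _; apply: measurableI => //; exact: measurableI.
(* For a fixed value [v] of [p], only [y = g v] gives a nonempty joint level set. *)
rewrite exchange_fsbig//; apply: eq_fsbigr => v /set_mem[t _ <-].
rewrite (fsbigD1 (g (p t)))//.
rewrite fsbig1 => [|y [_ /= yg]]; last first.
  rewrite /F (_ : _ `&` _ = set0) ?setI0 ?measure0 ?scale0r//.
  by apply/seteqP; split=> // u [_ [/= pu gu]]; apply: yg; rewrite /= -gu pu.
rewrite /= /F addr0; congr (fine (mu (D `&` _)) *: _).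
by apply/seteqP; split=> [u []//|u /= pu]; split => //=; rewrite pu.
Qed.

Lemma simple_integralB s s' : simple_fun s -> simple_fun s' ->
  simple_integral mu D (fun t => s t - s' t) =
  simple_integral mu D s - simple_integral mu D s'.
Proof.
move=> ss ss'; pose p t := (s t, s' t).
have sp : simple_fun p by exact: simple_fun_op2.
have [fp _] := sp.
rewrite (_ : s = fst \o p)// (_ : s' = snd \o p)//.
rewrite (_ : (fun t => _) = (fun v => v.1 - v.2) \o p)//.
rewrite !simple_integral_comp// !fsbig_finite//= -sumrB.
by apply: eq_bigr => v _; rewrite scalerBr.
Qed.

Lemma simple_integral_norm s : simple_fun s ->
  (`|simple_integral mu D s|%:E <= \int[mu]_(t in D) `|s t|%:E)%E.
Proof.
move=> [fs ms].
have sE t : `|s t|%:E =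
    (\sum_(y \in range s) (`|y| * \1_(s @^-1` [set y]) t)%:E)%E.
  rewrite (fsbigD1 (s t))//.
  rewrite fsbig1 => [|y [_ /= ys]]; last first.
    by rewrite indicE memNset ?mulr0// => /= st; apply: ys; rewrite st.
  by rewrite /= adde0 indicE mem_set//= mulr1.
under eq_integral => t _ do rewrite sE.
rewrite ge0_integral_fsum//; last first.
  move=> y; apply/measurable_EFinP; exact: measurable_funM.
have intE y : (\int[mu]_(t in D) (`|y| * \1_(s @^-1` [set y]) t)%:E =
    `|y|%:E * mu (D `&` s @^-1` [set y]))%E.
  rewrite (@integralZl_indic _ _ _ mu D mD (fun=> s @^-1` [set y]) `|y|)//.
    by rewrite integral_indic// setIC.
  by rewrite normr_lt0.
under eq_fsbigr => y _ do rewrite intE.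
rewrite /simple_integral !fsbig_finite//=.
set r := finmap.enum_fset _.
have := ler_norm_sum r (fun y => fine (mu (D `&` s @^-1` [set y])) *: y)
  xpredT; rewrite -lee_fin => /le_trans; apply.
  rewrite -sumEFin; apply: lee_sum => y _.
rewrite normrZ ger0_norm ?fine_ge0// EFinM fineK; last exact: fin_muI.
by rewrite muleC.
Qed.

Lemma simple_integral_dist s s' : simple_fun s -> simple_fun s' ->
  (`|simple_integral mu D s - simple_integral mu D s'|%:E <=
   \int[mu]_(t in D) `|s t - s' t|%:E)%E.
Proof.
move=> ss ss'; rewrite -simple_integralB//; apply: simple_integral_norm.
exact: (simple_fun_op2 (fun u v => u - v)).
Qed.

End simple_integral.

Section bochner_integral.
Context d {T : measurableType d} {R : realType} (mu : {measure set T -> \bar R}).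
Context {E : completeNormedModType R}.
Variable D : set T.
Hypothesis cmu : measure_is_complete mu.
Hypothesis mD : measurable D.
Hypothesis muD : (mu D < +oo)%E.
Implicit Types f g : T -> E.

Lemma integral_dist_triangle f g h : strongly_measurable mu D f ->
  strongly_measurable mu D g -> strongly_measurable mu D h ->
  (\int[mu]_(t in D) `|f t - h t|%:E <=
   \int[mu]_(t in D) `|f t - g t|%:E + \int[mu]_(t in D) `|g t - h t|%:E)%E.
Proof.
move=> mf mg mh.
have := integral_norm_comb cmu mD 1 (strongly_measurableB mf mg)
  (strongly_measurableB mg mh).
rewrite normr1 mul1e; apply: le_trans.
rewrite le_eqVlt; apply/orP; left; apply/eqP; apply: eq_integral => t _.
by rewrite !fctE scale1r addrA subrK.
Qed.

Lemma integral_distC f g : (\int[mu]_(t in D) `|f t - g t|%:E =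
  \int[mu]_(t in D) `|g t - f t|%:E)%E.
Proof. by apply: eq_integral => t _; rewrite distrC. Qed.

(** One estimate serves twice: with [f = g] it makes the simple integrals Cauchy and their limit
    independent of the approximation; in general it passes to the limit as the L^1 bound for the
    integral. *)
Lemma bochner_approx_dist f g s s' m n :
  strongly_measurable mu D f -> strongly_measurable mu D g ->
  bochner_approx mu D f s -> bochner_approx mu D g s' ->
  (`|simple_integral mu D (s m) - simple_integral mu D (s' n)|%:E <=
   \int[mu]_(t in D) `|f t - g t|%:E +
   (\int[mu]_(t in D) `|f t - s m t|%:E +
    \int[mu]_(t in D) `|g t - s' n t|%:E))%E.
Proof.
move=> mf mg [ss _ _] [ss' _ _].
apply: le_trans (simple_integral_dist mD muD (ss m) (ss' n)) _.
have ms := simple_strongly_measurable mu D (ss m).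
have ms' := simple_strongly_measurable mu D (ss' n).
apply: le_trans (integral_dist_triangle ms mf ms') _.
rewrite addeCA integral_distC leeD2l//.
exact: integral_dist_triangle.
Qed.

(** The integral is a chosen limit along some approximating sequence. Completeness of [E] shows that
    such a limit exists, and [small] transfers it to every other approximating sequence. *)
Lemma bochner_integral_cvg f s : bochner_integrable mu D f ->
  bochner_approx mu D f s ->
  simple_integral mu D (s n) @[n --> \oo] --> bochner_integral mu D f.
Proof.
move=> [mf _].
have small s' s'' : bochner_approx mu D f s' -> bochner_approx mu D f s'' ->
    forall eps, 0 < eps -> \forall n \near \oo, forall m, (n <= m)%N ->
      `|simple_integral mu D (s' n) - simple_integral mu D (s'' m)| < eps.
  move=> as' as'' eps eps0.
  have e2 : (0 < (eps / 2)%:E)%E by rewrite lte_fin divr_gt0.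
  have [_ _ /cvge_lt_near/(_ e2) H'] := as'.
  have [_ _ /cvge_lt_near/(_ e2)[N _ H'']] := as''.
  near=> n => m nm; rewrite -lte_fin.
  apply: le_lt_trans (bochner_approx_dist n m mf mf as' as'') _.
  under eq_integral do rewrite subrr normr0; rewrite integral0 add0e.
  rewrite [eps]splitr EFinD lteD//; first by near: n.
  apply: H'' => /=; apply: leq_trans nm; near: n.
  exact: nbhs_infty_ge.
have get_lim s' : bochner_approx mu D f s' ->
    cvgn (fun n => simple_integral mu D (s' n)).
  move=> as'; apply/cauchy_cvgP/cauchy_exP => eps eps0.
  have [N _ /(_ N (leqnn N)) HN] := small _ _ as' as' _ eps0.
  exists (simple_integral mu D (s' N)); exists N => // m /= Nm.
  by rewrite -ball_normE /=; exact: HN.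
move=> as_; pose P (x : E) := exists s0, bochner_approx mu D f s0 /\
   simple_integral mu D (s0 n) @[n --> \oo] --> x.
have : P (get P).
  apply: getPex; exists (limn (fun n => simple_integral mu D (s n))).
  by exists s; split => //; exact: get_lim.
move=> [s0 [as0 s0x]]; rewrite /bochner_integral -/P.
apply/cvgrPdist_lt => eps eps0; have e2 : 0 < eps / 2 by rewrite divr_gt0.
have H := small _ _ as0 as_ _ e2.
move/cvgrPdist_lt : s0x => /(_ _ e2) s0x.
near=> n; rewrite -(subrK (simple_integral mu D (s0 n)) (get P)) -addrA.
rewrite (le_lt_trans (ler_normD _ _))// [eps]splitr ltrD//; first by near: n.
have /(_ n) : forall m, (n <= m)%N -> `|simple_integral mu D (s0 n) -
  simple_integral mu D (s m)| < eps / 2 by near: n.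
by apply.
Unshelve. all: by end_near. Qed.

Lemma bochner_integral_dist f g : bochner_integrable mu D f ->
  bochner_integrable mu D g ->
  (`|bochner_integral mu D f - bochner_integral mu D g|%:E <=
   \int[mu]_(t in D) `|f t - g t|%:E)%E.
Proof.
move=> bf bg; have [mf [s as_]] := bf; have [mg [s' as']] := bg.
have cs := bochner_integral_cvg bf as_; have cs' := bochner_integral_cvg bg as'.
apply/lee_addgt0Pr => eps eps0.
have e2 : (0 < (eps / 2)%:E)%E by rewrite lte_fin divr_gt0.
have H : `|simple_integral mu D (s n) - simple_integral mu D (s' n)|%:E
    @[n --> \oo] -->
    `|bochner_integral mu D f - bochner_integral mu D g|%:E.
  apply: cvg_EFin; first by near=> n.
  by apply: cvg_norm; apply: cvgB; [exact: cs|exact: cs'].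
have [_ _ /cvge_lt_near/(_ e2) H'] := as_.
have [_ _ /cvge_lt_near/(_ e2) H''] := as'.
apply: (cvge_le _ H); near=> n.
apply: le_trans (bochner_approx_dist n n mf mg as_ as') _.
rewrite leeD2l// [eps]splitr EFinD leeD//; apply: ltW; by near: n.
Unshelve. all: by end_near. Qed.

End bochner_integral.

(** * Completeness of L^1 and its elements as classes *)

Section L1_completeness.
Context d {T : measurableType d} {R : realType} (mu : {measure set T -> \bar R}).
Context {E : completeNormedModType R}.
Variable D : set T.
Hypothesis cmu : measure_is_complete mu.
Hypothesis mD : measurable D.
Hypothesis sepE : separable E.

Lemma nneseries_geometric_le (u : nat -> \bar R) (C : R) :
  (forall k, 0 <= u k)%E -> (forall k, u k <= (C / 2 ^+ k)%:E)%E ->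
  (\sum_(0 <= k <oo) u k <= (2 * C)%:E)%E.
Proof.
move=> u0 uC; have C0 : 0 <= C.
  by rewrite -lee_fin (le_trans (u0 0%N))// (le_trans (uC 0%N))// expr0 divr1.
have part m : (\sum_(0 <= k < m) u k <= (2 * C - 2 * C / 2 ^+ m)%:E)%E.
  elim: m => [|m IHm]; first by rewrite big_geq// expr0 divr1 subrr.
  rewrite big_nat_recr//=; apply: le_trans (leeD IHm (uC m)) _.
  have p0 : (2 ^+ m : R) != 0 by rewrite expf_neq0.
  by rewrite -EFinD lee_fin exprS invfM; lra.
apply: lime_le; first by apply: is_cvg_nneseries => k _.
apply: nearW => m; apply: le_trans (part m) _.
by rewrite lee_fin gerBl divr_ge0// ?mulr_ge0// exprn_ge0.
Qed.

(** Riesz-Fischer: the series [S 0] of the increments has finite integral, hence is finite almost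
    everywhere, and there [g n t] is Cauchy. The tail [S n] dominates the distance from [g n] to the
    limit. *)
Lemma bochner_integrable_complete (g : nat -> T -> E) (C : R) :
  (forall n, bochner_integrable mu D (g n)) ->
  (forall n, \int[mu]_(t in D) `|g n.+1 t - g n t|%:E <= (C / 2 ^+ n)%:E)%E ->
  exists f, [/\ bochner_integrable mu D f,
    {ae mu, forall t, D t -> g n t @[n --> \oo] --> f t} &
    forall n, (\int[mu]_(t in D) `|f t - g n t|%:E <=
      (2 * C / 2 ^+ n)%:E)%E].
Proof.
move=> bg gC; have mg n : strongly_measurable mu D (g n) by have [] := bg n.
pose e k t := `|g k.+1 t - g k t|%:E.
have e0 k t : (0 <= e k t)%E by rewrite lee_fin.
have me k : measurable_fun D (e k).
  by apply/measurable_EFinP; exact: (measurable_dist cmu mD (mg k.+1) (mg k)).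
pose S n t := (\sum_(0 <= k <oo) e (n + k)%N t)%E.
have S0 n t : (0 <= S n t)%E by apply: nneseries_ge0.
have mS n : measurable_fun D (S n).
  by apply: ge0_emeasurable_sum => // k t _ _.
have intS n : (\int[mu]_(t in D) S n t <= (2 * C / 2 ^+ n)%:E)%E.
  rewrite /S integral_nneseries//.
  rewrite -mulrA; apply: nneseries_geometric_le => k.
    by apply: integral_ge0.
  by rewrite -mulrA -invfM -exprD; exact: gC.
have dist_le n m t : (`|g (n + m)%N t - g n t|%:E <= S n t)%E.
  apply: (@le_trans _ _ (\sum_(0 <= k < m) e (n + k)%N t)%E); last first.
    by apply: nneseries_lim_ge.
  elim: m => [|m IHm]; first by rewrite addn0 subrr normr0 big_geq.
  rewrite big_nat_recr//= addnS -(subrK (g (n + m)%N t) (g (n + m).+1 t)).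
  rewrite -addrA addeC; apply: le_trans (leeD2l _ IHm).
  by rewrite -EFinD lee_fin ler_normD.
have S_fin : {ae mu, forall t, D t -> S 0%N t \is a fin_num}.
  apply: integrable_ae => //; apply/integrableP; split => //.
  under eq_integral => t _ do rewrite gee0_abs//.
  by apply: le_lt_trans (intS 0%N) _; rewrite ltry.
have gcvg t : S 0%N t \is a fin_num -> cvgn (g ^~ t).
  move=> fin; apply/cauchy_cvgP/cauchy_exP => eps eps0.
  have cS : (\sum_(0 <= k < n) e k t)%E @[n --> \oo] --> S 0%N t.
    by apply: is_cvg_nneseries.
  have finS : S 0%N t = (fine (S 0%N t))%:E by rewrite fineK.
  (* Bounding partial sum plus distance by [S 0] turns convergence of the partial sums into the
     Cauchy estimate. *)
  have sub n m : (\sum_(0 <= k < n) e k t + `|g (n + m)%N t - g n t|%:E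
      <= S 0%N t)%E.
    apply: (@le_trans _ _ (\sum_(0 <= k < (n + m)) e k t)%E); last first.
      by apply: nneseries_lim_ge.
    elim: m => [|m IHm]; first by rewrite addn0 subrr normr0 adde0.
    rewrite addnS big_nat_recr//=.
    apply: le_trans (leeD2r _ IHm).
    rewrite -addeA leeD2l// -EFinD lee_fin [leRHS]addrC.
    exact: ler_distD.
  have fcS : fine (\sum_(0 <= k < n) e k t)%E @[n --> \oo] --> fine (S 0%N t).
    by apply: fine_cvg; rewrite -finS.
  move/cvgrPdist_lt : fcS => /(_ _ eps0)[N _ HN].
  exists (g N t); exists N => // m /= Nm.
  rewrite -ball_normE /= distrC.
  have := sub N (m - N)%N; rewrite subnKC// finS.
  have -> : (\sum_(0 <= k < N) e k t = (fine (\sum_(0 <= k < N) e k t))%:E)%E.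
    by rewrite fineK// sum_fin_num; apply/allP => x /mapP[k _ ->].
  rewrite -EFinD lee_fin -lerBrDl => /le_lt_trans; apply.
  exact: le_lt_trans (ler_norm _) (HN N (leqnn N)).
pose f t := limn (g ^~ t).
have gf : {ae mu, forall t, D t -> g n t @[n --> \oo] --> f t}.
  by apply: filterS S_fin => t St Dt; exact/gcvg/St.
have mf : strongly_measurable mu D f.
  exact: (strongly_measurable_ae_cvg cmu mD sepE mg gf).
have fg n : (\int[mu]_(t in D) `|f t - g n t|%:E <= (2 * C / 2 ^+ n)%:E)%E.
  apply: le_trans (intS n); apply: ae_ge0_le_integral => //.
    by apply/measurable_EFinP; exact: (measurable_dist cmu mD mf (mg n)).
  apply: filterS gf => t gft Dt.
  have H : `|g (n + m)%N t - g n t|%:E @[m --> \oo] --> `|f t - g n t|%:E.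
    apply: cvg_EFin; first exact: nearW.
    apply: cvg_norm; apply: cvgB; last exact: cvg_cst.
    have := gft Dt; rewrite -(cvg_shiftn n).
    by under eq_fun do rewrite addnC.
  by apply: (cvge_le _ H); apply: nearW => m; exact: dist_le.
exists f; split => //.
apply: bochner_integrable_fin_norm => //.
have H := integral_norm_comb cmu mD 1 (strongly_measurableB mf (mg 0%N)) (mg 0%N).
have -> : (\int[mu]_(t in D) `|f t|%:E = \int[mu]_(t in D)
    `|(1 *: (fun t => f t - g 0%N t) + g 0%N) t|%:E)%E.
  by apply: eq_integral => t _; rewrite !fctE scale1r subrK.
apply: le_lt_trans H _; rewrite normr1 mul1e lte_add_pinfty//.
  by apply: le_lt_trans (fg 0%N) _; rewrite ltry.
by rewrite -ge0_fin_numE ?integral_ge0// bochner_integrable_fin.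
Qed.

End L1_completeness.

Section L1_space.
Context {R : realType} (T : R) {E : completeNormedModType R}.
Hypothesis sepE : separable E.
Local Open Scope quotient_scope.
Local Notation I := `[0, T]%classic.
Local Notation lambda := (@completed_lebesgue_measure R).

Let clambda := @completed_lebesgue_measure_is_complete R.

Let mI := lebesgue_measurable_itv `[0, T].

Lemma completed_lebesgue_measure_itv (i : interval R) : lambda [set` i] =
  (if i.1 < i.2 then (i.2 : \bar R) - i.1 else 0)%E.
Proof. exact: (@lebesgue_measure_itv R i). Qed.

Lemma lambda_fin : (lambda I < +oo)%E.
Proof.
rewrite completed_lebesgue_measure_itv/=.
by case: ifP => // _; rewrite -EFinB ltry.
Qed.

Lemma L1_integrable (w : L1 T E) : bochner_integrable lambda I w.
Proof. exact: bochner_funP. Qed.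

Lemma L1_measurable (w : L1 T E) : strongly_measurable lambda I w.
Proof. by have [] := L1_integrable w. Qed.

(** The default 0 makes the passage to classes total, so families of functions map into [L1] without
    carrying proofs of integrability. *)
Definition L1_of (f : R -> E) : L1 T E :=
  if pselect (bochner_integrable lambda I f) is left bf
  then \pi_(L1 T E) (BochnerFun (mem_set bf)) else 0.

Lemma L1_ofE f : bochner_integrable lambda I f ->
  {ae lambda, forall t, I t -> L1_of f t = f t}.
Proof.
move=> bf; rewrite /L1_of; case: pselect => // {}bf.
by apply/(@L1_eqP R T E (repr _) (BochnerFun (mem_set bf))); rewrite reprK.
Qed.

Lemma L1_distE (u v : L1 T E) :
  `|u - v|%:E = (\int[lambda]_(t in I) `|u t - v t|%:E)%E.
Proof.
have -> : u - v = \pi_(L1 T E) (repr u - repr v).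
  rewrite -[in LHS](reprK u) -[in LHS](reprK v).
  rewrite (L1_piD (repr u) (- repr v)); congr (_ + _).
  by rewrite -scaleN1r -[- repr v]scaleN1r; exact: (L1_scale_pi (-1) (repr v)).
have fin := bochner_integrable_fin clambda mI (bochner_funP (repr u - repr v)).
by rewrite [X in X%:E](L1_norm_pi (repr u - repr v)) (fineK fin).
Qed.

Lemma L1_of_distE f g : bochner_integrable lambda I f ->
  bochner_integrable lambda I g ->
  `|L1_of f - L1_of g|%:E = (\int[lambda]_(t in I) `|f t - g t|%:E)%E.
Proof.
move=> bf bg; rewrite L1_distE.
apply: (integral_norm_ae clambda mI
  (f := fun t => L1_of f t - L1_of g t) (g := fun t => f t - g t)).
- exact: (strongly_measurableB (L1_measurable _) (L1_measurable _)).
- exact: (strongly_measurableB bf.1 bg.1).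
- by apply: filterS2 (L1_ofE bf) (L1_ofE bg) => t ef eg It; rewrite ef// eg.
Qed.

End L1_space.

(** * Bounded endomorphisms acting on integrable functions *)

Lemma bounded_endo_norm_le {R : realType} {E : normedModType R}
  (f : bounded_endo E) x : `|f x| <= `|f| * `|x|.
Proof.
have [lf _] := bounded_endoP f.
have f0 : f 0 = 0.
  by have := lf (-1) 0 0; rewrite scaler0 addr0 scaleN1r addNr.
have [->|x0] := eqVneq x 0; first by rewrite f0 !normr0 mulr0.
have nx0 : 0 < `|x| by rewrite normr_gt0.
have fZ a y : f (a *: y) = a *: f y by have := lf a y 0; rewrite f0 !addr0.
rewrite -[x in leLHS](scale1r x) -(@divff _ `|x|) ?gt_eqF//.
rewrite -scalerA fZ normrZ normr_id mulrC ler_wpM2r//.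
by apply: le_opnorm; rewrite normrZ normfV normr_id mulVf ?gt_eqF.
Qed.

Lemma bounded_endoB {R : realType} {E : normedModType R}
  (f : bounded_endo E) x y : f x - f y = f (x - y).
Proof.
have [lf _] := bounded_endoP f.
by rewrite addrC -scaleN1r -lf scaleN1r addrC.
Qed.

Section Linfty.
Context d {T : measurableType d} {R : realType} (mu : {measure set T -> \bar R}).
Variable D : set T.

(** The norm is the essential supremum of the extension by 0 off [D], which explains the sign
    condition on [c]. *)
Lemma Linfty_norm_leP {E : normedModType R} (f : T -> E) (c : R) : 0 <= c ->
  (Linfty_norm mu D f <= c%:E)%E <-> {ae mu, forall t, D t -> `|f t| <= c}.
Proof.
move=> c0; split.
  move/ess_supP; apply: filterS => t + Dt.
  by rewrite patchE mem_set// lee_fin.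
move=> fc; apply/ess_supP; apply: filterS fc => t fc.
by rewrite patchE; case: ifPn => [/set_mem/fc|_]; rewrite lee_fin.
Qed.

Lemma strongly_measurable_apply {E : normedModType R}
    (K : T -> bounded_endo E) (w : T -> E) :
  strongly_measurable mu D K -> strongly_measurable mu D w ->
  strongly_measurable mu D (fun t => K t (w t)).
Proof.
move=> [k [sk kK]] [s [ss sw]].
exists (fun n t => k n t (s n t)); split=> [n|].
  exact: (simple_fun_op2 (fun (f : bounded_endo E) x => f x)).
apply: filterS2 kK sw => t kK sw Dt; have {}kK := kK Dt; have {}sw := sw Dt.
apply/subr_cvg0; apply: norm_cvg0.
apply: (@squeeze_cvgr _ _ _ _ (cst 0)
  (fun n => `|k n t - K t| * `|s n t| + `|K t| * `|s n t - w t|)).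
- apply: nearW => n; rewrite normr_ge0/=.
  have -> : k n t (s n t) - K t (w t) =
      (k n t - K t) (s n t) + K t (s n t - w t).
    by rewrite -bounded_endoB /= fctE addrA subrK.
  by rewrite (le_trans (ler_normD _ _))// lerD// bounded_endo_norm_le.
- exact: cvg_cst.
- rewrite -[X in _ --> X]addr0 -[X in _ --> X + _](mul0r `|w t|).
  rewrite -[X in _ --> _ + X](mulr0 `|K t|); apply: cvgD; apply: cvgM.
  + rewrite -(normr0 (bounded_endo E)) -(subrr (K t)).
    by apply: cvg_norm; apply: cvgB => //; exact: cvg_cst.
  + exact: cvg_norm.
  + exact: cvg_cst.
  + rewrite -(normr0 E) -(subrr (w t)).
    by apply: cvg_norm; apply: cvgB => //; exact: cvg_cst.
Qed.

End Linfty.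

Section bochner_integral_apply.
Context d {T : measurableType d} {R : realType} (mu : {measure set T -> \bar R}).
Context {E : completeNormedModType R}.
Variable D : set T.
Hypothesis cmu : measure_is_complete mu.
Hypothesis mD : measurable D.
Hypothesis sepE : separable E.

Lemma integral_apply_le (K : T -> bounded_endo E) (w : T -> E) (c : R) :
  strongly_measurable mu D K -> {ae mu, forall t, D t -> `|K t| <= c} ->
  strongly_measurable mu D w -> 0 <= c ->
  (\int[mu]_(t in D) `|K t (w t)|%:E <= c%:E * \int[mu]_(t in D) `|w t|%:E)%E.
Proof.
move=> mK Kc mw c0; have mKw := strongly_measurable_apply mK mw.
have mnw := measurable_normE cmu mD mw.
rewrite -ge0_integralZl//; apply: ae_ge0_le_integral => //.
- exact: (measurable_normE cmu mD mKw).
- by move=> t _; rewrite mule_ge0.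
- exact: measurable_funeM.
- apply: filterS Kc => t Kc Dt; rewrite -EFinM lee_fin.
  by rewrite (le_trans (bounded_endo_norm_le _ _))// ler_wpM2r// Kc.
Qed.

Lemma bochner_integrable_apply (K : T -> bounded_endo E) (w : T -> E) (c : R) :
  strongly_measurable mu D K -> {ae mu, forall t, D t -> `|K t| <= c} ->
  bochner_integrable mu D w -> 0 <= c ->
  bochner_integrable mu D (fun t => K t (w t)).
Proof.
move=> mK Kc bw c0; have mw := bw.1.
apply: bochner_integrable_fin_norm => //; first exact: strongly_measurable_apply.
apply: le_lt_trans (integral_apply_le mK Kc mw c0) _.
by rewrite lte_mul_pinfty// ltey_eq (bochner_integrable_fin cmu mD bw).
Qed.

Lemma strongly_measurableS (A : set T) {V : normedModType R} (f : T -> V) :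
  A `<=` D -> strongly_measurable mu D f -> strongly_measurable mu A f.
Proof.
move=> AD [s [ss sf]]; exists s; split => //.
by apply: filterS sf => t sf /AD/sf.
Qed.

Lemma bochner_integrableS (A : set T) (f : T -> E) : measurable A ->
  A `<=` D -> bochner_integrable mu D f -> bochner_integrable mu A f.
Proof.
move=> mA AD bf; have mf := strongly_measurableS AD bf.1.
apply: bochner_integrable_fin_norm => //.
apply: (@le_lt_trans _ _ (\int[mu]_(t in D) `|f t|%:E)%E).
  apply: ge0_subset_integral => //.
  exact: (measurable_normE cmu mD bf.1).
by rewrite -ge0_fin_numE ?integral_ge0// (bochner_integrable_fin cmu mD bf).
Qed.

(** Setting the approximating simple functions to 0 off [A] gives approximations on both [D] and
    [A]. Their simple integrals agree term by term, since the value 0 contributes nothing. *)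
Lemma bochner_integral_restrict (A : set T) (f : T -> E) :
  (mu D < +oo)%E -> measurable A -> A `<=` D -> bochner_integrable mu D f ->
  (forall t, ~ A t -> f t = 0) ->
  bochner_integral mu D f = bochner_integral mu A f.
Proof.
move=> muD mA AD bf fA; have [mf [s [ss soo sf]]] := bf.
pose s' n t := if t \in A then s n t else 0.
have ss' n : simple_fun (s' n).
  by apply: simple_fun_if => //; exact: simple_fun_cst.
have mss n := simple_strongly_measurable mu D (ss n).
have mss' n := simple_strongly_measurable mu D (ss' n).
have as' : bochner_approx mu D f s'.
  split => // [n|].
    apply: le_lt_trans (soo n); apply: ge0_le_integral => //.
    - exact: (measurable_normE cmu mD (mss' n)).
    - exact: (measurable_normE cmu mD (mss n)).
    - by move=> t _; rewrite /s'; case: ifP => _; rewrite lee_fin ?normr0.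
  apply: (@squeeze_cvge _ _ _ _ (cst 0%E) _ _ _ _ _ sf); last exact: cvg_cst.
  apply: nearW => n; rewrite integral_ge0//=; apply: ge0_le_integral => //.
  - by apply/measurable_EFinP; exact: (measurable_dist cmu mD mf (mss' n)).
  - by apply/measurable_EFinP; exact: (measurable_dist cmu mD mf (mss n)).
  - move=> t _; rewrite /s'; case: ifPn => [//|]; rewrite notin_setE => At.
    by rewrite lee_fin fA// subrr normr0.
have asA : bochner_approx mu A f s'.
  have [_ soo' sf'] := as'.
  split => // [n|].
    apply: le_lt_trans (soo' n); apply: ge0_subset_integral => //.
    exact: (measurable_normE cmu mD (mss' n)).
  apply: (@squeeze_cvge _ _ _ _ (cst 0%E) _ _ _ _ _ sf'); last exact: cvg_cst.
  apply: nearW => n; rewrite integral_ge0//=; apply: ge0_subset_integral => //.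
  by apply/measurable_EFinP; exact: (measurable_dist cmu mD mf (mss' n)).
have muA : (mu A < +oo)%E.
  by apply: le_lt_trans muD; apply: le_measure; rewrite ?inE.
have bA := bochner_integrableS mA AD bf.
have c1 := bochner_integral_cvg cmu mD muD bf as'.
have c2 := bochner_integral_cvg cmu mA muA bA asA.
rewrite -(cvg_lim (@norm_hausdorff _ E) c1) -(cvg_lim (@norm_hausdorff _ E) c2).
congr (limn _); apply/funext => n; rewrite /simple_integral; apply: eq_fsbigr => y _.
have [->|y0] := eqVneq y 0; first by rewrite !scaler0.
congr (fine (mu _) *: _); apply/seteqP.
by split=> t [Dt] /=; rewrite /s'; case: ifPn => [/set_mem At sy|_ y0'];
  [split|rewrite y0' eqxx in y0|split => //; exact: AD|rewrite y0' eqxx in y0].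
Qed.

End bochner_integral_apply.

Lemma ereal_lty_bound {R : realType} (x : \bar R) : (x < +oo)%E ->
  exists2 c : R, 0 <= c & (x <= c%:E)%E.
Proof.
case: x => [r _| |_]//; last by exists 0; rewrite ?leNye.
by exists `|r| => //; rewrite lee_fin ler_norm.
Qed.

(** * The Volterra operator *)

Section volterra.
Context {R : realType} (T : R) {E : completeNormedModType R}.
Variable k : R -> R -> bounded_endo E.
Hypothesis sepE : separable E.
Local Notation I := `[0, T]%classic.
Local Notation lambda := (@completed_lebesgue_measure R).
Hypothesis k5 : forall t, I t -> in_Linfty lambda `[0, t] (k t).
Hypothesis k6 : forall t, I t ->
  Linfty_norm lambda I (kernel_ext k t' - kernel_ext k t)
    @[t' --> within I (nbhs t)] --> 0%E.

Let clambda := @completed_lebesgue_measure_is_complete R.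

Let mitv (a b : R) := lebesgue_measurable_itv `[a, b].

Definition volterra (w : R -> E) (t : R) : E :=
  bochner_integral lambda `[0, t] (fun s => k t s (w s)).

Let subI t : I t -> `[0, t]%classic `<=` I.
Proof.
rewrite /= in_itv/= => /andP[_ tT] s; rewrite /= !in_itv/= => /andP[-> st].
exact: le_trans st tT.
Qed.

Lemma kernel_ext_measurable t : I t ->
  strongly_measurable lambda I (kernel_ext k t).
Proof.
move=> /k5[[s [ss sk]] _].
exists (fun n u => if u \in `[0, t]%classic then s n u else 0); split.
  move=> n; apply: simple_fun_if; first exact: mitv.
    exact: ss.
  exact: simple_fun_cst.
apply: filterS sk => u sk _; rewrite /kernel_ext patchE.
case: ifPn => [/set_mem/sk//|_]; exact: cvg_cst.
Qed.

Lemma kernel_continuous t eps : I t -> 0 < eps ->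
  \forall t' \near within I (nbhs t),
    {ae lambda, forall s, I s -> `|kernel_ext k t' s - kernel_ext k t s| <= eps}.
Proof.
move=> It eps0; have eps0E : (0 < eps%:E)%E by rewrite lte_fin.
apply: filterS (cvge_lt_near (k6 It) eps0E) => t' /ltW.
by move/(Linfty_norm_leP _ _ _ (ltW eps0)).
Qed.

(** Continuity in the essential supremum norm lets the kernel deviate by at most 1 near each [t];
    compactness of [[0, T]] turns the pointwise bounds into one. *)
Lemma kernel_bounded : exists2 K : R, 0 <= K &
  forall t, I t -> {ae lambda, forall s, I s -> `|kernel_ext k t s| <= K}.
Proof.
have bnd t : I t -> exists2 c : R, 0 <= c &
    {ae lambda, forall s, I s -> `|kernel_ext k t s| <= c}.
  move=> /k5[_ /ereal_lty_bound[c c0 kc]]; exists c => //.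
  move/(Linfty_norm_leP _ _ _ c0) : kc; apply: filterS => s kc _.
  by rewrite /kernel_ext patchE; case: ifPn => [/set_mem/kc//|_]; rewrite normr0.
pose P (n : nat) t := I t ->
  {ae lambda, forall s, I s -> `|kernel_ext k t s| <= n%:R}.
have /compact_near_coveringP/(_ nat \oo P) := @segment_compact R 0 T.
case.
  move=> t It; have [c c0 kc] := bnd t It.
  (* An integer above the bound [c] at [t] plus the deviation 1. *)
  pose N := (Num.truncn (c + 1)).+1.
  exists ([set t' | I t' -> {ae lambda, forall s, I s ->
      `|kernel_ext k t' s - kernel_ext k t s| <= 1}], [set n | (N <= n)%N]).
    split => /=; last by exists N.
    exact: (kernel_continuous It ltr01).
  move=> [t' n] /= [near1 Nn] It'.
  apply: filterS2 kc (near1 It') => s kc k1 Is.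
  rewrite -(subrK (kernel_ext k t s) (kernel_ext k t' s)).
  apply: le_trans (ler_normD _ _) _.
  apply: le_trans (lerD (k1 Is) (kc Is)) _.
  rewrite addrC (le_trans (ltW (truncnS_gt _)))//.
  by rewrite ler_nat.
move=> N _ /(_ N (leqnn N)) H; exists N%:R => // t It; exact: H.
Qed.

Let muitv (t : R) : (lambda `[0%R, t]%classic < +oo)%E.
Proof. exact: (@lambda_fin R t). Qed.

Lemma volterra_integrable (w : R -> E) t : bochner_integrable lambda I w -> I t ->
  bochner_integrable lambda `[0, t] (fun s => k t s (w s)).
Proof.
move=> bw It; have [mk lk] := k5 It; have [c c0 kc] := ereal_lty_bound lk.
apply: (bochner_integrable_apply clambda (mitv 0 t) sepE mk _ _ c0).
  exact/(Linfty_norm_leP _ _ _ c0).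
exact: (bochner_integrableS clambda (mitv 0 T) sepE (mitv 0 t) (subI It) bw).
Qed.

(** The integral is kept over [[0, t]] and not enlarged to [I]: this causality is what makes the
    later iteration decay for every [K]. *)
Lemma volterra_dist : exists2 K : R, 0 <= K & forall (w v : R -> E) t,
  bochner_integrable lambda I w -> bochner_integrable lambda I v -> I t ->
  (`|volterra w t - volterra v t|%:E <=
   K%:E * \int[lambda]_(s in `[0%R, t]) `|w s - v s|%:E)%E.
Proof.
have [K K0 kK] := kernel_bounded; exists K => // w v t bw bv It.
apply: le_trans (bochner_integral_dist clambda (mitv 0 t) (muitv t)
  (volterra_integrable bw It) (volterra_integrable bv It)) _.
under eq_integral do rewrite bounded_endoB.
have [mk _] := k5 It.
have mwv : strongly_measurable lambda `[0, t] (fun s => w s - v s).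
  apply: (@strongly_measurableS _ _ _ lambda I _ _ _ (subI It)).
  exact: (strongly_measurableB bw.1 bv.1).
apply: (integral_apply_le clambda (mitv 0 t) mk _ mwv K0).
apply: filterS (kK t It) => s + st; move=> /(_ (subI It st)).
by rewrite /kernel_ext patchE mem_set.
Qed.

(** The kernel extended by 0 moves all integrals to the fixed domain [I], where the continuity
    hypothesis compares the kernels at two times. *)
Lemma volterra_continuous (w : R -> E) : bochner_integrable lambda I w ->
  {within I, continuous (volterra w)}.
Proof.
move=> bw; have [K K0 kK] := kernel_bounded.
have bext t : I t ->
    bochner_integrable lambda I (fun s => kernel_ext k t s (w s)).
  move=> It; exact: (bochner_integrable_apply clambda (mitv 0 T) sepE
    (kernel_ext_measurable It) (kK t It) bw K0).
have volE t : I t -> volterra w t =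
    bochner_integral lambda I (fun s => kernel_ext k t s (w s)).
  move=> It.
  rewrite (bochner_integral_restrict clambda (mitv 0 T) sepE (muitv T)
    (mitv 0 t) (subI It) (bext t It)); last first.
    by move=> s st; rewrite /kernel_ext patchE memNset.
  have bA := bochner_integrableS clambda (mitv 0 T) sepE (mitv 0 t) (subI It)
    (bext t It).
  have := bochner_integral_dist clambda (mitv 0 t) (muitv t)
    (volterra_integrable bw It) bA.
  rewrite integral0_eq => [|s st]; last first.
    by rewrite /kernel_ext patchE mem_set// subrr normr0.
  by rewrite lee_fin normr_le0 subr_eq0 => /eqP.
have finw := bochner_integrable_fin clambda (mitv 0 T) bw.
set M := fine (\int[lambda]_(t in I) `|w t|%:E)%E.
have M0 : 0 <= M by apply: fine_ge0; exact: integral_ge0.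
apply/subspace_continuousP => t It; apply/cvgrPdist_lt => eps eps0.
pose e1 := eps / (M + 1).
have e10 : 0 < e1 by rewrite divr_gt0// ltr_wpDl.
apply: filterS2 (kernel_continuous It e10) (withinT _ _) => t' kt It'.
rewrite /from_subspace volE// volE// -lte_fin distrC.
apply: le_lt_trans (bochner_integral_dist clambda (mitv 0 T) (muitv T)
  (bext t' It') (bext t It)) _.
have mB := strongly_measurableB (kernel_ext_measurable It')
  (kernel_ext_measurable It).
under eq_integral => s _ do
  rewrite (_ : _ - _ = (kernel_ext k t' s - kernel_ext k t s) (w s))//.
apply: le_lt_trans (integral_apply_le clambda (mitv 0 T) mB kt bw.1 (ltW e10)) _.
rewrite -(fineK finw) -EFinM lte_fin -/M mulrAC ltr_pdivrMr ?ltr_wpDl//.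
by rewrite ltr_pM2l// ltrDl.
Qed.

End volterra.

Section geometric_sequences.
Context {R : realType} {E : completeNormedModType R}.

Lemma geometric_dist (z : nat -> E) (r : R) :
  (forall k, `|z k.+1 - z k| <= r / 2 ^+ k) ->
  forall n m, `|z (n + m)%N - z n| <= 2 * r / 2 ^+ n.
Proof.
move=> zr n m; have r0 : 0 <= r.
  by have := zr 0%N; rewrite expr0 divr1; apply: le_trans.
suff : `|z (n + m)%N - z n| <= 2 * r / 2 ^+ n - 2 * r / 2 ^+ (n + m).
  by move/le_trans; apply; rewrite gerBl divr_ge0 ?mulr_ge0 ?exprn_ge0.
elim: m => [|m IHm]; first by rewrite addn0 !subrr normr0.
rewrite addnS; apply: le_trans (ler_distD (z (n + m)%N) _ _) _.
apply: le_trans (lerD (zr _) IHm) _.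
have p0 : (2 ^+ (n + m) : R) != 0 by rewrite expf_neq0.
by rewrite [2 ^+ (n + m).+1]exprS invfM; lra.
Qed.

Lemma geometric_cvg (z : nat -> E) (r : R) :
  (forall k, `|z k.+1 - z k| <= r / 2 ^+ k) ->
  z n @[n --> \oo] --> limn z /\ forall n, `|limn z - z n| <= 2 * r / 2 ^+ n.
Proof.
move=> zr; have dist := geometric_dist zr.
have r0 : 0 <= r.
  by have := zr 0%N; rewrite expr0 divr1; apply: le_trans.
have cz : cvgn z.
  apply/cauchy_cvgP/cauchy_exP => eps eps0.
  have := cvg_geometric (2 * r) (z := 2^-1 : R).
  rewrite ger0_norm ?invr_ge0// invf_lt1// ltr1n => /(_ isT).
  move/cvgrPdist_lt => /(_ _ eps0)[N _ HN].
  exists (z N); exists N => // m /= Nm; rewrite -ball_normE /= distrC.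
  have := dist N (m - N)%N; rewrite subnKC// => /le_lt_trans; apply.
  have := HN N (leqnn N); rewrite /= sub0r normrN exprVn.
  by rewrite ger0_norm// divr_ge0 ?mulr_ge0 ?exprn_ge0.
split => // n.
have H : `|z (m + n)%N - z n| @[m --> \oo] --> `|limn z - z n|.
  by apply: cvg_norm; apply: cvgB; [rewrite cvg_shiftn|exact: cvg_cst].
apply: (cvgr_to_le H); apply: nearW => m; rewrite addnC; exact: dist.
Qed.

End geometric_sequences.

(** * Distances to sets and measurable selections *)

Section distance_to_set.
Context {R : realType} {E : normedModType R}.
Implicit Types (x y : E) (A B : set E).

(* The junk value is 0 when A is empty. *)
Definition rdist x A : R := fine (dist_set x A).

Lemma dist_set_fin x A : A !=set0 -> dist_set x A \is a fin_num.
Proof.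
move=> [y Ay]; rewrite ge0_fin_numE; last first.
  by apply: le_ereal_inf_tmp => _ [z _ <-]; rewrite lee_fin.
apply: (@le_lt_trans _ _ `|x - y|%:E); last exact: ltry.
by apply: ereal_inf_lbound; exists y.
Qed.

Lemma rdistK x A : A !=set0 -> (rdist x A)%:E = dist_set x A.
Proof. by move=> A0; rewrite fineK// dist_set_fin. Qed.

Lemma rdist_le x y A : A y -> rdist x A <= `|x - y|.
Proof.
move=> Ay; rewrite -lee_fin rdistK; last by exists y.
by apply: ereal_inf_lbound; exists y.
Qed.

Lemma rdist_ge0 x A : 0 <= rdist x A.
Proof.
by apply: fine_ge0; apply: le_ereal_inf_tmp => _ [z _ <-]; rewrite lee_fin.
Qed.

Lemma rdist_lt x A r : A !=set0 -> rdist x A < r ->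
  exists2 y, A y & `|x - y| < r.
Proof.
move=> A0; rewrite -lte_fin rdistK// => /ereal_inf_lt[_ [y Ay <-]].
by rewrite lte_fin => xy; exists y.
Qed.

Lemma rdist_geP x A r : A !=set0 ->
  r <= rdist x A <-> forall y, A y -> r <= `|x - y|.
Proof.
move=> A0; split=> [rx y Ay|rA]; first exact: le_trans rx (rdist_le _ Ay).
rewrite leNgt; apply/negP => /(rdist_lt A0)[y Ay].
by rewrite ltNge rA.
Qed.

Lemma rdist_lip x y A : A !=set0 -> rdist x A <= `|x - y| + rdist y A.
Proof.
move=> A0; apply/ler_addgt0Pr => e e0.
have [|z Az yz] := @rdist_lt y A (rdist y A + e) A0; first by rewrite ltrDl.
apply: le_trans (rdist_le x Az) _; apply: le_trans (ler_distD y _ _) _.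
by rewrite -addrA lerD2l ltW.
Qed.

Lemma rdist_closed x A : A !=set0 -> closed A -> rdist x A <= 0 -> A x.
Proof.
move=> A0 cA xA; apply: cA => B /nbhs_ballP[e /= e0 eB].
have [|y Ay xy] := @rdist_lt x A e A0; first exact: le_lt_trans xA _.
by exists y; split => //; apply: eB; rewrite -ball_normE.
Qed.

Lemma rdist_hausdorff x A B c : A !=set0 -> B !=set0 ->
  (hausdorff_dist A B <= c%:E)%E -> rdist x B <= rdist x A + c.
Proof.
move=> A0 B0 ABc; apply/ler_addgt0Pr => e e0.
have [|z Az xz] := @rdist_lt x A (rdist x A + e) A0; first by rewrite ltrDl.
apply: le_trans (rdist_lip x z B0) _.
have zc : rdist z B <= c.
  rewrite -lee_fin rdistK//; apply: le_trans ABc; rewrite /hausdorff_dist.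
  rewrite le_max; apply/orP; left.
  by apply: ereal_sup_ubound; exists z.
by rewrite addrAC lerD// ltW.
Qed.

End distance_to_set.

Section first_index.

Definition first_index (P : pred nat) : nat :=
  if pselect (exists n, P n) is left ex then ex_minn ex else 0.

Lemma first_indexP (P : pred nat) : (exists n, P n) -> P (first_index P).
Proof. by rewrite /first_index; case: pselect => // ex _; case: ex_minnP. Qed.

Lemma measurable_first_index d (T : measurableType d) (D : set T)
    (P : T -> pred nat) : measurable D ->
  (forall n, measurable (D `&` [set t | P t n])) ->
  (forall t, D t -> exists n, P t n) ->
  forall n, measurable (D `&` (fun t => first_index (P t)) @^-1` [set n]).
Proof.
move=> mD mP exP n.
rewrite (_ : _ `&` _ = (D `&` [set t | P t n]) `\`
    \bigcup_(k < n) (D `&` [set t | P t k])); last first.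
  apply/seteqP; split=> [t [Dt /= <-]|t [[Dt /= Pn] nP]].
    split; first by split => //=; apply: first_indexP; exact: exP.
    move=> [k /= kn [_ /= Pk]]; move: kn; rewrite /first_index.
    case: pselect => [ex|]; last by move=> /(_ (exP t Dt)).
    by case: ex_minnP => m _ /(_ _ Pk); rewrite leqNgt => /negP.
  split => //=; rewrite /first_index; case: pselect => [ex|[]]; last exact: exP.
  case: ex_minnP => m Pm minm; apply/eqP; rewrite eqn_leq minm//= leqNgt.
  by apply/negP => mn; apply: nP; exists m.
apply: measurableD => //; exact: bigcup_measurable.
Qed.

End first_index.

Section selection.
Context d {T : measurableType d} {R : realType} (mu : {measure set T -> \bar R}).
Context {E : completeNormedModType R}.
Variable D : set T.
Hypothesis cmu : measure_is_complete mu.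
Hypothesis mD : measurable D.
Hypothesis sepE : separable E.
Variables (F : T -> E -> set E) (alpha : T -> R).
Hypothesis F0 : forall t x, D t -> F t x !=set0.
Hypothesis Fclosed : forall t x, D t -> closed (F t x).
Hypothesis Fmeasurable : forall x C, open C ->
  measurable [set t | D t /\ F t x `<=` C].
Hypothesis Flip : {ae mu, forall t, D t -> forall x y,
  (hausdorff_dist (F t x) (F t y) <= (alpha t * `|x - y|)%:E)%E}.

(** The hypothesis on [F] concerns inclusions in open sets, so the closed condition
    [r <= rdist y (F t x)] is written as inclusion in the open sets [|y - z| > r - 1/(n+1)] for all
    [n]. *)
Lemma measurable_rdist x y : measurable_fun D (fun t => rdist y (F t x)).
Proof.
move=> _; apply: (measurability _ (RGenCInfty.measurableE R)) => // _ [_ [r ->] <-].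
rewrite (_ : _ `&` _ = \bigcap_n [set t | D t /\
    F t x `<=` [set z | r - n.+1%:R^-1 < `|y - z|]]); last first.
  apply/seteqP; split=> [t [Dt /=]|t H].
    rewrite in_itv/= andbT => /(rdist_geP _ _ (F0 x Dt)) rF n _; split => // z Fz.
    by rewrite /= (lt_le_trans _ (rF z Fz))// ltrBlDr ltrDl invr_gt0.
  have [Dt _] := H 0%N I; split => //=; rewrite in_itv/= andbT.
  apply/(rdist_geP _ _ (F0 x Dt)) => z Fz; apply/ler_addgt0Pr => e e0.
  have [n _ /(_ n (leqnn n)) ne] := near_infty_natSinv_lt (PosNum e0).
  have [_ /(_ z Fz) /= /ltW] := H n I; rewrite lerBlDr => /le_trans; apply.
  by rewrite lerD2l ltW.
apply: bigcap_measurable => // n _; apply: Fmeasurable.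
rewrite (_ : [set z | _] = (fun z => `|y - z|) @^-1` [set u | r - n.+1%:R^-1 < u]).
  apply: open_comp; last exact: open_gt.
  move=> z _; apply: cvg_norm; apply: cvgB; [exact: cvg_cst|exact: cvg_id].
by [].
Qed.

Lemma measurable_fun_simple_glue {V : Type} (p : T -> V) (g : V -> T -> R) :
  simple_fun p -> (forall v, measurable_fun D (g v)) ->
  measurable_fun D (fun t => g (p t) t).
Proof.
move=> [fp mp] mg _ B mB.
rewrite (_ : _ `&` _ = \bigcup_(v in range p) (p @^-1` [set v] `&`
    (D `&` g v @^-1` B))).
  by apply: fin_bigcup_measurable => // v _; apply: measurableI => //; exact: mg.
apply/seteqP; split=> [t [Dt gt]|t [v _ [<- [Dt gt]]]]; last by split.
by exists (p t) => //; exists t.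
Qed.

(** A Caratheodory argument: the distance is measurable in [t] and, at almost every [t], Lipschitz
    in the point and in the state, so simple approximations of [X] and [u] pass to the limit. *)
Lemma measurable_rdist_comp (X u : T -> E) :
  strongly_measurable mu D X -> strongly_measurable mu D u ->
  measurable_fun D (fun t => rdist (u t) (F t (X t))).
Proof.
move=> [x [sx xX]] [v [sv vu]].
apply: (@ae_measurable_fun_cvg _ _ _ mu D cmu mD
    (fun n t => rdist (v n t) (F t (x n t)))).
  move=> n; apply: (@measurable_fun_simple_glue _ (fun t => (x n t, v n t))
    (fun p t => rdist p.2 (F t p.1))).
    exact: simple_fun_op2.
  move=> p; exact: measurable_rdist.
apply: filterS3 Flip xX vu => t Ft xX vu Dt.
have {}xX := xX Dt; have {}vu := vu Dt.
have lip w w' z z' : rdist w (F t z) <= rdist w' (F t z') +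
    (`|w - w'| + alpha t * `|z - z'|).
  have := rdist_hausdorff w (F0 z' Dt) (F0 z Dt) (Ft Dt z' z).
  move/le_trans; apply; rewrite addrA distrC lerD2r addrC.
  by apply: rdist_lip; exact: F0.
apply/subr_cvg0; apply: norm_cvg0.
apply: (@squeeze_cvgr _ _ _ _ (cst 0)
  (fun n => `|v n t - u t| + alpha t * `|x n t - X t|)).
- apply: nearW => n; rewrite normr_ge0/= ler_norml.
  have h1 := lip (v n t) (u t) (x n t) (X t).
  have := lip (u t) (v n t) (X t) (x n t).
  rewrite [`|u t - _|]distrC [`|X t - _|]distrC => h2.
  by apply/andP; split; lra.
- exact: cvg_cst.
- rewrite -[X in _ --> X]addr0 -[X in _ --> _ + X](mulr0 (alpha t)).
  apply: cvgD.
    rewrite -(normr0 E) -(subrr (u t)).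
    by apply: cvg_norm; apply: cvgB => //; exact: cvg_cst.
  apply: cvgM; first exact: cvg_cst.
  rewrite -(normr0 E) -(subrr (X t)).
  by apply: cvg_norm; apply: cvgB => //; exact: cvg_cst.
Qed.

(** Successive approximation in the manner of Kuratowski and Ryll-Nardzewski: [z k] takes values in
    a dense sequence, lies within [r k] of the set and moves by less than [r k]; closedness puts the
    limit in the set. [Z] takes the point to be approximated as an argument, so that one operator
    serves every [u]. *)
Lemma measurable_selection (X : T -> E) (delta : R) : 0 < delta ->
  strongly_measurable mu D X -> exists Z : T -> E -> E,
  (forall u, strongly_measurable mu D u ->
     strongly_measurable mu D (fun t => Z t (u t))) /\
  (forall t e, D t -> F t (X t) (Z t e) /\
     `|Z t e - e| <= rdist e (F t (X t)) + delta).
Proof.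
move=> delta0 mX; have [e de] := separable_enum (0 : E) sepE.
(* The first point costs [r0] beyond the distance and all later moves together at most [2 * r0],
   which stays below [delta]. *)
pose r0 := delta / 4; have r00 : 0 < r0 by rewrite divr_gt0.
pose r k := r0 / 2 ^+ k.
have rk0 k : 0 < r k by rewrite divr_gt0// exprn_gt0.
pose near_dense t b rho r' := first_index (fun j : nat =>
   (rdist (e j) (F t (X t)) < r') && (`|e j - b| < rho)).
have near_denseP t b rho r' : D t -> rdist b (F t (X t)) < rho -> 0 < r' ->
    exists j, (rdist (e j) (F t (X t)) < r') && (`|e j - b| < rho).
  move=> Dt brho r'0; have [a Fa ba] := rdist_lt (F0 _ Dt) brho.
  (* A dense point within [s] of [a] is within [r'] of the set and within [rho] of [b]. *)
  pose s := Num.min r' (rho - `|b - a|).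
  have s0 : 0 < s by rewrite lt_min r'0 subr_gt0.
  have oB : open (ball a s) by exact: ball_open.
  have [|j] := de _ oB; first by exists a; exact: ballxx.
  rewrite -ball_normE/= lt_min => /andP[aj1 aj2]; exists j.
  rewrite (le_lt_trans (rdist_le _ Fa)) ?[`|e j - a|]distrC//=.
  rewrite (le_lt_trans (ler_distD a _ _))// [`|e j - a|]distrC [`|a - b|]distrC.
  by rewrite -ltrBrDr.
have near_dense_measurable (b : T -> E) (rho : T -> R) r' : 0 < r' ->
    strongly_measurable mu D b -> measurable_fun D rho ->
    (forall t, D t -> rdist (b t) (F t (X t)) < rho t) ->
    strongly_measurable mu D (fun t => e (near_dense t (b t) (rho t) r')).
  move=> r'0 mb mrho brho.
  apply: (@strongly_measurable_glue _ _ _ _ _ cmu mD _ sepE _ (fun j => cst (e j))).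
    apply: measurable_first_index => // [n|t Dt];
      last exact: near_denseP (brho t Dt) _.
    rewrite [X in measurable X](_ : _ =
       (D `&` (fun t => rdist (e n) (F t (X t)) < r') @^-1` [set true]) `&`
       (D `&` (fun t => `|e n - b t| < rho t) @^-1` [set true])); last first.
      by apply/seteqP; split=> [t [Dt /andP[]]|t [[Dt /= ->] [_ /= ->]]].
    have me := simple_strongly_measurable mu D (simple_fun_cst (e n)).
    apply: measurableI.
      apply: (measurable_fun_ltr (measurable_rdist_comp mX me)) => //.
    apply: (measurable_fun_ltr _ mrho) => //.
    exact: (measurable_dist cmu mD me mb).
  move=> n; exact: (simple_strongly_measurable mu D (simple_fun_cst (e n))).
pose fix z (k : nat) (t : T) (b : E) {struct k} : E := if k is m.+1
  then e (near_dense t (z m t b) (r m) (r m.+1))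
   else e (near_dense t b (rdist b (F t (X t)) + r0) r0).
have lt_r0 t b : rdist b (F t (X t)) < rdist b (F t (X t)) + r0.
  by rewrite ltrDl.
have z_near k t b : D t -> rdist (z k t b) (F t (X t)) < r k.
  move=> Dt; elim: k => [|k IHk] /=.
    rewrite /r expr0 divr1.
    by have /first_indexP/andP[] := near_denseP t b _ r0 Dt (lt_r0 t b) r00.
  by have /first_indexP/andP[] := near_denseP t _ _ _ Dt IHk (rk0 k.+1).
have z_step k t b : D t -> `|z k.+1 t b - z k t b| <= r0 / 2 ^+ k.
  move=> Dt; have /first_indexP/andP[_ /ltW] :=
    near_denseP t _ _ _ Dt (z_near k t b Dt) (rk0 k.+1).
  exact.
have z0 t b : D t -> `|z 0%N t b - b| <= rdist b (F t (X t)) + r0.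
  move=> Dt; have /first_indexP/andP[_ /ltW] :=
    near_denseP t b _ r0 Dt (lt_r0 t b) r00.
  exact.
exists (fun t b => limn (fun k => z k t b)); split=> [u mu_|t b Dt].
  apply: (@strongly_measurable_ae_cvg _ _ _ _ _ cmu mD _ sepE
    (fun k t => z k t (u t))).
    elim=> [|k IHk] /=.
      apply: near_dense_measurable => //.
        apply: measurable_funD => //; exact: measurable_rdist_comp.
    by apply: near_dense_measurable => // t Dt; exact: z_near.
  apply: aeW => t Dt.
  by have [] := geometric_cvg (fun k => z_step k t (u t) Dt).
have [zlim zdist] := geometric_cvg (fun k => z_step k t b Dt).
split.
  apply: rdist_closed; [exact: F0|exact: Fclosed|].
  apply/ler_addgt0Pr => eps eps0; rewrite add0r.
  have := cvg_geometric (3 * r0) (z := 2^-1 : R).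
  rewrite ger0_norm ?invr_ge0// invf_lt1// ltr1n => /(_ isT).
  move/cvgrPdist_lt => /(_ _ eps0)[N _ /(_ N (leqnn N))].
  rewrite /= sub0r normrN exprVn ger0_norm; last first.
    by rewrite divr_ge0 ?mulr_ge0 ?exprn_ge0// ltW.
  move=> /ltW; apply: le_trans.
  apply: le_trans (rdist_lip _ (z N t b) (F0 _ Dt)) _.
  apply: le_trans (lerD (zdist N) (ltW (z_near N t b Dt))) _.
  by rewrite /r -mulrDl ler_pM2r ?invr_gt0 ?exprn_gt0//; lra.
apply: le_trans (ler_distD (z 0%N t b) _ _) _.
apply: le_trans (lerD (zdist 0%N) (z0 t b Dt)) _.
by rewrite expr0 divr1 /r0; lra.
Qed.

End selection.

(** * Volterra integral inequalities *)

(** Truncation at a large [N] loses at most [eta / 2] in L^1, and the truncated function contributes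
    at most [N * mu B]. *)
Lemma integral_absolutely_continuous d (T : measurableType d) (R : realType)
    (mu : {measure set T -> \bar R}) (D : set T) (f : T -> R) :
  measurable D -> mu.-integrable D (EFin \o f) -> (forall t, 0 <= f t) ->
  forall eta, 0 < eta -> exists2 delta, 0 < delta & forall B, measurable B ->
    B `<=` D -> (mu B <= delta%:E)%E ->
    (\int[mu]_(t in B) (f t)%:E <= eta%:E)%E.
Proof.
move=> mD intf f0 eta eta0.
have mf : measurable_fun D f.
  by apply/measurable_EFinP; exact: (measurable_int mu intf).
pose g (n : nat) t := Num.min (f t) n%:R.
have mg n : measurable_fun D (g n) by exact: measurable_minr.
have [||||| _ + _] := @dominated_convergence _ _ _ mu D mD
    (fun n t => (g n t)%:E) (EFin \o f) (EFin \o f).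
- by move=> n; apply/measurable_EFinP.
- exact/measurable_EFinP.
- apply: aeW => t Dt; apply: cvg_near_cst.
  exists (Num.truncn (f t)).+1 => // n /= tn; rewrite /g min_l//.
  by apply: ltW; apply: lt_le_trans (truncnS_gt _) _; rewrite ler_nat.
- exact: intf.
- apply: aeW => t n Dt /=; rewrite lee_fin /g.
  by rewrite ger0_norm ?le_min ?f0 ?ler0n// ge_min lexx.
have eta2 : (0 < (eta / 2)%:E)%E by rewrite lte_fin divr_gt0.
move=> /cvge_lt_near/(_ eta2)[N _ /(_ N (leqnn N)) /= HN].
pose delta := eta / 2 / N.+1%:R.
exists delta => [|B mB BD muB]; first by rewrite !divr_gt0.
have mdiff : measurable_fun D (fun t => `|(g N t)%:E - (f t)%:E|%E).
  apply: measurableT_comp => //.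
  by apply: emeasurable_funB; apply/measurable_EFinP.
apply: (@le_trans _ _ (\int[mu]_(t in B)
    (`|(g N t)%:E - (f t)%:E| + (cst N%:R%:E) t))%E).
  apply: ge0_le_integral => //.
  - by move=> t _; rewrite lee_fin.
  - by apply/measurable_EFinP; exact: measurable_funS mf.
  - by apply: emeasurable_funD => //; exact: measurable_funS mdiff.
  - move=> t Bt; rewrite -EFinB abse_EFin -EFinD lee_fin.
    rewrite -lerBlDr distrC (le_trans _ (ler_norm _))// lerD2l lerN2.
    by rewrite /g ge_min lexx orbT.
have mdiffB := measurable_funS mD BD mdiff.
rewrite ge0_integralD//.
rewrite integral_cst// [eta]splitr EFinD; apply: leeD.
  apply: le_trans (ltW HN); apply: ge0_subset_integral => //.
apply: le_trans (lee_wpmul2l _ muB) _ => //.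
rewrite -EFinM lee_fin /delta mulrCA ler_piMr ?divr_ge0 ?(ltW eta0)//.
  by rewrite ler_pdivrMr// mul1r ler_nat.
by move=> t _; rewrite lee_fin.
Qed.

(* The sets S t abstract the intervals [0, t]; they are exhausted by a finite
   chain along which the integral of gamma increases by small steps. *)
Section volterra_iteration.
Context d {T : measurableType d} {R : realType} (mu : {measure set T -> \bar R}).
Variables (D : set T) (gamma : T -> R) (K : R) (S : T -> set T).
Variables (A : nat -> set T) (J : nat).
Hypothesis mD : measurable D.
Hypothesis gamma0 : forall t, 0 <= gamma t.
Hypothesis gamma_int : mu.-integrable D (EFin \o gamma).
Hypothesis K0 : 0 <= K.
Hypothesis mS : forall t, measurable (S t).
Hypothesis mA : forall j, measurable (A j).
Hypothesis A0 : A 0%N = set0.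
Hypothesis AJ : A J = D.
Hypothesis AS : forall j, A j `<=` A j.+1.
Hypothesis AD : forall j, A j `<=` D.
Hypothesis SA : forall j t, A j t -> S t `<=` A j.
Hypothesis A_small : forall j,
  (K%:E * \int[mu]_(t in A j.+1 `\` A j) (gamma t)%:E <= (4^-1)%:E)%E.

(** Induction along the chain [A j], and inside it on [n]. For [t] in [A j.+1 \ A j] the set [S t]
    lies in [A j.+1], so the inner hypothesis bounds the integral of [e n]; by [A_small] it enters
    with factor 1/4 only, which leaves room for the required factor 1/2. *)
Lemma volterra_iteration : exists2 C : R, 0 <= C &
  forall (e : nat -> T -> R) (c : R), 0 <= c ->
  (forall n, measurable_fun D (e n)) -> (forall n t, 0 <= e n t) ->
  {ae mu, forall t, D t -> e 0%N t <= c * gamma t} ->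
  (forall n, {ae mu, forall t, D t -> ((e n.+1 t)%:E <= (gamma t)%:E *
     (K%:E * \int[mu]_(s in S t) (e n s)%:E + (c / 2 ^+ n)%:E))%E}) ->
  forall n, (\int[mu]_(t in D) (e n t)%:E <= (C * c / 2 ^+ n)%:E)%E.
Proof.
have mgamma : measurable_fun D (fun t => (gamma t)%:E).
  exact: (measurable_int mu gamma_int).
have fin_gamma : (\int[mu]_(t in D) (gamma t)%:E)%E \is a fin_num.
  exact: (integrable_fin_num mD gamma_int).
pose G := fine (\int[mu]_(t in D) (gamma t)%:E)%E.
have GE : (\int[mu]_(t in D) (gamma t)%:E = G%:E)%E by rewrite fineK.
have G0 : 0 <= G by apply: fine_ge0; apply: integral_ge0 => t _; rewrite lee_fin.
suff H j : exists2 C : R, 0 <= C &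
  forall (e : nat -> T -> R) (c : R), 0 <= c ->
  (forall n, measurable_fun D (e n)) -> (forall n t, 0 <= e n t) ->
  {ae mu, forall t, D t -> e 0%N t <= c * gamma t} ->
  (forall n, {ae mu, forall t, D t -> ((e n.+1 t)%:E <= (gamma t)%:E *
     (K%:E * \int[mu]_(s in S t) (e n s)%:E + (c / 2 ^+ n)%:E))%E}) ->
  forall n, (\int[mu]_(t in A j) (e n t)%:E <= (C * c / 2 ^+ n)%:E)%E.
  by have := H J; rewrite AJ.
elim: j => [|j [C C0 IHj]].
  exists 0 => // e c _ _ _ _ _ n; rewrite A0 integral_set0 lee_fin.
  by rewrite !mul0r.
(* Solves [C / 2 + C' / 4 + G = C' / 2]: the terms on the left come from [A j], from the feedback on
   the new part and from the source [c / 2 ^ n]. *)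
pose C' := 2 * C + 4 * G.
have C'0 : 0 <= C' by rewrite addr_ge0// mulr_ge0.
exists C' => // e c c0 me e0 eg estep.
have {}IHj := IHj e c c0 me e0 eg estep.
have meE n B : B `<=` D -> measurable_fun B (fun t => (e n t)%:E).
  by move=> BD; apply/measurable_EFinP; exact: (measurable_funS mD BD (me n)).
have mgB B : B `<=` D -> measurable_fun B (fun t => (gamma t)%:E).
  by move=> BD; exact: (measurable_funS mD BD mgamma).
have e0E n t : (0 <= (e n t)%:E)%E by rewrite lee_fin.
have g0E t : (0 <= (gamma t)%:E)%E by rewrite lee_fin.
elim=> [|n IHn].
  apply: (@le_trans _ _ (\int[mu]_(t in A j.+1) (c%:E * (gamma t)%:E))%E).
    apply: ae_ge0_le_integral => //.
    - by apply: meE; exact: AD.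
    - by move=> t _; rewrite mule_ge0.
    - by apply: measurable_funeM; apply: mgB; exact: AD.
    - by apply: filterS eg => t eg /AD/eg; rewrite -EFinM lee_fin.
  rewrite ge0_integralZl//; last by apply: mgB; exact: AD.
  apply: (@le_trans _ _ (c%:E * G%:E)%E).
    rewrite lee_wpmul2l// -GE; apply: ge0_subset_integral => //; exact: AD.
  rewrite -EFinM lee_fin expr0 divr1 mulrC ler_wpM2r//.
  by rewrite /C'; lra.
pose B := A j.+1 `\` A j.
have mB : measurable B by exact: measurableD.
have BD : B `<=` D by move=> t [/AD].
have AB : A j.+1 = A j `|` B by rewrite setDUK//; exact: AS.
rewrite [in leLHS]AB ge0_integral_setU//; last 2 first.
- by rewrite -AB; apply: meE; exact: AD.
- by rewrite /B; apply/disj_setPS => t [At [_ /(_ At)]].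
pose a := (K%:E * (C' * c / 2 ^+ n)%:E + (c / 2 ^+ n)%:E)%E.
have a0 : (0 <= a)%E.
  by rewrite /a -EFinM -EFinD lee_fin addr_ge0 ?mulr_ge0 ?invr_ge0 ?exprn_ge0.
have intB : (\int[mu]_(t in B) (e n.+1 t)%:E <=
    a * \int[mu]_(t in B) (gamma t)%:E)%E.
  have afin : a = (fine a)%:E by [].
  rewrite afin -ge0_integralZl//; last exact: mgB.
  apply: ae_ge0_le_integral => //; rewrite -?afin.
  - exact: meE.
  - by move=> t _; rewrite mule_ge0.
  - by apply: measurable_funeM; exact: mgB.
  apply: filterS (estep n) => t et Bt; apply: le_trans (et (BD t Bt)) _.
  rewrite muleC lee_wpmul2r// leeD2r// lee_wpmul2l//.
  apply: le_trans _ IHn; apply: ge0_subset_integral => //.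
    by apply: meE; exact: AD.
  by apply: SA; case: Bt.
have intB' : (a * \int[mu]_(t in B) (gamma t)%:E <=
    (C' * c / 2 ^+ n / 4 + G * (c / 2 ^+ n))%:E)%E.
  have p0 : 0 <= c / 2 ^+ n by rewrite divr_ge0 ?exprn_ge0.
  rewrite /a ge0_muleDl//; last by rewrite mule_ge0// lee_fin -mulrA mulr_ge0.
  rewrite EFinD leeD//.
    rewrite [X in (X * _)%E]muleC -muleA [leRHS]EFinM lee_wpmul2l//.
      by rewrite lee_fin -mulrA mulr_ge0.
    exact: A_small.
  rewrite [X in (_ <= X%:E)%E]mulrC [leRHS]EFinM lee_wpmul2l// -GE.
  exact: ge0_subset_integral.
apply: le_trans (leeD (IHj n.+1) (le_trans intB intB')) _.
rewrite -EFinD lee_fin exprS invfM.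
have p0 : 0 <= c / 2 ^+ n by rewrite divr_ge0 ?exprn_ge0.
rewrite /C'; nra.
Qed.

End volterra_iteration.

(** * Gluing along a parameter *)

Section fractional_part.
Context {R : realType}.
Implicit Types x : R.

Definition frac x : R := x - (Num.truncn x)%:R.

Lemma frac_itv x : 0 <= x -> 0 <= frac x < 1.
Proof.
move=> x0; rewrite /frac subr_ge0 truncn_le x0/= ltrBlDr addrC.
by rewrite -(natrD R _ 1) addn1 truncnS_gt.
Qed.

Lemma continuous_frac x : 0 < frac x -> 0 <= x -> {for x, continuous frac}.
Proof.
move=> fx0 x0; set n := Num.truncn x.
have nx : n%:R < x by rewrite -subr_gt0.
have xn : x < n.+1%:R by exact: truncnS_gt.
have near_n : \forall y \near x, frac y = y - n%:R.
  near=> y; rewrite /frac; congr (_ - _%:R); apply: truncn_def.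
  apply/andP; split; last by near: y; exact: lt_nbhsl.
  by apply: ltW; near: y; exact: lt_nbhsr.
apply: (@cvg_trans _ ((fun y => y - n%:R) y @[y --> x])).
  by apply: near_eq_cvg; apply: filterS near_n => y ->.
have H : (y - n%:R) @[y --> x] --> x - n%:R.
  by apply: cvgB; [exact: cvg_id|exact: cvg_cst].
exact: H.
Unshelve. all: by end_near. Qed.

End fractional_part.

Section coding.
Context {R : realType} {P : topologicalType}.
Variables (O : set P) (sigma : nat -> P -> R) (nu : P -> R).
Hypothesis sigma_ge0 : forall n p, 0 <= sigma n p.
Hypothesis sigma_cvg : forall n p, O p -> sigma n q @[q --> p] --> sigma n p.
Hypothesis sigma_gt1 : forall p, O p -> exists n, 1 < sigma n p.
Hypothesis nu_gt0 : forall p, O p -> 0 < nu p.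
Hypothesis nu_cvg : forall p, O p -> nu q @[q --> p] --> nu p.

(** Capping at 1 replaces normalization of the weights: as some weight exceeds 1, the capped sums
    reach 1 after finitely many indices, and no infinite sum occurs. *)
Definition cumul (n : nat) (p : P) : R := Num.min 1 (\sum_(m < n) sigma m p).

(* The indices are spread over each period of frac (nu p * t) in proportion to
   the partition of unity with partial sums cumul. *)
Definition code (p : P) (t : R) : nat :=
  first_index (fun m => frac (nu p * t) < cumul m.+1 p).

Lemma cumul_le p m n : (m <= n)%N -> cumul m p <= cumul n p.
Proof.
move=> mn; rewrite /cumul le_min ge_min lexx/= ge_min; apply/orP; right.
rewrite -(subnKC mn) big_split_ord/= lerDl; exact: sumr_ge0.
Qed.

Lemma cumul0 p : cumul 0 p = 0.
Proof. by rewrite /cumul big_ord0 min_r. Qed.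

Lemma cumul_cvg n p : O p -> cumul n q @[q --> p] --> cumul n p.
Proof.
move=> Op.
have S : \sum_(m < n) sigma m q @[q --> p] --> \sum_(m < n) sigma m p.
  elim: n => [|n IHn].
    by under eq_fun do rewrite big_ord0; rewrite big_ord0; exact: cvg_cst.
  rewrite big_ord_recr/=; under eq_fun do rewrite big_ord_recr/=.
  by apply: cvgD; [exact: IHn|exact: sigma_cvg].
exact: (continuous_min (cvg_cst _) S).
Qed.

Lemma cumul_eq1 n p : 1 < sigma n p -> cumul n.+1 p = 1.
Proof.
move=> s1; rewrite /cumul min_l// big_ord_recr/=.
by rewrite (le_trans (ltW s1))// lerDr; exact: sumr_ge0.
Qed.

Lemma code_ex p t : O p -> 0 <= t ->
  exists m, frac (nu p * t) < cumul m.+1 p.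
Proof.
move=> Op t0; have [m s1] := sigma_gt1 Op; exists m; rewrite cumul_eq1//.
by have /andP[] : 0 <= frac (nu p * t) < 1
  by apply: frac_itv; rewrite mulr_ge0// ltW// nu_gt0.
Qed.

Lemma codeP p t m : O p -> 0 <= t ->
  code p t = m <-> cumul m p <= frac (nu p * t) < cumul m.+1 p.
Proof.
move=> Op t0; have ex := code_ex Op t0.
have /andP[f0 _] : 0 <= frac (nu p * t) < 1.
  by apply: frac_itv; rewrite mulr_ge0// ltW// nu_gt0.
rewrite /code /first_index; case: pselect => [{}ex|//].
case: ex_minnP => n fn nmin; split=> [<-|/andP[cm fm]].
  rewrite fn andbT; case: n fn nmin => [|n] fn nmin; first by rewrite cumul0.
  by rewrite leNgt; apply/negP => /nmin; rewrite ltnn.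
apply/eqP; rewrite eqn_leq nmin//= leqNgt; apply/negP => nm.
by move: (lt_le_trans fn (cumul_le p nm)); rewrite ltNge cm.
Qed.

(** A zero weight makes the half-open interval of its index empty. *)
Lemma code_sigma_gt0 p t : O p -> 0 <= t -> 0 < sigma (code p t) p.
Proof.
move=> Op t0; have /(codeP _ Op t0)/andP[c1 c2] := erefl (code p t).
rewrite lt_neqAle sigma_ge0 andbT; apply/eqP => s0.
move: (le_lt_trans c1 c2); rewrite /cumul big_ord_recr/= -s0 addr0.
by rewrite ltxx.
Qed.

(** A weight above 1 at [p] stays above 1 nearby, and its index then bounds every code. *)
Lemma code_near_bounded p : O p -> exists n, \forall q \near p,
  O q -> forall t, 0 <= t -> (code q t <= n)%N.
Proof.
move=> Op; have [n s1] := sigma_gt1 Op; exists n.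
have near1 : \forall q \near p, 1 < sigma n q.
  by apply: (cvgr_gt (sigma n p)) => //; exact: sigma_cvg.
apply: filterS near1 => q sq1 Oq t t0.
rewrite leqNgt; apply/negP => nc.
have /(codeP _ Oq t0)/andP[c1 c2] := erefl (code q t).
have := le_lt_trans (le_trans (cumul_le q nc) c1) c2.
by rewrite cumul_eq1// ltNge /cumul ge_min lexx.
Qed.

(** Away from the jumps of [frac] and from the endpoints [cumul m p], the inequalities that define
    the code are strict and persist near [p]. *)
Lemma code_near_cst p t : open O -> O p -> 0 < t ->
  0 < frac (nu p * t) -> (forall m, frac (nu p * t) != cumul m p) ->
  \forall q \near p, code q t = code p t.
Proof.
move=> oO Op t0 f0 fc.
have /(codeP _ Op (ltW t0))/andP[c1 c2] := erefl (code p t).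
set m := code p t in c1 c2 *.
have {}c1 : cumul m p < frac (nu p * t) by rewrite lt_neqAle eq_sym fc.
have cf : frac (nu q * t) @[q --> p] --> frac (nu p * t).
  apply: continuous_cvg; last by apply: cvgMr_tmp; exact: nu_cvg.
  by apply: continuous_frac => //; rewrite mulr_ge0// ltW// nu_gt0.
have d1 : cumul m q - frac (nu q * t) @[q --> p] -->
    cumul m p - frac (nu p * t) by apply: cvgB => //; exact: cumul_cvg.
have d2 : cumul m.+1 q - frac (nu q * t) @[q --> p] -->
    cumul m.+1 p - frac (nu p * t) by apply: cvgB => //; exact: cumul_cvg.
near=> q; apply/(codeP _ _ (ltW t0)).
  by near: q; exact: open_nbhs_nbhs.
apply/andP; split.
  rewrite -subr_le0; near: q; apply: (cvgr_le _ d1); rewrite subr_lt0//.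
by rewrite -subr_gt0; near: q; apply: (cvgr_gt _ d2); rewrite subr_gt0.
Unshelve. all: by end_near. Qed.

(** The excluded times solve [nu p * t = z + cumul m p] for naturals [z] and [m]; the jumps of
    [frac] are the case [m = 0]. *)
Lemma code_exceptional p : O p -> exists N : set R, countable N /\
  forall t, 0 < t -> ~ N t ->
    0 < frac (nu p * t) /\ forall m, frac (nu p * t) != cumul m p.
Proof.
move=> Op.
pose N := \bigcup_(z in [set: nat]) \bigcup_(m in [set: nat])
  [set (z%:R + cumul m p) / nu p].
have nu0 := nu_gt0 Op.
exists N; split.
  by apply: bigcup_countable => // z _; apply: bigcup_countable.
have ne t m : 0 < t -> ~ N t -> frac (nu p * t) != cumul m p.
  move=> t0 Nt; apply/eqP => fc; apply: Nt.
  exists (Num.truncn (nu p * t)) => //; exists m => //=.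
  by rewrite -fc /frac addrC subrK mulrC mulKf ?gt_eqF.
move=> t t0 Nt; split=> [|m]; last exact: ne.
have /andP[f0 _] : 0 <= frac (nu p * t) < 1.
  by apply: frac_itv; rewrite mulr_ge0// ltW.
by rewrite lt_neqAle f0 andbT eq_sym -(cumul0 p) ne.
Qed.

End coding.

(** * From local constancy in the parameter to continuity in L^1 *)

(** Dominated convergence is a statement on sequences; this transfers it to the neighbourhood filter
    of a pseudometric space. *)
Lemma sequential_cvg {R : realType} {P : pseudoMetricType R} {V : normedModType R}
    (f : P -> V) (p : P) (U : set P) : nbhs p U ->
  (forall u : nat -> P, (forall n, U (u n)) -> u n @[n --> \oo] --> p ->
     f (u n) @[n --> \oo] --> f p) ->
  f q @[q --> p] --> f p.
Proof.
move=> pU fseq; apply/cvgrPdist_lt => eps eps0; apply: contrapT => nf.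
have ex n : exists q, [/\ U q, ball p n.+1%:R^-1 q & eps <= `|f p - f q|].
  apply: contrapT => nq; apply: nf.
  have nb : nbhs p (ball p n.+1%:R^-1) by exact: nbhsx_ballx.
  apply: filterS (filterI pU nb) => q [Uq bq]; rewrite ltNge.
  by apply/negP => fq; apply: nq; exists q.
have [u hu] := choice ex.
have up : u n @[n --> \oo] --> p.
  apply/cvg_ballP => e e0.
  near=> n; have [_ + _] := hu n; apply: le_ball; apply: ltW.
  by near: n; exact: (near_infty_natSinv_lt (PosNum e0)).
have /cvgrPdist_lt/(_ _ eps0)[N _ /(_ N (leqnn N))] :=
  fseq u (fun n => let: And3 Un _ _ := hu n in Un) up.
by have [_ _] := hu N; rewrite leNgt => /negP.
Unshelve. all: by end_near. Qed.

Lemma eventually_eq_cvg_L1 d (T : measurableType d) (R : realType)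
    (mu : {measure set T -> \bar R}) (E : completeNormedModType R) (D : set T)
    (w : nat -> T -> E) (v : T -> E) (g : T -> R) :
  measure_is_complete mu -> measurable D ->
  (forall n, strongly_measurable mu D (w n)) -> strongly_measurable mu D v ->
  {ae mu, forall t, D t -> \forall n \near \oo, w n t = v t} ->
  mu.-integrable D (EFin \o g) ->
  (forall n, {ae mu, forall t, D t -> `|w n t| <= g t}) ->
  {ae mu, forall t, D t -> `|v t| <= g t} ->
  (\int[mu]_(t in D) `|w n t - v t|%:E)%E @[n --> \oo] --> 0%E.
Proof.
move=> cmu mD mw mv wv ig wg vg.
have [||||| _ _ +] := @dominated_convergence _ _ _ mu D mD
    (fun n t => `|w n t - v t|%:E) (fun=> 0%E) (fun t => (2 * g t)%:E).
- by move=> n; apply/measurable_EFinP; exact: (measurable_dist cmu mD (mw n) mv).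
- exact: measurable_cst.
- apply: filterS wv => t wv Dt; apply: cvg_near_cst.
  by apply: filterS (wv Dt) => n ->; rewrite subrr normr0.
- by under eq_fun do rewrite EFinM; exact: integrableZl.
- have /ae_foralln := wg; apply: filterS2 vg => t vg wg' t' n.
  rewrite abse_EFin normr_id lee_fin (le_trans (ler_normB _ _))//.
  rewrite mulr_natl mulr2n lerD//.
    exact: wg'.
  exact: vg.
by rewrite integral0.
Qed.

Section L1_continuity.
Context {R : realType} (T : R) {E : completeNormedModType R}.
Local Notation I := `[0, T]%classic.
Local Notation lambda := (@completed_lebesgue_measure R).

Let clambda := @completed_lebesgue_measure_is_complete R.

(** The neighbourhood on which [w q t] is constant may depend on [t]. A sequence tending to [p]
    eventually enters it for almost every [t], and [g] dominates. *)
Lemma L1_of_cvg {P : pseudoMetricType R} (p : P) (w : P -> R -> E) (g : R -> R) :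
  (\forall q \near p, bochner_integrable lambda I (w q)) ->
  {ae lambda, forall t, I t -> \forall q \near p, w q t = w p t} ->
  lambda.-integrable I (EFin \o g) ->
  (\forall q \near p, {ae lambda, forall t, I t -> `|w q t| <= g t}) ->
  L1_of T (w q) @[q --> p] --> L1_of T (w p).
Proof.
move=> bw wp ig wg.
apply: (sequential_cvg (filterI bw wg)) => u Uu up.
have [bp gp] := nbhs_singleton (filterI bw wg).
have wu : {ae lambda, forall t, I t -> \forall n \near \oo, w (u n) t = w p t}.
  by apply: filterS wp => t wp It; have := up _ (wp It).
have := eventually_eq_cvg_L1 clambda (lebesgue_measurable_itv `[0, T])
  (fun n => (Uu n).1.1) bp.1 wu ig (fun n => (Uu n).2) gp.
move=> H; apply/cvgrPdist_lt => eps eps0.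
have eps0E : (0 < eps%:E)%E by rewrite lte_fin.
apply: filterS (cvge_lt_near H eps0E) => n; rewrite distrC -lte_fin.
by rewrite (L1_of_distE (Uu n).1 bp).
Qed.

End L1_continuity.

(** * Completed Lebesgue measure and the iteration on an interval *)

Section completed_lebesgue.
Context {R : realType}.
Local Notation lambda := (@completed_lebesgue_measure R).
Local Notation calR := (caratheodory_type (@wlength R idfun)^*%mu).

Lemma borel_lebesgue_measurable (A : set R) :
  @measurable _ (measurableTypeR R) A -> @measurable _ calR A.
Proof. exact: sub_caratheodory. Qed.

Lemma borel_lebesgue_measurable_fun (D : set R) (f : R -> R) :
  @measurable _ (measurableTypeR R) D ->
  @measurable_fun _ _ (measurableTypeR R) _ D f ->
  @measurable_fun _ _ calR _ D f.
Proof. by move=> mD mf _ B mB; apply: borel_lebesgue_measurable; exact: mf. Qed.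

Lemma lambda_countable (N : set R) : countable N -> lambda N = 0%E.
Proof. exact: countable_lebesgue_measure0. Qed.

Lemma ae_countable (N : set R) : countable N -> {ae lambda, forall t, ~ N t}.
Proof.
move=> cN; exists N; split; [|exact: lambda_countable|].
  exact/borel_lebesgue_measurable/countable_measurable.
by move=> t /contrapT.
Qed.

Section volterra_iteration_itv.
Variables (T : R) (gamma : R -> R) (K : R).
Local Notation I := `[0, T]%classic.
Hypothesis gamma0 : forall t, 0 <= gamma t.
Hypothesis gamma_int : lambda.-integrable I (EFin \o gamma).
Hypothesis K0 : 0 <= K.

Let mitv (i : interval R) := lebesgue_measurable_itv i.

(** By absolute continuity of the integral of [gamma], cells of some length [h] satisfy the
    smallness required of the chain; [eta] carries [K + 1] so that [K = 0] is covered. *)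
Lemma volterra_iteration_itv : exists2 C : R, 0 <= C &
  forall (e : nat -> R -> R) (c : R), 0 <= c ->
  (forall n, @measurable_fun _ _ calR _ I (e n)) ->
  (forall n t, 0 <= e n t) ->
  {ae lambda, forall t, I t -> e 0%N t <= c * gamma t} ->
  (forall n, {ae lambda, forall t, I t -> ((e n.+1 t)%:E <= (gamma t)%:E *
     (K%:E * \int[lambda]_(s in `[0%R, t]) (e n s)%:E + (c / 2 ^+ n)%:E))%E}) ->
  forall n, (\int[lambda]_(t in I) (e n t)%:E <= (C * c / 2 ^+ n)%:E)%E.
Proof.
pose eta := 4^-1 / (K + 1).
have K1 : 0 < K + 1 by rewrite ltr_wpDl.
have eta0 : 0 < eta by rewrite divr_gt0// invr_gt0.
have [h h0 hsmall] := integral_absolutely_continuous (mitv `[0, T]) gamma_int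
  gamma0 eta0.
(* The strict bound makes [A 0] empty, and the successor in [J] below makes [J * h] exceed [T], so
   that the endpoint [T] lies in [A J]. *)
pose A (j : nat) := I `&` [set t | t < j%:R * h].
have mA j : @measurable _ calR (A j).
  apply: measurableI; first exact: mitv.
  exact: mitv `]-oo, (j%:R * h)[.
pose J := (Num.truncn (T / h)).+1.
apply: (@volterra_iteration _ calR R lambda I gamma K (fun t => `[0, t]%classic)
  A J) => //.
- exact: mitv.
- by move=> t; exact: mitv.
- apply/seteqP; split=> // t [/=]; rewrite in_itv/= mul0r => /andP[t0 _].
  by rewrite ltNge t0.
- apply/seteqP; split=> [t []//|t It]; split => //=.
  move: It; rewrite /= in_itv/= => /andP[_ tT].
  apply: le_lt_trans tT _; rewrite -ltr_pdivrMr//; exact: truncnS_gt.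
- move=> j t [It tj]; split => //; apply: lt_le_trans tj _.
  by rewrite ler_pM2r// ler_nat.
- by move=> j t [].
- move=> j t [/= It tj] s; rewrite /= in_itv/= => /andP[s0 st]; split => /=.
    move: It; rewrite !in_itv/= => /andP[_ tT].
    by rewrite s0 (le_trans st tT).
  exact: le_lt_trans st tj.
- move=> j; apply: (@le_trans _ _ (K%:E * eta%:E)%E); last first.
    rewrite -EFinM lee_fin /eta mulrCA ler_piMr ?invr_ge0//.
    by rewrite ler_pdivrMr// mul1r lerDl.
  rewrite lee_wpmul2l//; apply: hsmall.
  + exact: measurableD.
  + by move=> t [[]].
  + apply: (@le_trans _ _ (lambda `[(j%:R * h), (j.+1%:R * h)]%classic)).
      apply: le_measure; rewrite ?inE.
      * exact: measurableD.
      * exact: mitv.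
      * move=> t [[It /= tj1] tj]; rewrite /= in_itv/= (ltW tj1) andbT leNgt.
        by apply/negP => tj'; apply: tj.
    rewrite completed_lebesgue_measure_itv/= lte_fin ltr_pM2r// ltr_nat ltnSn.
    by rewrite -EFinB lee_fin -mulrBl -natrB// subSnn mul1r.
Qed.

End volterra_iteration_itv.

End completed_lebesgue.

(** * Separability of C(I, E) *)

Section continuous_path_space.
Context {R : realType} (T : R) {E : completeNormedModType R}.
Hypothesis sepE : separable E.
Local Notation I := `[0, T]%classic.
Local Notation lambda := (@completed_lebesgue_measure R).

Let mI := lebesgue_measurable_itv `[0, T].

Lemma cont_strongly_measurable (X : cont_space T E) :
  strongly_measurable lambda I X.
Proof.
apply: (strongly_measurable_pettis lambda mI sepE) => y.
apply: borel_lebesgue_measurable_fun; first exact: measurable_itv.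
apply: subspace_continuous_measurable_fun; first exact: measurable_itv.
have [cX _] := cont_spaceP X.
move=> t; apply: (@cvg_norm _ E); apply: cvgB; [exact: cX|exact: cvg_cst].
Qed.

Lemma cont_space_dist_le (X Y : cont_space T E) t : I t ->
  `|X t - Y t| <= `|X - Y|.
Proof. by move=> It; exact: (@le_maxnorm _ _ _ (X - Y) t It). Qed.

Lemma cont_space_dist_ge (X Y : cont_space T E) M : 0 <= M ->
  (forall t, I t -> `|X t - Y t| <= M) -> `|X - Y| <= M.
Proof. by move=> M0 XYM; exact: (@maxnorm_le _ _ _ (X - Y) M M0 XYM). Qed.

Lemma cont_unif (X : cont_space T E) eps : 0 < eps -> exists N : nat,
  forall s t, I s -> I t -> `|s - t| < N.+1%:R^-1 -> `|X s - X t| <= eps.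
Proof.
move=> eps0; have [/subspace_continuousP cX _] := cont_spaceP X.
pose Q (N : nat) t := I t -> forall s, I s -> `|s - t| < N.+1%:R^-1 ->
  `|X s - X t| <= eps.
have /compact_near_coveringP/(_ nat \oo Q) := @segment_compact R 0 T.
case.
  move=> t It; have eps2 : 0 < eps / 2 by rewrite divr_gt0.
  have /cvgrPdist_lt/(_ _ eps2) := cX t It.
  rewrite near_withinE => /nbhs_ballP[d /= d0 dX].
  have d2 : 0 < d / 2 by rewrite divr_gt0.
  have [N _ HN] := near_infty_natSinv_lt (PosNum d2).
  exists (ball t (d / 2), [set n | (N <= n)%N]).
    by split => /=; [exact: nbhsx_ballx|exists N].
  move=> [t' n] /= [tt' Nn] It' s Is st'.
  have {}tt' : `|t - t'| < d / 2 by move: tt'; rewrite -ball_normE.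
  have st : `|t - s| < d.
    apply: le_lt_trans (ler_distD t' _ _) _; rewrite [d]splitr ltrD//.
    by rewrite distrC (lt_trans st')//; exact: HN.
  have Xs : `|X t - X s| < eps / 2.
    by apply: dX => //; rewrite -ball_normE.
  have Xt' : `|X t - X t'| < eps / 2.
    apply: dX => //; rewrite -ball_normE/= (lt_trans tt')//.
    by rewrite ltr_pdivrMr// ltr_pMr// ltr1n.
  apply: le_trans (ler_distD (X t) _ _) _.
  by rewrite [eps]splitr distrC lerD// ltW.
by move=> N _ /(_ N (leqnn N)) HN; exists N => s t Is It; exact: HN.
Qed.

(* A net of C(I, E) is indexed by a precision, a mesh, and indices of points of
   the dense sequence approximated at the nodes of the mesh. *)
Lemma cont_space_dense : exists c : nat -> cont_space T E,
  forall X eps, 0 < eps -> exists n, `|X - c n| < eps.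
Proof.
have [e de] := separable_enum (0 : E) sepE.
pose near_grid (i : nat * nat * seq nat) (X : cont_space T E) :=
  forall t, I t ->
    `|X t - e (nth 0%N i.2 (Num.truncn (i.1.2.+1%:R * t)))| <= i.1.1.+1%:R^-1.
pose c n : cont_space T E := if unpickle n is Some i
  then xget 0 (near_grid i) else 0.
exists c => X eps eps0.
have eps2 : 0 < eps / 2 by rewrite divr_gt0.
have [m _ /(_ m (leqnn m)) /= mlt] := near_infty_natSinv_lt (PosNum eps2).
have m2 : 0 < m.+1%:R^-1 / 2 :> R by rewrite divr_gt0// invr_gt0.
have [N HN] := cont_unif X m2.
have N0 : 0 < N.+1%:R :> R by [].
have ex k : exists j, `|X (k%:R / N.+1%:R) - e j| < m.+1%:R^-1 / 2.
  have oB : open (ball (X (k%:R / N.+1%:R)) (m.+1%:R^-1 / 2)).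
    exact: ball_open.
  have [|j] := de _ oB; first by exists (X (k%:R / N.+1%:R)); exact: ballxx.
  by rewrite -ball_normE => Xj; exists j.
have [g hg] := choice ex.
(* The list includes the index of the cell that contains [T]. *)
pose i := (m, N, mkseq g (Num.truncn (N.+1%:R * T)).+1).
have Xi : near_grid i X.
  move=> t It /=; have := It; rewrite /= in_itv/= => /andP[t0 tT].
  set k := Num.truncn (_ * t).
  have kt : k%:R / N.+1%:R <= t.
    by rewrite ler_pdivrMr// mulrC truncn_le mulr_ge0.
  have tk : t - k%:R / N.+1%:R < N.+1%:R^-1.
    rewrite ltrBlDl -[X in _ + X]mul1r -mulrDl ltr_pdivlMr// mulrC.
    by rewrite -(natrD R _ 1) addn1 truncnS_gt.
  have Ik : I (k%:R / N.+1%:R).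
    by rewrite /= in_itv/= divr_ge0//= (le_trans kt).
  rewrite nth_mkseq; last first.
    by rewrite ltnS /k; apply: le_truncn; rewrite ler_pM2l.
  apply: le_trans (ler_distD (X (k%:R / N.+1%:R)) _ _) _.
  rewrite [m.+1%:R^-1]splitr lerD//; last exact: ltW.
  by apply: HN => //; rewrite ger0_norm// subr_ge0.
exists (pickle i); rewrite /c pickleK.
case: xgetP => [Y _ Yi|/(_ X)//].
(* The member of the net is some function near the same grid values, not [X] itself, so the
   precision is counted twice. *)
apply: le_lt_trans (_ : m.+1%:R^-1 + m.+1%:R^-1 < _); last first.
  by rewrite [eps]splitr ltrD.
apply: cont_space_dist_ge => [|t It]; first by rewrite addr_ge0.
apply: le_trans (ler_distD (e (nth 0%N i.2 (Num.truncn (i.1.2.+1%:R * t)))) _ _) _.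
by rewrite lerD//; [exact: Xi|rewrite distrC; exact: Yi].
Qed.

End continuous_path_space.

(** * Measurability of the coding *)

Section code_measurable.
Context {R : realType}.
Local Notation calR := (caratheodory_type (@wlength R idfun)^*%mu).

Lemma frac_itvP (nu a b t : R) : 0 < nu -> 0 <= a -> b <= 1 -> 0 <= t ->
  (a <= frac (nu * t) < b) <->
  exists z : nat, t \in `[((z%:R + a) / nu), ((z%:R + b) / nu)[.
Proof.
move=> nu0 a0 b1 t0; have nut0 : 0 <= nu * t by rewrite mulr_ge0// ltW.
split=> [|[z]].
  rewrite /frac => /andP[at_ tb]; exists (Num.truncn (nu * t)).
  rewrite in_itv/= ler_pdivrMr// ltr_pdivlMr// [t * _]mulrC.
  by apply/andP; split; lra.
rewrite in_itv/= ler_pdivrMr// ltr_pdivlMr// [t * _]mulrC => /andP[zt tz].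
rewrite /frac (@truncn_def _ _ z) ?lerBrDl ?ltrBlDl ?zt//.
rewrite (le_trans _ zt) ?lerDl//= (lt_le_trans tz)//.
by rewrite -addn1 natrD lerD2l.
Qed.

Lemma measurable_frac (nu a b : R) : 0 < nu -> 0 <= a -> b <= 1 ->
  @measurable _ calR [set t | 0 <= t /\ a <= frac (nu * t) < b].
Proof.
move=> nu0 a0 b1; rewrite (_ : [set t | _] =
  \bigcup_(z in [set: nat]) `[((z%:R + a) / nu), ((z%:R + b) / nu)[%classic).
  by apply: bigcup_measurable => z _; exact: lebesgue_measurable_itv.
apply/seteqP; split=> t.
  by move=> [t0 /(frac_itvP nu0 a0 b1 t0)[z tz]]; exists z.
move=> [z _ /= tz]; have t0 : 0 <= t.
  move: tz; rewrite in_itv/= => /andP[+ _]; apply: le_trans.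
  by rewrite divr_ge0 ?addr_ge0// ltW.
by split => //; apply/(frac_itvP nu0 a0 b1 t0); exists z.
Qed.

Lemma measurable_code {P : topologicalType} (O : set P) sigma nu (p : P)
    (D : set R) m :
  (forall n p, 0 <= sigma n p) ->
  (forall p, O p -> exists n, 1 < sigma n p) ->
  (forall p, O p -> 0 < nu p) -> O p ->
  @measurable _ calR D -> (forall t, D t -> 0 <= t) ->
  @measurable _ calR (D `&` code sigma nu p @^-1` [set m]).
Proof.
move=> s0 s1 nu0 Op mD D0.
rewrite (_ : _ `&` _ = D `&` [set t | 0 <= t /\
    cumul sigma m p <= frac (nu p * t) < cumul sigma m.+1 p]).
  apply: measurableI => //; apply: measurable_frac; first exact: nu0.
    by rewrite -(cumul0 sigma p); apply: cumul_le.
  by rewrite /cumul ge_min lexx.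
apply/seteqP; split=> t [Dt].
  move=> /= /(codeP s0 s1 nu0 _ Op (D0 t Dt)) ct; split => //=.
  by split => //; exact: D0.
by move=> /= [t0 ct]; split => //=; exact/(codeP s0 s1 nu0 _ Op t0).
Qed.

End code_measurable.

Lemma bochner_integrable_dominated d (T : measurableType d) (R : realType)
    (mu : {measure set T -> \bar R}) (E : completeNormedModType R) (D : set T)
    (f : T -> E) (g : T -> R) :
  measure_is_complete mu -> measurable D -> separable E ->
  strongly_measurable mu D f -> mu.-integrable D (EFin \o g) ->
  {ae mu, forall t, D t -> `|f t| <= g t} -> bochner_integrable mu D f.
Proof.
move=> cmu mD sepE mf ig fg; apply: bochner_integrable_fin_norm => //.
have /integrableP[mg] := ig; apply: le_lt_trans.
apply: ae_ge0_le_integral => //.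
- exact: (measurable_normE cmu mD mf).
- exact: measurableT_comp.
- apply: filterS fg => t fg Dt; rewrite lee_fin.
  by rewrite (le_trans (fg Dt))// ler_norm.
Qed.

Lemma integral_distS d (T : measurableType d) (R : realType)
    (mu : {measure set T -> \bar R}) (E : completeNormedModType R) (A D : set T)
    (f g : T -> E) :
  measure_is_complete mu -> measurable A -> measurable D -> A `<=` D ->
  strongly_measurable mu D f -> strongly_measurable mu D g ->
  (\int[mu]_(t in A) `|f t - g t|%:E <= \int[mu]_(t in D) `|f t - g t|%:E)%E.
Proof.
move=> cmu mA mD AD mf mg; apply: ge0_subset_integral => //.
by apply/measurable_EFinP; exact: (measurable_dist cmu mD mf mg).
Qed.

Lemma bump_cvg {R : realType} {P : topologicalType} {V : normedModType R}
    (X : P -> V) (delta : P -> R) (p : P) (c : V) (r : R) :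
  X q @[q --> p] --> X p -> delta q @[q --> p] --> delta p -> delta p != 0 ->
  Num.max 0 (2 - 2 * (`|X q - c| + r) / delta q) @[q --> p] -->
  Num.max 0 (2 - 2 * (`|X p - c| + r) / delta p).
Proof.
move=> cX cd d0.
have S1 : `|X q - c| + r @[q --> p] --> `|X p - c| + r.
  apply: (@cvgD R R^o); last exact: cvg_cst.
  by apply: cvg_norm; apply: cvgB; [exact: cX|exact: cvg_cst].
have S2 : (delta q)^-1 @[q --> p] --> (delta p)^-1 by exact: cvgV.
have S3 : 2 * (`|X q - c| + r) / delta q @[q --> p] -->
    2 * (`|X p - c| + r) / delta p by exact: cvgM (cvgM (cvg_cst _) S1) S2.
have S4 : 2 - 2 * (`|X q - c| + r) / delta q @[q --> p] -->
    2 - 2 * (`|X p - c| + r) / delta p by exact: cvgB (cvg_cst _) S3.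
exact: (continuous_max (cvg_cst _) S4).
Qed.

Lemma domination_arith {R : realFieldType} (A B r1 r2 r3 a b G s d g : R) :
  A <= r1 + b -> r1 <= B + r2 -> r2 <= r3 + a -> r3 <= G ->
  a <= G * (s + 1) -> b <= G * (d + 1) -> B <= g ->
  A + B <= 2 * g + (3 + s + d) * G.
Proof. by move=> *; lra. Qed.

(** * Continuous families of exact solutions *)

Section selection_scheme.
Context {R : realType} (T : R) {E : completeNormedModType R}.
Hypothesis sepE : separable E.
Local Notation I := `[0, T]%classic.
Local Notation lambda := (@completed_lebesgue_measure R).
Local Notation calR := (caratheodory_type (@wlength R idfun)^*%mu).

Let clambda := @completed_lebesgue_measure_is_complete R.

Let mI := lebesgue_measurable_itv `[0, T].

Variables (F : R -> E -> set E) (gamma : R -> R).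
Hypothesis F0 : forall t x, I t -> F t x !=set0.
Hypothesis Fclosed : forall t x, I t -> closed (F t x).
Hypothesis Fmeasurable : forall x C, open C ->
  @measurable _ calR [set t | I t /\ F t x `<=` C].
Hypothesis Flip : {ae lambda, forall t, I t -> forall x y,
  (hausdorff_dist (F t x) (F t y) <= (gamma t * `|x - y|)%:E)%E}.
Hypothesis Fzero : {ae lambda, forall t, I t -> rdist 0 (F t 0) <= gamma t}.
Hypothesis gamma1 : forall t, 1 <= gamma t.
Hypothesis gamma_int : lambda.-integrable I (EFin \o gamma).

Variables (V : L1 T E -> cont_space T E) (K : R).
Hypothesis K0 : 0 <= K.
Hypothesis V_dist : forall (w v : L1 T E) t, I t ->
  (`|V w t - V v t|%:E <=
   K%:E * \int[lambda]_(s in `[0%R, t]) `|w s - v s|%:E)%E.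

Let gamma0 t : 0 <= gamma t.
Proof. exact: le_trans ler01 (gamma1 t). Qed.

Lemma V_lipschitz w v : `|V w - V v| <= K * `|w - v|.
Proof.
apply: cont_space_dist_ge => [|t It]; first by rewrite mulr_ge0.
rewrite -lee_fin EFinM; apply: le_trans (V_dist w v It) _.
rewrite L1_distE lee_wpmul2l//.
apply: (integral_distS clambda (lebesgue_measurable_itv `[0, t]) mI _
  (L1_measurable w) (L1_measurable v)).
move: It; rewrite /= in_itv/= => /andP[_ tT] s; rewrite /= !in_itv/=.
by move=> /andP[-> st]; exact: le_trans st tT.
Qed.

Lemma rdist_lip_ae : {ae lambda, forall t, I t -> forall w x y,
  rdist w (F t y) <= rdist w (F t x) + gamma t * `|x - y|}.
Proof.
apply: filterS Flip => t Ft It w x y.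
by apply: rdist_hausdorff (Ft It x y); exact: F0.
Qed.

Section parameter_space.
Context {P : pseudoMetricType R}.
Variable O : set P.
Hypothesis oO : open O.

(* By dominated convergence, such families depend continuously on p in L^1. *)
Definition locally_constant_family (w : P -> R -> E) := forall p, O p ->
  [/\ bochner_integrable lambda I (w p),
      {ae lambda, forall t, I t -> \forall q \near p, w q t = w p t} &
      exists2 g, lambda.-integrable I (EFin \o g) &
        \forall q \near p, {ae lambda, forall t, I t -> `|w q t| <= g t}].

Let O_near p : O p -> \forall q \near p, O q.
Proof. by move=> Op; exact: open_nbhs_nbhs. Qed.

Lemma locally_constant_cvg w p : locally_constant_family w -> O p ->
  L1_of T (w q) @[q --> p] --> L1_of T (w p).
Proof.
move=> lw Op; have [_ cw [g ig wg]] := lw p Op.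
apply: (L1_of_cvg _ cw ig wg).
by apply: filterS (O_near Op) => q /lw[].
Qed.

Variable H : P -> cont_space T E.
Hypothesis H_cvg : forall p, O p -> H q @[q --> p] --> H p.
Variable delta : P -> R.
Hypothesis delta_gt0 : forall p, O p -> 0 < delta p.
Hypothesis delta_cvg : forall p, O p -> delta q @[q --> p] --> delta p.

Definition state (w : P -> R -> E) (p : P) := H p + V (L1_of T (w p)).

Lemma state_cvg w p : locally_constant_family w -> O p ->
  state w q @[q --> p] --> state w p.
Proof.
move=> lw Op; apply: cvgD; first exact: H_cvg.
have /cvgrPdist_lt wq := locally_constant_cvg lw Op.
apply/cvgrPdist_lt => eps eps0; have K1 : 0 < K + 1 by rewrite ltr_wpDl.
have e0 : 0 < eps / (K + 1) by rewrite divr_gt0.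
apply: filterS (wq _ e0) => q wqp; apply: le_lt_trans (V_lipschitz _ _) _.
rewrite ltr_pdivlMr// in wqp; rewrite mulrC; apply: le_lt_trans wqp.
by rewrite ler_wpM2l// lerDl.
Qed.

(** Selections chosen separately for each [p] would not vary continuously. They are taken only along
    the countably many paths [ctr m] and glued. Replacing the state by a nearby centre costs
    [gamma t] times their distance; since [gamma >= 1], the selection tolerance [rad m] is also at
    most [gamma t * rad m]. *)
Lemma selection_step w : locally_constant_family w ->
  exists2 w', locally_constant_family w' & forall p, O p ->
    {ae lambda, forall t, I t ->
      `|w' p t - w p t| <= rdist (w p t) (F t (state w p t)) + gamma t * delta p /\
      rdist (w' p t) (F t (state w p t)) <= gamma t * delta p}.
Proof.
move=> lw. have [c dc] := cont_space_dense T sepE.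
pose ix m : nat * nat := odflt (0, 0)%N (unpickle m).
pose ctr m := c (ix m).1.
pose rad m : R := (ix m).2.+1%:R^-1.
have rad0 m : 0 < rad m by rewrite invr_gt0.
(* The tent is positive exactly when distance plus [rad m] is below [delta p], and exceeds 1 when it
   is below [delta p / 2]. The weight thus fixes the centre and the precision together. *)
pose sigma m p : R :=
  Num.max 0 (2 - 2 * (`|state w p - ctr m| + rad m) / delta p).
have sigma0 m p : 0 <= sigma m p by rewrite le_max lexx.
have sigma_cvg m p : O p -> sigma m q @[q --> p] --> sigma m p.
  move=> Op.
  by apply: bump_cvg; [exact: state_cvg|exact: delta_cvg|rewrite gt_eqF ?delta_gt0].
have sigma1 p : O p -> exists m, 1 < sigma m p.
  move=> Op; have d4 : 0 < delta p / 4 by rewrite divr_gt0// delta_gt0.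
  have [a ca] := dc (state w p) _ d4.
  have [l _ /(_ l (leqnn l)) /= hl] := near_infty_natSinv_lt (PosNum d4).
  exists (pickle (a, l)); rewrite /sigma /ctr /rad /ix pickleK/= lt_max.
  apply/orP; right; rewrite ltrBrDl -ltrBrDr ltr_pdivrMr ?delta_gt0//.
  move: ca hl; set u := `|_ - c a|; set v := _^-1 => u4 v4.
  by rewrite (_ : _ * delta p = 2 * (delta p / 4 + delta p / 4)) ?ltr_pM2l ?ltrD//; lra.
have sigmaP m p : O p -> 0 < sigma m p -> `|state w p - ctr m| + rad m < delta p.
  move=> Op; rewrite /sigma lt_max ltxx/= subr_gt0.
  by rewrite ltr_pdivrMr ?delta_gt0// ltr_pM2l.
pose nu : P -> R := cst 1.
have nu0 p : O p -> 0 < nu p by [].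
have nu_cvg p : O p -> nu q @[q --> p] --> nu p by move=> _; exact: cvg_cst.
have ctrm m := cont_strongly_measurable sepE (ctr m).
have [Z hZ] := choice (fun m => measurable_selection clambda mI sepE F0 Fclosed
  Fmeasurable Flip (rad0 m) (ctrm m)).
(* The parameter enters only through the code and the value [w p t], so local constancy is inherited
   from both. *)
pose w' p t := Z (code sigma nu p t) t (w p t).
have It0 t : I t -> 0 <= t by rewrite /= in_itv/= => /andP[].
have w'P p : O p -> {ae lambda, forall t, I t ->
    `|w' p t - w p t| <= rdist (w p t) (F t (state w p t)) + gamma t * delta p /\
    rdist (w' p t) (F t (state w p t)) <= gamma t * delta p}.
  move=> Op; apply: filterS rdist_lip_ae => t Ft It.
  have {}Ft := Ft It; have t0 := It0 t It.
  have := code_sigma_gt0 sigma0 sigma1 nu0 Op t0.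
  rewrite /w'; set m := code _ _ _ _ => /(sigmaP m p Op) sm.
  have [FZ Zw] := (hZ m).2 t (w p t) It.
  have dXt := cont_space_dist_le (state w p) (ctr m) It.
  have sm' : `|state w p t - ctr m t| + rad m <= delta p.
    by apply: ltW; apply: le_lt_trans sm; rewrite lerD2r.
  have g1 := gamma1 t; have r0 := rad0 m.
  split.
    apply: le_trans Zw _.
    apply: le_trans (lerD (Ft (w p t) (state w p t) (ctr m t)) (lexx _)) _.
    rewrite -addrA lerD2l.
    apply: (@le_trans _ _ (gamma t * (`|state w p t - ctr m t| + rad m))).
      by rewrite mulrDr lerD2l ler_peMl// ltW.
    by rewrite ler_wpM2l.
  apply: le_trans (Ft _ (ctr m t) _) _.
  have -> : rdist (Z m t (w p t)) (F t (ctr m t)) = 0.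
    apply/eqP; rewrite eq_le rdist_ge0 andbT.
    by apply: le_trans (rdist_le _ FZ) _; rewrite subrr normr0.
  rewrite add0r ler_wpM2l// distrC.
  by apply: le_trans sm'; rewrite lerDl ltW.
exists w' => // p Op; have [bw cw [g ig wg]] := lw p Op.
(* One unit comes from [Fzero], one from the variation of the norm of the state near [p], one from
   that of [delta]. *)
pose C := 3 + `|state w p| + delta p.
have dp0 := delta_gt0 Op.
have C0 : 0 <= C by rewrite addr_ge0// ltW.
pose g' t := 2 * g t + C * gamma t.
have ig' : lambda.-integrable I (EFin \o g').
  rewrite (_ : EFin \o g' = 
    fun t => (2%:E * (EFin \o g) t + C%:E * (EFin \o gamma) t)%E)//.
  by apply: (integrableD mI); apply: (integrableZl mI).
have w'g : \forall q \near p,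
    {ae lambda, forall t, I t -> `|w' q t| <= g' t}.
  have near_state : \forall q \near p, `|state w q| <= `|state w p| + 1.
    have sn : `|state w q| @[q --> p] --> `|state w p|.
      exact: cvg_norm (state_cvg lw Op).
    by apply: (cvgr_le _ sn); rewrite ltrDl.
  have near_delta : \forall q \near p, delta q <= delta p + 1.
    by apply: (cvgr_le _ (delta_cvg Op)); rewrite ltrDl.
  near=> q.
  have Oq : O q by near: q; exact: O_near.
  have sq : `|state w q| <= `|state w p| + 1 by near: q.
  have dq : delta q <= delta p + 1 by near: q.
  have wgq : {ae lambda, forall t, I t -> `|w q t| <= g t} by near: q.
  apply: filterS2 (filterI (w'P q Oq) rdist_lip_ae) (filterI wgq Fzero) => t.
  move=> [w'q Ft] [wq Fz] It.
  have [{}w'q _] := w'q It; have {}Ft := Ft It.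
  have {}wq := wq It; have {}Fz := Fz It.
  have h1 := rdist_lip (w q t) 0 (F0 (state w q t) It).
  have h2 := Ft 0 0 (state w q t).
  have h3 : `|0 - state w q t| <= `|state w q|.
    by rewrite sub0r normrN; exact: (@le_maxnorm _ _ _ (state w q) t It).
  rewrite subr0 in h1.
  have h4 : gamma t * `|0 - state w q t| <= gamma t * (`|state w p| + 1).
    by rewrite ler_wpM2l// (le_trans h3).
  have h5 : gamma t * delta q <= gamma t * (delta p + 1) by rewrite ler_wpM2l.
  rewrite -(subrK (w q t) (w' q t)).
  apply: le_trans (ler_normD _ _) _.
  exact: domination_arith w'q h1 h2 Fz h4 h5 wq.
split => //.
- apply: (bochner_integrable_dominated clambda mI sepE _ ig' (nbhs_singleton w'g)).
  apply: (strongly_measurable_glue clambda mI sepE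
    (c := code sigma nu p) (f := fun m t => Z m t (w p t))).
    by move=> m; apply: (measurable_code (O := O)).
  by move=> m; apply: (hZ m).1; have [] := bw.
- have [N [cN HN]] := code_exceptional sigma nu0 Op.
  have c0 := ae_countable (countable1 (0 : R)).
  apply: filterS2 cw (filterI (ae_countable cN) c0) => t cw [Nt t0'] It.
  have t0 : 0 < t.
    by rewrite lt_neqAle It0// andbT; apply/eqP => t0; apply: t0'.
  have [f0 fc] := HN t t0 Nt.
  have := code_near_cst sigma0 sigma_cvg sigma1 nu0 nu_cvg oO Op t0 f0 fc.
  by apply: filterS2 (cw It) => q wq cq; rewrite /w' cq wq.
- by exists g'.
Unshelve. all: by end_near. Qed.

End parameter_space.

Lemma tolerance_arith {K' : realFieldType} (b d q : K') :
  0 <= b -> 0 <= d -> 0 <= q -> d * q + d * (2^-1 * q) <= 2 * (b + d) * q.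
Proof. by move=> b0 d0 q0; nra. Qed.

Lemma geometric_small (D eps : R) : 0 < eps -> exists n, D / 2 ^+ n < eps.
Proof.
move=> eps0; have := cvg_geometric D (z := 2^-1 : R).
rewrite ger0_norm ?invr_ge0// invf_lt1// ltr1n => /(_ isT).
move/cvgrPdist_lt => /(_ _ eps0)[N _ /(_ N (leqnn N))].
rewrite /= sub0r normrN exprVn => h; exists N.
exact: le_lt_trans (ler_norm _) h.
Qed.

Lemma dist_lt3 {W : normedModType R} (a b c d : W) (e : R) :
  `|a - b| < e / 3 -> `|b - c| < e / 3 -> `|d - c| < e / 3 -> `|a - d| < e.
Proof.
move=> ab bc dc; apply: le_lt_trans (ler_distD b _ _) _.
apply: le_lt_trans (lerD (lexx _) (ler_distD c _ _)) _.
have -> : e = e / 3 + (e / 3 + e / 3) by lra.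
by rewrite ltrD// ltrD// distrC.
Qed.

(** The distance from [l t] to the set at the limit state is at most [|l t - w n.+1 p t|] plus a
    multiple of [gamma t / 2 ^ n], the second term collecting the tolerance and the change of state.
    Both tend to 0, and [F] has closed values. *)
Lemma solution_of_iterates (P : pseudoMetricType R) (H : P -> cont_space T E)
    (w : nat -> P -> R -> E) (l : L1 T E) (p : P) (delta D : R) : 0 < delta ->
  (forall n, bochner_integrable lambda I (w n p)) ->
  {ae lambda, forall t, I t -> w n p t @[n --> \oo] --> l t} ->
  (forall n, `|l - L1_of T (w n p)| <= D / 2 ^+ n) ->
  (forall n, {ae lambda, forall t, I t ->
    `|w n.+1 p t - w n p t| <= rdist (w n p t) (F t (state H (w n) p t)) +
       gamma t * (delta / 2 ^+ n) /\
    rdist (w n.+1 p t) (F t (state H (w n) p t)) <=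
       gamma t * (delta / 2 ^+ n)}) ->
  {ae lambda, forall t, I t -> F t (H p t + V l t) (l t)}.
Proof.
move=> d0 bw wl lD wS.
have wS' := ae_foralln wS.
apply: filterS3 rdist_lip_ae wl wS' => t Ft wl {}wS It.
have {}Ft := Ft It; have {}wl := wl It; have {}wS n := (wS n It).2.
apply: rdist_closed; [exact: F0|exact: Fclosed|].
have D0 : 0 <= D by have := lD 0%N; rewrite expr0 divr1; apply: le_trans.
have bound n : rdist (l t) (F t (H p t + V l t)) <=
    `|l t - w n.+1 p t| + gamma t * (delta + K * D) / 2 ^+ n.
  have h1 := rdist_lip (l t) (w n.+1 p t) (F0 (H p t + V l t) It).
  apply: le_trans h1 _; rewrite lerD2l.
  have h2 := Ft (w n.+1 p t) (state H (w n) p t) (H p t + V l t).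
  apply: le_trans h2 _.
  have -> : state H (w n) p t - (H p t + V l t) = V (L1_of T (w n p)) t - V l t.
    by rewrite /state /= !fctE opprD addrACA subrr add0r.
  have h3 : `|V (L1_of T (w n p)) t - V l t| <= K * D / 2 ^+ n.
    apply: le_trans (cont_space_dist_le _ _ It) _.
    apply: le_trans (V_lipschitz _ _) _.
    by rewrite -mulrA ler_wpM2l// distrC.
  apply: le_trans (lerD (wS n) (ler_wpM2l (gamma0 t) h3)) _.
  by rewrite -mulrDr -mulrDl mulrA.
have to0 : `|l t - w n.+1 p t| + gamma t * (delta + K * D) / 2 ^+ n
    @[n --> \oo] --> (0 : R).
  rewrite -[X in _ --> X]addr0; apply: cvgD.
    have H1 : w n.+1 p t @[n --> \oo] --> l t by rewrite (cvg_shiftS (w ^~ p ^~ t)).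
    rewrite -(normr0 E) -(subrr (l t)).
    by apply: cvg_norm; apply: cvgB => //; exact: cvg_cst.
  have := cvg_geometric (gamma t * (delta + K * D)) (z := 2^-1 : R).
  rewrite ger0_norm ?invr_ge0// invf_lt1// ltr1n => /(_ isT).
  have -> : geometric (gamma t * (delta + K * D)) 2^-1 =
      (fun n => gamma t * (delta + K * D) / 2 ^+ n).
    by apply/funext => n; rewrite /geometric /= exprVn.
  exact.
apply: (cvgr_to_ge to0); apply: nearW => n; exact: bound.
Qed.

(** The new function is nearly in [F] at the old state; moving to the new state costs [gamma t]
    times the change of [V]. The two tolerances add to [3/2 * delta / 2 ^ n]; the larger constant
    [2 * (b + delta)] is taken because it also bounds the first increment. *)
Lemma iterates_increment (P : pseudoMetricType R) (H : P -> cont_space T E)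
    (w : nat -> P -> R -> E) (p : P) (delta b : R) n : 0 <= delta -> 0 <= b ->
  bochner_integrable lambda I (w n p) ->
  bochner_integrable lambda I (w n.+1 p) ->
  {ae lambda, forall t, I t ->
    `|w n.+1 p t - w n p t| <= rdist (w n p t) (F t (state H (w n) p t)) +
        gamma t * (delta / 2 ^+ n) /\
    rdist (w n.+1 p t) (F t (state H (w n) p t)) <=
        gamma t * (delta / 2 ^+ n)} ->
  {ae lambda, forall t, I t ->
    `|w n.+2 p t - w n.+1 p t| <=
        rdist (w n.+1 p t) (F t (state H (w n.+1) p t)) +
        gamma t * (delta / 2 ^+ n.+1) /\
    rdist (w n.+2 p t) (F t (state H (w n.+1) p t)) <=
        gamma t * (delta / 2 ^+ n.+1)} ->
  {ae lambda, forall t, I t -> (`|w n.+2 p t - w n.+1 p t|%:E <= (gamma t)%:E *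
    (K%:E * \int[lambda]_(s in `[0%R, t]) `|w n.+1 p s - w n p s|%:E +
     (2 * (b + delta) / 2 ^+ n)%:E))%E}.
Proof.
move=> d0 b0 bw bw' wS wS'.
have Vint t : I t ->
    (`|V (L1_of T (w n.+1 p)) t - V (L1_of T (w n p)) t|%:E <=
      K%:E * \int[lambda]_(s in `[0%R, t]) `|w n.+1 p s - w n p s|%:E)%E.
  move=> It; have It' : `[0, t]%classic `<=` I.
    move: It; rewrite /= in_itv/= => /andP[_ tT] s; rewrite /= !in_itv/=.
    by move=> /andP[-> st]; exact: le_trans st tT.
  apply: le_trans (V_dist _ _ It) _; rewrite le_eqVlt; apply/orP; left.
  apply/eqP; congr (_ * _)%E.
  apply: (integral_norm_ae clambda (lebesgue_measurable_itv `[0, t])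
    (f := fun s => L1_of T (w n.+1 p) s - L1_of T (w n p) s)
    (g := fun s => w n.+1 p s - w n p s)).
  - apply: (@strongly_measurableS _ _ _ lambda I _ _ _ It').
    exact: (strongly_measurableB (L1_measurable _) (L1_measurable _)).
  - apply: (@strongly_measurableS _ _ _ lambda I _ _ _ It').
    exact: (strongly_measurableB bw'.1 bw.1).
  - apply: filterS2 (L1_ofE bw') (L1_ofE bw) => s e1 e2.
    by move=> /It' Is; rewrite e1// e2.
apply: filterS3 rdist_lip_ae wS wS' => t Ft w1 w2 It.
have [_ {}w1] := w1 It; have [{}w2 _] := w2 It; have {}Ft := Ft It.
apply: (@le_trans _ _ ((gamma t)%:E *
    (`|V (L1_of T (w n.+1 p)) t - V (L1_of T (w n p)) t|%:E +
     (2 * (b + delta) / 2 ^+ n)%:E))%E); last first.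
  by rewrite lee_wpmul2l ?lee_fin// leeD2r// Vint.
rewrite -EFinD -EFinM lee_fin.
apply: le_trans w2 _.
have h := Ft (w n.+1 p t) (state H (w n) p t) (state H (w n.+1) p t).
have hs : state H (w n) p t - state H (w n.+1) p t =
    V (L1_of T (w n p)) t - V (L1_of T (w n.+1 p)) t.
  by rewrite /state /= !fctE opprD addrACA subrr add0r.
rewrite hs distrC in h.
apply: le_trans (lerD (le_trans h (lerD w1 (lexx _))) (lexx _)) _.
rewrite -!mulrDr ler_wpM2l// addrAC addrC lerD2l.
by rewrite exprS invfM; exact: tolerance_arith.
Qed.

(** The constant is fixed before the parameter space and the family; the extension off a closed set
    relies on a bound uniform in both. *)
Lemma iterates_decay : exists2 C : R, 0 <= C &
  forall (P : pseudoMetricType R) (H : P -> cont_space T E)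
    (w : nat -> P -> R -> E) (p : P) (delta b : R), 0 <= delta -> 0 <= b ->
  (forall n, bochner_integrable lambda I (w n p)) ->
  {ae lambda, forall t, I t ->
     rdist (w 0%N p t) (F t (state H (w 0%N) p t)) <= b * gamma t} ->
  (forall n, {ae lambda, forall t, I t ->
    `|w n.+1 p t - w n p t| <= rdist (w n p t) (F t (state H (w n) p t)) +
        gamma t * (delta / 2 ^+ n) /\
    rdist (w n.+1 p t) (F t (state H (w n) p t)) <=
        gamma t * (delta / 2 ^+ n)}) ->
  forall n, (\int[lambda]_(t in I) `|w n.+1 p t - w n p t|%:E <=
    (2 * C * (b + delta) / 2 ^+ n)%:E)%E.
Proof.
have [C C0 iter] := volterra_iteration_itv gamma0 gamma_int K0.
exists C => // P H w p delta b d0 b0 bw w0B wS.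
pose e n t := `|w n.+1 p t - w n p t|.
have me n : @measurable_fun _ _ calR _ I (e n).
  exact: (measurable_dist clambda mI (bw n.+1).1 (bw n).1).
have c0 : 0 <= 2 * (b + delta) by rewrite mulr_ge0// addr_ge0.
have e00 n t : 0 <= e n t by exact: normr_ge0.
have hyp0 : {ae lambda, forall t, I t ->
    e 0%N t <= 2 * (b + delta) * gamma t}.
  apply: filterS2 w0B (wS 0%N) => t wB w1 It.
  have [{}w1 _] := w1 It; apply: le_trans w1 _.
  rewrite expr0 divr1; apply: le_trans (lerD (wB It) (lexx _)) _.
  rewrite [gamma t * _]mulrC -mulrDl ler_wpM2r// ler_peMl ?addr_ge0//.
  by rewrite ler1n.
have hypS n := iterates_increment d0 b0 (bw n) (bw n.+1) (wS n) (wS n.+1).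
by move=> n; have := iter e _ c0 me e00 hyp0 hypS n; rewrite mulrCA mulrA.
Qed.

(* Iteration of selection_step with tolerances delta / 2 ^ n. *)
Lemma exact_selection : exists2 C : R, 0 <= C &
  forall (P : pseudoMetricType R) (O : set P) (H : P -> cont_space T E)
    (delta B : P -> R) (w0 : P -> R -> E), open O ->
  (forall p, O p -> H q @[q --> p] --> H p) ->
  (forall p, O p -> 0 < delta p) ->
  (forall p, O p -> delta q @[q --> p] --> delta p) ->
  (forall p, O p -> 0 <= B p) ->
  (forall p, O p -> exists M, \forall q \near p, B q <= M) ->
  locally_constant_family O w0 ->
  (forall p, O p -> {ae lambda, forall t, I t ->
     rdist (w0 p t) (F t (state H w0 p t)) <= B p * gamma t}) ->
  exists f : P -> L1 T E, [/\
    forall p, O p -> f q @[q --> p] --> f p,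
    forall p, O p -> {ae lambda, forall t, I t ->
      F t (H p t + V (f p) t) (f p t)} &
    forall p, O p -> `|f p - L1_of T (w0 p)| <= C * (B p + delta p)].
Proof.
have [C C0 iter] := iterates_decay.
(* The 2 of [iterates_decay] times the 2 from summing the geometric tail. *)
exists (4 * C); first by rewrite mulr_ge0.
move=> P O H delta B w0 oO H_cvg delta0 delta_cvg B0 B_bnd lw0 w0B.
have stepex (x : nat * {w | locally_constant_family O w}) :
  exists w' : {w | locally_constant_family O w}, forall p, O p ->
    {ae lambda, forall t, I t ->
      `|sval w' p t - sval x.2 p t| <=
        rdist (sval x.2 p t) (F t (state H (sval x.2) p t)) +
        gamma t * (delta p / 2 ^+ x.1) /\
      rdist (sval w' p t) (F t (state H (sval x.2) p t)) <=
        gamma t * (delta p / 2 ^+ x.1)}.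
  case: x => n [w lw] /=.
  have d0 p : O p -> 0 < delta p / 2 ^+ n.
    by move=> /delta0 d0; rewrite divr_gt0// exprn_gt0.
  have d_cvg p : O p -> delta q / 2 ^+ n @[q --> p] --> delta p / 2 ^+ n.
    by move=> Op; exact: cvgM (delta_cvg p Op) (cvg_cst _).
  have [w' lw' hw'] := selection_step oO H_cvg d0 d_cvg lw.
  by exists (exist _ w' lw').
have [step hstep] := choice stepex.
pose fix W n := if n is m.+1 then step (m, W m) else exist _ w0 lw0.
pose w n := sval (W n).
have lw n : locally_constant_family O (w n) by exact: (svalP (W n)).
have w00 : w 0%N = w0 by [].
have bw n p : O p -> bochner_integrable lambda I (w n p) by move=> /(lw n)[].
have wS n p : O p -> {ae lambda, forall t, I t ->
    `|w n.+1 p t - w n p t| <= rdist (w n p t) (F t (state H (w n) p t)) +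
        gamma t * (delta p / 2 ^+ n) /\
    rdist (w n.+1 p t) (F t (state H (w n) p t)) <=
        gamma t * (delta p / 2 ^+ n)} by exact: (hstep (n, W n)).
have e_le p (Op : O p) := iter P H w p _ _ (ltW (delta0 p Op)) (B0 p Op)
  (fun n => bw n p Op) (w0B p Op) (fun n => wS n p Op).
have lim_ex p : exists l : L1 T E, O p ->
    {ae lambda, forall t, I t -> w n p t @[n --> \oo] --> l t} /\
    forall n, `|l - L1_of T (w n p)| <= 4 * C * (B p + delta p) / 2 ^+ n.
  have [Op|nOp] := pselect (O p); last by exists 0.
  have [g [bg wg dg]] := bochner_integrable_complete clambda mI sepE
    (fun n => bw n p Op) (e_le p Op).
  exists (L1_of T g) => _; split=> [|n].
    by apply: filterS2 wg (L1_ofE bg) => t wg gE It; rewrite gE//; exact: wg.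
  rewrite -lee_fin (L1_of_distE bg (bw n p Op)); apply: le_trans (dg n) _.
  by rewrite !mulrA -natrM.
have [f hf] := choice lim_ex.
have fw p n : O p ->
    `|f p - L1_of T (w n p)| <= 4 * C * (B p + delta p) / 2 ^+ n.
  by move=> /hf[].
exists f; split=> p Op; last first.
- by have := fw p 0%N Op; rewrite expr0 divr1 w00.
- exact: (solution_of_iterates (H := H) (delta0 p Op) (fun n => bw n p Op)
    (hf p Op).1 (fw p ^~ Op) (fun n => wS n p Op)).
(* [B] is only locally bounded, not continuous; this suffices for convergence uniform near [p], and
   continuity follows by splitting [eps] into thirds. *)
have [M BM] := B_bnd p Op; apply/cvgrPdist_lt => eps eps0.
pose D := 4 * C * (M + (delta p + 1)).
have near_bound : \forall q \near p, forall n,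
    `|f q - L1_of T (w n q)| <= D / 2 ^+ n.
  have nd : \forall q \near p, delta q <= delta p + 1.
    by apply: (cvgr_le _ (delta_cvg p Op)); rewrite ltrDl.
  have nO : \forall q \near p, O q by exact: open_nbhs_nbhs.
  apply: filterS3 BM nd nO => q BM nd Oq n; apply: le_trans (fw q n Oq) _.
  rewrite ler_wpM2r ?invr_ge0 ?exprn_ge0//.
  by rewrite ler_wpM2l ?mulr_ge0// lerD.
have e3 : 0 < eps / 3 by rewrite divr_gt0.
have [n Dn] := geometric_small D e3.
have /cvgrPdist_lt wn := locally_constant_cvg oO (lw n) Op.
have pb := nbhs_singleton near_bound n.
apply: filterS2 near_bound (wn _ e3) => q qb wq.
exact: dist_lt3 (le_lt_trans pb Dn) wq (le_lt_trans (qb n) Dn).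
Qed.

End selection_scheme.

(** * Integrals over pieces *)

Lemma integrable_const d (T : measurableType d) (R : realType)
    (mu : {measure set T -> \bar R}) (D : set T) (c : R) :
  measurable D -> (mu D < +oo)%E -> mu.-integrable D (EFin \o cst c).
Proof.
move=> mD Doo; apply/integrableP; split; first exact/measurable_EFinP/measurable_cst.
rewrite (_ : (fun x => _) = cst `|c|%:E)//.
by rewrite integral_cst//= lte_mul_pinfty.
Qed.

Lemma integral_dist_le_const d (T : measurableType d) (R : realType)
    (mu : {measure set T -> \bar R}) (E : completeNormedModType R) (D : set T)
    (f g : T -> E) (c : R) : measure_is_complete mu -> measurable D ->
  strongly_measurable mu D f -> strongly_measurable mu D g -> 0 <= c ->
  (forall t, D t -> `|f t - g t| <= c) ->
  (\int[mu]_(t in D) `|f t - g t|%:E <= c%:E * mu D)%E.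
Proof.
move=> cmu mD mf mg c0 fgc; rewrite -integral_cst//.
apply: ge0_le_integral => //.
exact/measurable_EFinP/(measurable_dist cmu mD mf mg).
Qed.

Lemma ge0_integral_pieces d (T : measurableType d) (R : realType)
    (mu : {measure set T -> \bar R}) (D : set T) (c : T -> nat)
    (f : T -> \bar R) (N : nat) :
  (forall m, measurable (D `&` c @^-1` [set m])) ->
  measurable_fun D f -> (forall t, D t -> 0 <= f t)%E ->
  (forall t, D t -> (c t < N)%N) ->
  (\int[mu]_(t in D) f t =
   \sum_(m < N) \int[mu]_(t in D `&` c @^-1` [set (m : nat)]) f t)%E.
Proof.
move=> mc mf f0 cN; pose F m := D `&` c @^-1` [set m].
have DE : D = \big[setU/set0]_(m <- index_iota 0 N) F m.
  rewrite big_mkord -bigcup_mkord; apply/seteqP; split=> [t Dt|t [m _ []]//].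
  by exists (c t) => //=; exact: cN.
rewrite -(big_mkord xpredT (fun m => \int[mu]_(t in F m) f t)%E) [in LHS]DE.
apply: ge0_integral_bigsetU => //; rewrite -?DE//.
- exact: iota_uniq.
- by move=> m n _ _ [t [[_ /= <-] [_ /= <-]]].
Qed.

Lemma integral_dist_in d (T : measurableType d) (R : realType)
    (mu : {measure set T -> \bar R}) (E : normedModType R) (D A B : set T) (y : E) :
  measurable D -> measurable A -> measurable B -> B `<=` A ->
  (\int[mu]_(t in D) `|(if t \in A then y else 0) - (if t \in B then y else 0)|%:E
   = `|y|%:E * mu (D `&` (A `\` B)))%E.
Proof.
move=> mD mA mB BA; have mAB := measurableD mA mB.
rewrite -integral_cst; last exact: measurableI.
rewrite integral_mkcondr; apply: eq_integral => t _; rewrite patchE in_setD.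
have [tB|tB] := boolP (t \in B); last first.
  by rewrite subr0; case: ifP => //=; rewrite normr0.
by rewrite mem_set ?subrr ?normr0//; apply: BA; exact: set_mem.
Qed.

(** * Step functions and equidistribution *)

Section step_functions.
Context {R : realType} (T : R) {E : completeNormedModType R}.
Hypothesis sepE : separable E.
Local Notation I := `[0, T]%classic.
Local Notation lambda := (@completed_lebesgue_measure R).
Local Notation calR := (caratheodory_type (@wlength R idfun)^*%mu).

Let clambda := @completed_lebesgue_measure_is_complete R.

Let mI := lebesgue_measurable_itv `[0, T].

(** A measurable set is a Borel set [B] joined with a subset of a Borel null set [M]. Regularity is
    applied to [B], and [M] adds no measure. *)
Lemma lebesgue_inner_closed (A : set R) (eps : R) : @measurable _ calR A ->
  (lambda A < +oo)%E -> 0 < eps ->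
  exists K : set R, [/\ closed K, K `<=` A & (lambda (A `\` K) < eps%:E)%E].
Proof.
rewrite -completed_caratheodory_measurable g_sigma_completed_algebra_genE.
move=> -[B mB [N [M [mM M0 NM]] <-]] BNoo eps0.
have mB' := borel_lebesgue_measurable mB.
have mM' := borel_lebesgue_measurable mM.
have mN : @measurable _ calR N by apply: clambda; exists M; split.
have Boo : (@lebesgue_measure R B < +oo)%E.
  apply: le_lt_trans BNoo; apply: (le_measure lambda); rewrite ?inE//.
  exact: (measurableU _ _ mB' mN).
have [K [cK KB BK]] := lebesgue_regularity_inner mB Boo eps0.
have clK := compact_closed (@Rhausdorff R) cK.
have mK : @measurable _ (measurableTypeR R) K by exact: closed_measurable.
have mBK := borel_lebesgue_measurable (measurableD mB mK).
exists K; split => //; first by move=> t /KB; left.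
apply: le_lt_trans BK.
apply: (@le_trans _ _ (lambda ((B `\` K) `|` M))).
  apply: (le_measure lambda); rewrite ?inE.
  - apply: measurableD; first exact: measurableU.
    exact: borel_lebesgue_measurable.
  - exact: measurableU.
  - by move=> t [[Bt|/NM Mt] Kt]; [left|right].
apply: le_trans (measureU2 _ mBK mM') _.
by rewrite [X in (_ + X)%E]M0 adde0.
Qed.

Definition step (l : nat) (v : nat -> E) (t : R) : E :=
  v (Num.truncn (l.+1%:R * t)).

Lemma truncn_itvP l m (t : R) : 0 <= t ->
  Num.truncn (l.+1%:R * t) = m <->
  t \in `[m%:R / l.+1%:R, m.+1%:R / l.+1%:R[.
Proof.
move=> t0; rewrite in_itv/= ler_pdivrMr// ltr_pdivlMr// [t * _]mulrC.
have lt0 : 0 <= l.+1%:R * t by rewrite mulr_ge0.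
split=> [<-|]; first exact: truncn_itv.
exact: truncn_def.
Qed.

Lemma measurable_cell l m :
  @measurable _ calR (I `&` (fun t => Num.truncn (l.+1%:R * t)) @^-1` [set m]).
Proof.
rewrite (_ : _ `&` _ = I `&` `[m%:R / l.+1%:R, m.+1%:R / l.+1%:R[%classic).
  by apply: measurableI => //; exact: lebesgue_measurable_itv.
apply/seteqP; split=> t [It] tm; split=> //.
  by apply/truncn_itvP => //; move: It; rewrite /= in_itv/= => /andP[].
by apply/truncn_itvP => //; move: It; rewrite /= in_itv/= => /andP[].
Qed.

Lemma step_measurable l v : strongly_measurable lambda I (step l v).
Proof.
apply: (strongly_measurable_glue clambda mI sepE (f := fun m t => v m)).
  exact: measurable_cell.
by move=> m; exact/simple_strongly_measurable/simple_fun_cst.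
Qed.

(** Approximation is required at all sufficiently fine meshes, not at one, so that approximations of
    two functions can be added on the same mesh. *)
Definition step_approximable (w : R -> E) := forall eps, 0 < eps ->
  \forall l \near \oo, exists v,
    (\int[lambda]_(t in I) `|w t - step l v t|%:E < eps%:E)%E.

Lemma step_approximable_near w :
  strongly_measurable lambda I w ->
  (forall eps, 0 < eps -> exists2 w', step_approximable w' &
     strongly_measurable lambda I w' /\
     (\int[lambda]_(t in I) `|w t - w' t|%:E < eps%:E)%E) ->
  step_approximable w.
Proof.
move=> mw aw eps eps0; have e2 : 0 < eps / 2 by rewrite divr_gt0.
have [w' aw' [mw' ww']] := aw _ e2; apply: filterS (aw' _ e2) => l [v wv].
exists v; apply: le_lt_trans (integral_dist_triangle clambda mI mw mw'
  (step_measurable l v)) _.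
by rewrite [eps]splitr EFinD lteD.
Qed.

Lemma step_approximableD w1 w2 : strongly_measurable lambda I w1 ->
  strongly_measurable lambda I w2 ->
  step_approximable w1 -> step_approximable w2 ->
  step_approximable (fun t => w1 t + w2 t).
Proof.
move=> m1 m2 a1 a2 eps eps0; have e2 : 0 < eps / 2 by rewrite divr_gt0.
apply: filterS2 (a1 _ e2) (a2 _ e2) => l [v1 wv1] [v2 wv2].
exists (fun m => v1 m + v2 m).
have := integral_norm_comb clambda mI 1
  (strongly_measurableB m1 (step_measurable l v1))
  (strongly_measurableB m2 (step_measurable l v2)).
rewrite normr1 mul1e => h; apply: (le_lt_trans _ (le_lt_trans h _)); last first.
  by rewrite [eps]splitr EFinD lteD.
rewrite le_eqVlt; apply/orP; left; apply/eqP; apply: eq_integral => t _.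
by rewrite !fctE scale1r /step opprD addrACA.
Qed.

Lemma truncn_eq_dist l (s t : R) : 0 <= s -> 0 <= t ->
  Num.truncn (l.+1%:R * s) = Num.truncn (l.+1%:R * t) ->
  `|s - t| < l.+1%:R^-1.
Proof.
move=> s0 t0 /(truncn_itvP l _ s0).
have /(truncn_itvP l _ t0) := erefl (Num.truncn (l.+1%:R * t)).
rewrite !in_itv/= -[(Num.truncn _).+1]addn1 natrD mulrDl mul1r.
suff /[apply] : forall a b : R,
  a <= t < a + b -> a <= s < a + b -> `|s - t| < b by [].
by move=> a b /andP[? ?] /andP[? ?]; rewrite ltr_distlC; apply/andP; split; lra.
Qed.

(** Mark the cells that meet [K]. A point of [K] is always in a marked cell; a point off the closed
    set [K] is eventually in an unmarked one, as the cells shrink. The steps are thus eventually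
    exact at each [t], and dominated by [|y|]. *)
Lemma step_approximable_closed (K : set R) (y : E) : closed K ->
  step_approximable (fun t => if t \in K then y else 0).
Proof.
move=> cK; pose hit l m := exists2 s, K s /\ 0 <= s &
  Num.truncn (l.+1%:R * s) = m.
pose v l m := if `[< hit l m >] then y else 0.
have mK : @measurable _ calR K.
  exact: (borel_lebesgue_measurable (closed_measurable cK)).
have mw : strongly_measurable lambda I (fun t => if t \in K then y else 0).
  apply: simple_strongly_measurable.
  by apply: (simple_fun_if mK); exact: simple_fun_cst.
have ew : {ae lambda, forall t, I t -> \forall n \near \oo,
    step n (v n) t = if t \in K then y else 0}.
  apply: aeW => t; rewrite /= in_itv/= => /andP[t0 _].
  have [Kt|Kt] := pselect (K t).
    apply: nearW => n; rewrite mem_set// /step /v; case: asboolP => // -[].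
    by exists t.
  have : nbhs t (~` K) by apply: open_nbhs_nbhs; split => //; exact: closed_openC.
  move=> /nbhs_ballP[d /= d0 dK].
  apply: filterS (near_infty_natSinv_lt (PosNum d0)) => n nd.
  rewrite memNset// /step /v; case: asboolP => // -[s [Ks s0] st].
  case: (dK s _ Ks); rewrite -ball_normE /= distrC.
  exact: lt_trans (truncn_eq_dist s0 t0 st) nd.
have vy n : {ae lambda, forall t, I t -> `|step n (v n) t| <= cst `|y| t}.
  by apply: aeW => t _; rewrite /step /v; case: ifP => // _; rewrite normr0.
have wy : {ae lambda, forall t, I t ->
    `|if t \in K then y else 0| <= cst `|y| t}.
  by apply: aeW => t _; case: ifP => // _; rewrite normr0.
have H := eventually_eq_cvg_L1 clambda mI
  (fun n => step_measurable n (v n)) mw ew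
  (integrable_const `|y| mI (lambda_fin T)) vy wy.
move=> eps eps0; have eps0E : (0 < eps%:E)%E by rewrite lte_fin.
by apply: filterS (cvge_lt_near H eps0E) => n; rewrite integral_distC; exists (v n).
Qed.

Lemma step_approximable_in (A : set R) (y : E) : @measurable _ calR A ->
  step_approximable (fun t => if t \in A then y else 0).
Proof.
move=> mA; have sm B : @measurable _ calR B ->
    strongly_measurable lambda I (fun t => if t \in B then y else 0).
  move=> mB; apply: simple_strongly_measurable.
  by apply: (simple_fun_if mB); exact: simple_fun_cst.
apply: step_approximable_near; first exact: sm.
move=> eps eps0; have mAI : @measurable _ calR (A `&` I) by exact: measurableI.
have AIoo : (lambda (A `&` I) < +oo)%E.
  by apply: le_lt_trans (lambda_fin T); apply: (le_measure lambda); rewrite ?inE.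
have e1 : 0 < eps / (`|y| + 1) by rewrite divr_gt0// ltr_wpDl.
have [K [cK KA AK]] := lebesgue_inner_closed mAI AIoo e1.
have mK : @measurable _ calR K.
  exact: (borel_lebesgue_measurable (closed_measurable cK)).
exists (fun t => if t \in K then y else 0); first exact: step_approximable_closed.
split; first exact: sm.
have KA' : K `<=` A by move=> t /KA[].
apply: (@le_lt_trans _ _ (`|y|%:E * lambda (I `&` (A `\` K)))%E).
  by rewrite -(integral_dist_in lambda y mI mA mK KA').
rewrite setIDA [I `&` A]setIC.
apply: (@le_lt_trans _ _ (`|y|%:E * (eps / (`|y| + 1))%:E)%E).
  by rewrite lee_wpmul2l// ltW.
rewrite -EFinM lte_fin mulrA ltr_pdivrMr ?ltr_wpDl// mulrC.
by rewrite ltr_pM2l// ltrDl.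
Qed.

Lemma simple_step_approximable (s : R -> E) :
  @simple_fun _ calR E s -> step_approximable s.
Proof.
move=> ss; have [/finite_seqP[r sr] _] := ss.
(* Listing only the nonzero values lets the induction remove a value by resetting it to 0. *)
have {sr} : forall t, s t != 0 -> s t \in r.
  by move=> t _; have : range s (s t); [exists t|rewrite sr].
elim: r s ss => [|y r IH] s ss sr.
  have -> : s = fun t => if t \in set0 then 0 else 0.
    apply/funext => t; rewrite if_same; apply/eqP/negPn/negP => /sr.
    by rewrite in_nil.
  by apply: step_approximable_in; exact: measurable0.
pose A := s @^-1` [set y].
have mA : @measurable _ calR A by have [_] := ss; apply.
pose s' t := if t \in A then 0 else s t.
have ss' : @simple_fun _ calR E s'.
  by apply: simple_fun_if => //; exact: simple_fun_cst.
have -> : s = fun t => s' t + (if t \in A then y else 0).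
  apply/funext => t; rewrite /s'; case: ifPn => tA; last by rewrite addr0.
  by rewrite add0r; exact: set_mem tA.
apply: step_approximableD.
- exact: simple_strongly_measurable.
- by apply: simple_strongly_measurable; apply: simple_fun_if => //;
    exact: simple_fun_cst.
- apply: IH => // t; rewrite /s'; case: ifPn => [|tA /sr]; first by rewrite eqxx.
  rewrite inE => /orP[/eqP sty|//].
  by move: tA; rewrite mem_set.
- exact: step_approximable_in.
Qed.

Lemma L1_step_approximable (w : R -> E) :
  bochner_integrable lambda I w -> step_approximable w.
Proof.
move=> [mw [s [ss _ sw]]]; apply: step_approximable_near => // eps eps0.
have eps0E : (0 < eps%:E)%E by rewrite lte_fin.
have [N _ /(_ N (leqnn N)) wN] := cvge_lt_near sw eps0E.
exists (s N); first exact: simple_step_approximable.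
by split => //; exact: simple_strongly_measurable.
Qed.

(* As for cont_space_dense, indices encode a precision, a mesh, and indices of
   values in the dense sequence of E. *)
Lemma L1_dense : exists c : nat -> L1 T E,
  forall w eps, 0 < eps -> exists n, `|w - c n| < eps.
Proof.
have [e de] := separable_enum (0 : E) sepE.
pose close (i : nat * nat * seq nat) (w : L1 T E) :=
  (\int[lambda]_(t in I) `|w t - step i.1.2 (fun m => e (nth 0%N i.2 m)) t|%:E
   < (i.1.1.+1%:R^-1)%:E)%E.
pose c n : L1 T E := if unpickle n is Some i then xget 0 (close i) else 0.
exists c => w eps eps0; have e2 : 0 < eps / 2 by rewrite divr_gt0.
have [m _ /(_ m (leqnn m)) /= mlt] := near_infty_natSinv_lt (PosNum e2).
have m2 : 0 < m.+1%:R^-1 / 2 :> R by rewrite divr_gt0// invr_gt0.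
have [l _ /(_ l (leqnn l)) [v wv]] :=
  L1_step_approximable (L1_integrable w) m2.
have T1 : 0 < fine (lambda I) + 1 by rewrite ltr_wpDl// fine_ge0.
pose r := m.+1%:R^-1 / 2 / (fine (lambda I) + 1).
have r0 : 0 < r by rewrite divr_gt0.
have ex k : exists j, `|v k - e j| < r.
  have oB : open (ball (v k) r) by exact: ball_open.
  have [|j] := de _ oB; first by exists (v k); exact: ballxx.
  by rewrite -ball_normE => vj; exists j.
have [g hg] := choice ex.
pose i := (m, l, mkseq g (Num.truncn (l.+1%:R * T)).+1).
have wi : close i w.
  rewrite /close /=; apply: le_lt_trans (integral_dist_triangle clambda mI
    (L1_measurable w) (step_measurable l v) (step_measurable l _)) _.
  rewrite [m.+1%:R^-1]splitr EFinD.
  apply: (@lt_le_trans _ _ ((m.+1%:R^-1 / 2)%:E + r%:E * lambda I)%E).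
    have lI : lambda I \is a fin_num by rewrite ge0_fin_numE// lambda_fin.
    have fin : (r%:E * lambda I)%E \is a fin_num by rewrite fin_numM.
    rewrite -(lteD2rE _ _ fin) in wv; apply: le_lt_trans wv; apply: leeD2l.
    apply: integral_dist_le_const (step_measurable l v)
      (step_measurable l _) (ltW r0) _ => //.
    move=> t; rewrite /= in_itv/= => /andP[t0 tT]; rewrite /step nth_mkseq.
      exact/ltW/hg.
    by rewrite ltnS; apply: le_truncn; rewrite ler_pM2l.
  have lI : lambda I \is a fin_num by rewrite ge0_fin_numE// lambda_fin.
  apply: leeD2l; rewrite -(fineK lI) -EFinM lee_fin /r mulrAC.
  by rewrite ler_pdivrMr// ler_pM2l// lerDl.
exists (pickle i); rewrite /c pickleK.
case: xgetP => [u _ ui|/(_ w)//].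
have : (`|w - u|%:E < (m.+1%:R^-1 + m.+1%:R^-1)%:E)%E.
  rewrite L1_distE; apply: le_lt_trans (integral_dist_triangle clambda mI
    (L1_measurable w) (step_measurable i.1.2 _) (L1_measurable u)) _.
  by rewrite EFinD lteD//; [exact: wi|rewrite integral_distC; exact: ui].
by rewrite lte_fin => /lt_trans; apply; rewrite [eps]splitr ltrD.
Qed.

Definition oscillation (nu a b : R) : set R :=
  [set t | 0 <= t /\ a <= frac (nu * t) < b].

Lemma oscillation_arith {K : realFieldType} (a b u n v : K) : 0 <= a ->
  a <= b -> b <= 1 -> n <= v * u + 2 -> (b - a) * n <= (b - a) * u * v + 2.
Proof. by move=> a0 ab b1 nvu; nra. Qed.

Lemma oscillation_final_arith {K : realFieldType} (a b e M eta : K) :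
  0 <= a -> a <= b -> b <= 1 -> 0 < e -> eta * M = 3 * e ->
  e + ((b - a) * (e + M) + e) <= (b - a + eta) * M.
Proof. by move=> a0 ab b1 e0 etaM; rewrite [leRHS]mulrDl etaM; nra. Qed.

(** At most [nu * (d - c) + 2] periods meet [[c, d]], and each contributes measure
    [(b - a) / nu]. *)
Lemma itv_oscillation_le (nu a b c d : R) : 0 < nu -> 0 <= a -> a <= b ->
  b <= 1 -> 0 <= c -> c <= d ->
  (lambda (`[c, d] `&` oscillation nu a b) <=
   ((b - a) * (d - c) + 2 / nu)%:E)%E.
Proof.
move=> nu0 a0 ab b1 c0 cd; set z0 := Num.truncn (nu * c).
set n := (Num.truncn (nu * d) - z0).+1.
pose A i : set R := `[((z0 + i)%:R + a) / nu, ((z0 + i)%:R + b) / nu]%classic.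
have mA i : @measurable _ calR (A i) by exact: lebesgue_measurable_itv.
have z01 : (z0 <= Num.truncn (nu * d))%N.
  by apply: le_truncn; rewrite ler_pM2l.
have lA i : lambda (A i) = ((b - a) / nu)%:E.
  rewrite completed_lebesgue_measure_itv/= lte_fin ltr_pM2r ?invr_gt0// ltrD2l.
  case: ltgtP ab => // [ab _|<- _]; last by rewrite subrr mul0r.
  by rewrite -EFinB -mulrBl opprD addrACA subrr add0r.
have sub : `[c, d]%classic `&` oscillation nu a b `<=`
    \big[setU/set0]_(i < n) A i.
  rewrite -bigcup_mkord => t [] /=; rewrite in_itv/= => /andP[ct td] [t0 ft].
  exists (Num.truncn (nu * t) - z0)%N.
    rewrite /= ltnS leq_sub2r//; apply: le_truncn; by rewrite ler_pM2l.
  rewrite /A subnKC; last by apply: le_truncn; rewrite ler_pM2l.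
  move: ft; rewrite /frac /= in_itv/= ler_pdivrMr// ler_pdivlMr// [t * _]mulrC.
  by move=> /andP[? ?]; apply/andP; split; lra.
apply: (@le_trans _ _ (\sum_(i < n) lambda (A i))%E).
  apply: (le_trans _ (@Boole_inequality _ _ calR lambda A n (fun i _ => mA i))).
  apply: (le_measure lambda); rewrite ?inE//.
  - apply: measurableI; first exact: lebesgue_measurable_itv.
    exact: measurable_frac.
  - by apply: bigsetU_measurable => i _; exact: mA.
rewrite (eq_bigr (fun=> ((b - a) / nu)%:E)) => [|i _]; last exact: lA.
rewrite sumEFin lee_fin sumr_const card_ord.
have d0 : 0 <= nu * d := mulr_ge0 (ltW nu0) (le_trans c0 cd).
have c0' : 0 <= nu * c := mulr_ge0 (ltW nu0) c0.
have nE : n%:R <= nu * (d - c) + 2 :> R.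
  have := truncn_itv d0; have := truncn_itv c0'; rewrite -/z0 => /andP[_].
  rewrite -addn1 natrD => h1 /andP[h2 _].
  by rewrite /n -addn1 natrD natrB//; lra.
have -> : (b - a) / nu *+ n = (b - a) * n%:R / nu by rewrite -mulr_natr mulrAC.
rewrite ler_pdivrMr// [leRHS]mulrDl divfK ?gt_eqF//.
exact: oscillation_arith.
Qed.

Lemma cell_oscillation_le (nu a b : R) l m : 0 < nu -> 0 <= a -> a <= b ->
  b <= 1 ->
  (lambda ((I `&` oscillation nu a b) `&`
     (fun t => Num.truncn (l.+1%:R * t)) @^-1` [set m]) <=
   (b - a)%:E *
     lambda (I `&` (fun t => Num.truncn (l.+1%:R * t)) @^-1` [set m]) +
   (2 / nu)%:E)%E.
Proof.
move=> nu0 a0 ab b1; set cell := _ @^-1` _.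
have mIc : @measurable _ calR (I `&` cell) by exact: measurable_cell.
have mosc := measurable_frac nu0 a0 b1.
pose c := m%:R / l.+1%:R : R; pose d := Num.min T (m.+1%:R / l.+1%:R).
have c0 : 0 <= c by rewrite divr_ge0.
have icd : I `&` cell `<=` `[c, d].
  move=> t [It] ct; have := It; rewrite /= !in_itv/= => /andP[t0 tT].
  have /(truncn_itvP l m t0) := ct; rewrite in_itv/= => /andP[-> tm] /=.
  by rewrite /d le_min tT ltW.
have dci : `[c, d[%classic `<=` I `&` cell.
  move=> t; rewrite /= in_itv/= /d lt_min => /andP[ct /andP[tT tm]].
  have t0 := le_trans c0 ct; split; first by rewrite /= in_itv/= t0 ltW.
  by apply/(truncn_itvP l m t0); rewrite in_itv/= ct.
rewrite setIAC.
have [cd|dc] := leP c d; last first.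
  have -> : I `&` cell = set0.
    apply/seteqP; split=> // t /icd; rewrite /= in_itv/= => /andP[ct td].
    by have := le_lt_trans (le_trans ct td) dc; rewrite ltxx.
  by rewrite set0I measure0 mule0 add0e lee_fin divr_ge0// ltW.
apply: (@le_trans _ _ (lambda (`[c, d] `&` oscillation nu a b))).
  apply: (le_measure lambda); rewrite ?inE.
  - exact: measurableI.
  - by apply: measurableI => //; exact: lebesgue_measurable_itv.
  - exact: setSI.
apply: le_trans (itv_oscillation_le nu0 a0 ab b1 c0 cd) _.
rewrite EFinD leeD2r// EFinM lee_wpmul2l// ?lee_fin ?subr_ge0//.
apply: (@le_trans _ _ (lambda `[c, d[)); last first.
  apply: (le_measure lambda); rewrite ?inE//.
  exact: lebesgue_measurable_itv.
rewrite completed_lebesgue_measure_itv/= lte_fin.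
have [->|cd'] := eqVneq c d; first by rewrite ltxx subrr.
by rewrite lt_neqAle cd' cd /= EFinB.
Qed.

(** On each of the finitely many cells that meet [I] the function is constant and the counting error
    is at most [2 / nu]. *)
Lemma step_oscillation l v : exists2 S : R, 0 <= S &
  forall nu a b : R, 0 < nu -> 0 <= a -> a <= b -> b <= 1 ->
  (\int[lambda]_(t in I `&` oscillation nu a b) `|step l v t|%:E <=
   (b - a)%:E * \int[lambda]_(t in I) `|step l v t|%:E + (S / nu)%:E)%E.
Proof.
pose N := (Num.truncn (l.+1%:R * T)).+1.
pose c (t : R) := Num.truncn (l.+1%:R * t).
exists (2 * \sum_(m < N) `|v m|); first by rewrite mulr_ge0// sumr_ge0.
move=> nu a b nu0 a0 ab b1.
have cN t : I t -> (c t < N)%N.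
  rewrite /= in_itv/= => /andP[t0 tT]; rewrite ltnS; apply: le_truncn.
  by rewrite ler_pM2l.
have mosc := measurable_frac nu0 a0 b1.
have mn := measurable_normE clambda mI (step_measurable l v).
have piece D : @measurable _ calR D -> D `<=` I ->
    (\int[lambda]_(t in D) `|step l v t|%:E =
     \sum_(m < N) `|v m|%:E * lambda (D `&` c @^-1` [set (m : nat)]))%E.
  move=> mD DI.
  have mc m : @measurable _ calR (D `&` c @^-1` [set m]).
    rewrite -(setIidl DI) -setIA; apply: measurableI => //.
    exact: measurable_cell.
  rewrite (ge0_integral_pieces lambda mc (measurable_funS mI DI mn) _
    (fun t Dt => cN t (DI t Dt)))//.
  apply: eq_bigr => m _; rewrite -(integral_cst _ (mc m)).
  by apply: eq_integral => t /set_mem[_ /= <-].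
rewrite piece; [|exact: measurableI|exact: subIsetl].
rewrite (piece I)// ge0_sume_distrr; last first.
  by move=> m _; rewrite mule_ge0.
have -> : (2 * (\sum_(m < N) `|v m|) / nu)%:E =
    (\sum_(m < N) `|v m|%:E * (2 / nu)%:E)%E.
  rewrite (eq_bigr (fun m : 'I_N => (`|v m| * (2 / nu))%:E)) => [|m _]; last by [].
  by rewrite sumEFin -mulr_suml mulrA [2 * _]mulrC.
rewrite -big_split/=; apply: lee_sum => m _.
rewrite muleCA -muleDr//; last first.
  apply: ge0_adde_def; rewrite inE; last by rewrite lee_fin divr_ge0// ltW.
  by rewrite mule_ge0// lee_fin subr_ge0.
apply: lee_wpmul2l; first by rewrite lee_fin.
exact: cell_oscillation_le.
Qed.

(** Equidistribution in the spirit of the Riemann-Lebesgue lemma. The threshold [N] does not depend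
    on [a] and [b], since the intervals will vary with the parameter. *)
Lemma oscillation_le (w : R -> E) eta : bochner_integrable lambda I w ->
  0 < eta -> exists2 N : R, 0 < N &
  forall nu a b : R, N <= nu -> 0 <= a -> a <= b -> b <= 1 ->
  (\int[lambda]_(t in I `&` oscillation nu a b) `|w t|%:E <=
   (b - a + eta)%:E * \int[lambda]_(t in I) `|w t|%:E)%E.
Proof.
move=> bw eta0; have fw := bochner_integrable_fin clambda mI bw.
have mw := bw.1; have mnw := measurable_normE clambda mI mw.
have sub nu a b : 0 < nu -> 0 <= a -> b <= 1 ->
    (\int[lambda]_(t in I `&` oscillation nu a b) `|w t|%:E <=
     \int[lambda]_(t in I) `|w t|%:E)%E.
  move=> nu0 a0 b1; apply: ge0_subset_integral => //.
  by apply: measurableI => //; exact: measurable_frac.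
(* The error is relative to the norm of [w], so the precision [eps] below would vanish in this
   case. *)
have [M0|M0] := eqVneq (\int[lambda]_(t in I) `|w t|%:E)%E 0%E.
  exists 1 => // nu a b nu1 a0 _ b1; rewrite M0 mule0 -M0; apply: sub => //.
  exact: lt_le_trans nu1.
pose M := fine (\int[lambda]_(t in I) `|w t|%:E)%E.
have ME : (\int[lambda]_(t in I) `|w t|%:E = M%:E)%E by rewrite fineK.
have Mgt0 : 0 < M.
  rewrite -lte_fin -ME lt_neqAle eq_sym M0 /=; exact: integral_ge0.
(* Three errors of size [eps]: the approximation on the oscillating set, the approximation on [I]
   scaled by [b - a <= 1], and [S / nu]. *)
pose eps := eta * M / 3; have eps0 : 0 < eps by rewrite divr_gt0// mulr_gt0.
have [l _ /(_ l (leqnn l))[v wv]] := L1_step_approximable bw eps0.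
have [S S0 osc] := step_oscillation l v.
exists (S / eps + 1) => [|nu a b nuS a0 ab b1].
  by rewrite ltr_wpDl// divr_ge0// ltW.
have nu0 : 0 < nu by apply: lt_le_trans nuS; rewrite ltr_wpDl// divr_ge0// ltW.
have Snu : S / nu <= eps.
  rewrite ler_pdivrMr// mulrC -ler_pdivrMr//.
  by apply: le_trans nuS; rewrite lerDl.
have ms := step_measurable l v.
have mO : @measurable _ calR (I `&` oscillation nu a b).
  by apply: measurableI => //; exact: measurable_frac.
have OI : I `&` oscillation nu a b `<=` I by exact: subIsetl.
have tri D (u1 u2 : R -> E) : @measurable _ calR D -> D `<=` I ->
    strongly_measurable lambda I u1 -> strongly_measurable lambda I u2 ->
    (\int[lambda]_(t in D) `|u1 t|%:E <= \int[lambda]_(t in I) `|u1 t - u2 t|%:E +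
      \int[lambda]_(t in D) `|u2 t|%:E)%E.
  move=> mD DI m1 m2; have m1D := strongly_measurableS DI m1.
  have m2D := strongly_measurableS DI m2.
  have := integral_norm_comb clambda mD 1 (strongly_measurableB m1D m2D) m2D.
  rewrite normr1 mul1e => h.
  apply: le_trans (le_trans _ h) _.
    rewrite le_eqVlt; apply/orP; left; apply/eqP; apply: eq_integral => t _.
    by rewrite !fctE scale1r subrK.
  by apply: leeD2r; exact: (integral_distS clambda mD mI DI m1 m2).
have sM : (\int[lambda]_(t in I) `|step l v t|%:E <= (eps + M)%:E)%E.
  apply: le_trans (tri I _ _ mI (@subset_refl _ I) ms mw) _.
  by rewrite ME EFinD leeD2r// integral_distC ltW.
apply: le_trans (tri _ _ _ mO OI mw ms) _.
apply: (@le_trans _ _ (eps%:E + ((b - a)%:E * (eps + M)%:E + eps%:E))%E).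
  apply: leeD; first exact: ltW.
  apply: le_trans (osc nu a b nu0 a0 ab b1) _.
  by apply: leeD; rewrite ?lee_fin// lee_wpmul2l// lee_fin subr_ge0.
rewrite ME -EFinM -!EFinD -EFinM lee_fin.
have etaM : eta * M = 3 * eps by rewrite /eps [3 * _]mulrC divfK.
exact: oscillation_final_arith.
Qed.

End step_functions.

(** * Gluing off a closed subset *)

Section bounded_suprema.
Context {R : realType}.
Implicit Types u v : nat -> R.

Definition supn u : R := sup (range u).

Lemma supn_ge u M m : (forall m, u m <= M) -> u m <= supn u.
Proof.
by move=> uM; apply: ub_le_sup; [exists M => _ [n _ <-]|exists m].
Qed.

Lemma supn_le u M : (forall m, u m <= M) -> supn u <= M.
Proof.
by move=> uM; apply: ge_sup; [exists (u 0%N); exists 0%N|move=> _ [m _ <-]].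
Qed.

Lemma supn_gt u x : x < supn u -> exists m, x < u m.
Proof.
move=> xu; apply: contrapT => h; move: xu; rewrite ltNge => /negP; apply.
by apply: supn_le => m; rewrite leNgt; apply/negP => xm; apply: h; exists m.
Qed.

Lemma supn_dist u v M c : (forall m, u m <= M) -> (forall m, v m <= M) ->
  (forall m, `|u m - v m| <= c) -> `|supn u - supn v| <= c.
Proof.
move=> uM vM uvc; rewrite ler_norml; apply/andP; split.
  rewrite lerNl opprB lerBlDr; apply: supn_le => m.
  have := supn_ge m uM; have := uvc m; rewrite ler_norml => /andP[h _]; lra.
rewrite lerBlDr; apply: supn_le => m.
have := supn_ge m vM; have := uvc m; rewrite ler_norml => /andP[_ h]; lra.
Qed.

Lemma clamp_dist (x y : R) :
  `|Num.min 1 (Num.max 0 x) - Num.min 1 (Num.max 0 y)| <= `|x - y|.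
Proof.
wlog xy : x y / x <= y.
  by move=> H; have [/H//|/ltW/H] := leP x y; rewrite distrC [leRHS]distrC.
rewrite [leRHS]distrC [leRHS]ger0_norm ?subr_ge0// distrC.
rewrite !minEle !maxEle; case: (leP 0 x) => ?; case: (leP 0 y) => ?;
  case: (leP 1 x) => ?; case: (leP 1 y) => ?;
  by rewrite ?ler10 ler_norml; apply/andP; split; lra.
Qed.

End bounded_suprema.

Section spreading.
Context {R : realType} {Y : metricType R}.
Variables (a : nat -> Y) (K : nat -> R).
Hypothesis K_ge1 : forall m, 1 <= K m.

Lemma mdist_dist (x y z : Y) : `|mdist x z - mdist y z| <= mdist x y.
Proof.
rewrite ler_norml; apply/andP; split.
  by rewrite lerNl opprB lerBlDr [mdist x y]metric_sym; exact: metric_triangle.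
by rewrite lerBlDr; exact: metric_triangle.
Qed.

Lemma lipschitz_cvg (u : Y -> R) (c : R) p :
  (forall x y, `|u x - u y| <= c * mdist x y) -> u q @[q --> p] --> u p.
Proof.
move=> uc; apply/cvgrPdist_lt => eps eps0.
have c1 : 0 < `|c| + 1 by rewrite ltr_wpDl.
apply/nbhs_ballP; exists (eps / (`|c| + 1)); first by rewrite /= divr_gt0.
move=> q; rewrite ballEmdist /= ltr_pdivlMr// mulrC => pq.
apply: le_lt_trans (uc p q) _; apply: le_lt_trans pq.
by rewrite ler_wpM2r ?mdist_ge0// (le_trans (ler_norm c))// lerDl.
Qed.

(** Distance to the range of [a]; the infimum is a negated supremum so that the estimates for [supn]
    apply. *)
Definition adist (y : Y) : R := - supn (fun m => - mdist y (a m)).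

Let mdistN y m : - mdist y (a m) <= 0.
Proof. by rewrite oppr_le0 mdist_ge0. Qed.

Lemma adist_le y m : adist y <= mdist y (a m).
Proof. by rewrite lerNl; exact: (supn_ge m (mdistN y)). Qed.

Lemma adist_lt y r : adist y < r -> exists m, mdist y (a m) < r.
Proof.
by rewrite ltrNl => /supn_gt[m]; rewrite ltrN2 => ?; exists m.
Qed.

Lemma adist_dist x y : `|adist x - adist y| <= mdist x y.
Proof.
rewrite /adist -opprD normrN; apply: (supn_dist (mdistN x) (mdistN y)) => m.
by rewrite -opprD normrN; exact: mdist_dist.
Qed.

(** The factor [1 / K m] ties indices to frequencies. An index is used only where its weight exceeds
    [total]; then [total] is below [1 / K m], so the frequency [1 / total] is at least [K m]. *)
Definition weight m (y : Y) : R :=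
  Num.min 1 (Num.max 0 (2 * adist y - mdist y (a m))) / K m.

Let K_gt0 m : 0 < K m.
Proof. exact: lt_le_trans ltr01 (K_ge1 m). Qed.

Lemma weight_le m y : weight m y <= (K m)^-1.
Proof. by rewrite ler_piMl// ?invr_ge0 ?(ltW (K_gt0 m))// ge_min lexx. Qed.

Let weight_le1 y m : weight m y <= 1.
Proof. by apply: le_trans (weight_le m y) _; rewrite invf_le1. Qed.

Lemma weight_dist m x y : `|weight m x - weight m y| <= 3 * mdist x y.
Proof.
rewrite -mulrBl normrM [X in _ * X]ger0_norm ?invr_ge0 ?(ltW (K_gt0 m))//.
apply: (@le_trans _ _
  `|(2 * adist x - mdist x (a m)) - (2 * adist y - mdist y (a m))|).
  rewrite ler_pdivrMr//; apply: le_trans (clamp_dist _ _) _.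
  by rewrite ler_peMr.
have := adist_dist x y; have := mdist_dist x y (a m); rewrite !ler_norml.
by move=> /andP[? ?] /andP[? ?]; apply/andP; split; lra.
Qed.

(** A supremum of uniformly Lipschitz weights is Lipschitz, with no need for local finiteness.
    Taking a third of it leaves some weight above [2 * total], hence some density above 1. *)
Definition total (y : Y) : R := supn (weight ^~ y) / 3.

Lemma total_dist x y : `|total x - total y| <= 1 * mdist x y.
Proof.
rewrite mul1r -mulrBl normrM [X in _ * X]ger0_norm// ler_pdivrMr// mulrC.
by apply: (supn_dist (weight_le1 x) (weight_le1 y)) => m; exact: weight_dist.
Qed.

Lemma weight_gt0 m y : 0 < weight m y -> mdist y (a m) < 2 * adist y.
Proof.
rewrite pmulr_lgt0 ?invr_gt0// lt_min ltr01/= lt_max ltxx/=.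
by rewrite subr_gt0.
Qed.

Lemma total_gt0 y : 0 < adist y -> 0 < total y.
Proof.
move=> y0; have [m ym] : exists m, mdist y (a m) < 2 * adist y.
  by apply: adist_lt; rewrite ltr_pMl// ltr1n.
rewrite divr_gt0//; apply: lt_le_trans (supn_ge m (weight_le1 y)).
by rewrite divr_gt0// lt_min ltr01/= lt_max subr_gt0 ym orbT.
Qed.

Definition density m (y : Y) : R := Num.max 0 (weight m y / total y - 1).

Definition frequency (y : Y) : R := (total y)^-1.

Lemma density_ge0 m y : 0 <= density m y.
Proof. by rewrite le_max lexx. Qed.

Lemma density_gt1 y : 0 < adist y -> exists m, 1 < density m y.
Proof.
move=> y0; have t0 := total_gt0 y0.
have [m ym] : exists m, 2 * total y < weight m y.
  by apply: supn_gt; rewrite -[ltRHS](divfK (_ : 3 != 0))// mulrC ltr_pM2l// ltr_nat.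
by exists m; rewrite lt_max; apply/orP; right; rewrite ltrBrDl ltr_pdivlMr// -natr1.
Qed.

Lemma frequency_gt0 y : 0 < adist y -> 0 < frequency y.
Proof. by move=> y0; rewrite invr_gt0; exact: total_gt0. Qed.

Lemma frequency_cvg y : 0 < adist y -> frequency q @[q --> y] --> frequency y.
Proof.
move=> y0; apply: cvgV; first by rewrite gt_eqF// total_gt0.
exact: lipschitz_cvg total_dist.
Qed.

Lemma density_cvg m y : 0 < adist y -> density m q @[q --> y] --> density m y.
Proof.
move=> y0; have W : weight m q @[q --> y] --> weight m y.
  exact: lipschitz_cvg (weight_dist m).
have S : weight m q / total q - 1 @[q --> y] --> weight m y / total y - 1.
  exact: cvgB (cvgM W (frequency_cvg y0)) (cvg_cst _).
exact: (continuous_max (cvg_cst _) S).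
Qed.

Lemma density_gt0 m y : 0 < adist y -> 0 < density m y ->
  mdist y (a m) < 2 * adist y /\ K m <= frequency y.
Proof.
move=> y0; have t0 := total_gt0 y0.
rewrite lt_max ltxx/= subr_gt0 ltr_pdivlMr// mul1r => wt; split.
  by apply: weight_gt0; exact: lt_trans wt.
by rewrite /frequency -[K m]invrK lef_pV2 ?posrE ?invr_gt0//;
  apply: le_trans (ltW wt) (weight_le m y).
Qed.

End spreading.

Lemma bochner_integrable_norm d (T : measurableType d) (R : realType)
    (mu : {measure set T -> \bar R}) (E : normedModType R) (D : set T) (w : T -> E) :
  measure_is_complete mu -> measurable D -> bochner_integrable mu D w ->
  mu.-integrable D (EFin \o (fun t => `|w t|)).
Proof.
move=> cmu mD bw; have fw := bochner_integrable_fin cmu mD bw.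
apply/integrableP; split; first exact: (measurable_normE cmu mD bw.1).
under eq_integral do rewrite /= normr_id.
by rewrite ltey_eq fw.
Qed.

Lemma sum_half_le {R : realFieldType} n : \sum_(m < n) (2^-1 : R) ^+ m <= 2.
Proof.
suff -> : \sum_(m < n) (2^-1 : R) ^+ m = 2 - 2 * 2^-1 ^+ n.
  by rewrite gerDl oppr_le0 mulr_ge0// exprn_ge0// invr_ge0.
elim: n => [|n IH]; first by rewrite big_ord0 expr0 mulr1 subrr.
by rewrite big_ord_recr/= IH exprS mulrA divff// mul1r; lra.
Qed.

Section coded_families.
Context {R : realType} (T : R) {E : completeNormedModType R}.
Hypothesis sepE : separable E.
Local Notation I := `[0, T]%classic.
Local Notation lambda := (@completed_lebesgue_measure R).
Local Notation calR := (caratheodory_type (@wlength R idfun)^*%mu).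

Let clambda := @completed_lebesgue_measure_is_complete R.

Let mI := lebesgue_measurable_itv `[0, T].

Let I_ge0 t : I t -> 0 <= t.
Proof. by rewrite /= in_itv/= => /andP[]. Qed.

Context {P : pseudoMetricType R}.
Variables (O : set P) (sigma : nat -> P -> R) (nu : P -> R).
Hypothesis oO : open O.
Hypothesis sigma_ge0 : forall n p, 0 <= sigma n p.
Hypothesis sigma_cvg : forall n p, O p -> sigma n q @[q --> p] --> sigma n p.
Hypothesis sigma_gt1 : forall p, O p -> exists n, 1 < sigma n p.
Hypothesis nu_gt0 : forall p, O p -> 0 < nu p.
Hypothesis nu_cvg : forall p, O p -> nu q @[q --> p] --> nu p.
Variable u : nat -> R -> E.
Hypothesis bu : forall m, bochner_integrable lambda I (u m).

Definition coded (p : P) (t : R) : E := u (code sigma nu p t) t.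

(** Near [p] the codes are bounded by some [n], so the sum of the norms of the first [n + 1] pieces
    dominates. *)
Lemma coded_locally_constant : locally_constant_family T O coded.
Proof.
move=> p Op; have Onear : \forall q \near p, O q by exact: open_nbhs_nbhs.
have [n cn] := code_near_bounded sigma_ge0 sigma_cvg sigma_gt1 nu_gt0 Op.
pose g t := \sum_(m < n.+1) `|u m t|.
have ig : lambda.-integrable I (EFin \o g).
  rewrite (_ : EFin \o g = fun t => (\sum_(m < n.+1) `|u m t|%:E)%E).
    by apply: (integrable_sum mI) => m _;
      exact: (bochner_integrable_norm clambda mI).
  by apply/funext => t; rewrite sumEFin.
have ug : \forall q \near p, {ae lambda, forall t, I t -> `|coded q t| <= g t}.
  apply: filterS2 cn Onear => q cq Oq; apply: aeW => t /I_ge0 It.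
  have cm : (code sigma nu q t < n.+1)%N by rewrite ltnS; exact: cq.
  rewrite /g (bigD1 (Ordinal cm))//= lerDl; exact: sumr_ge0.
split.
- apply: (bochner_integrable_dominated clambda mI sepE _ ig (nbhs_singleton ug)).
  apply: (strongly_measurable_glue clambda mI sepE (f := u)).
    by move=> m; apply: (measurable_code (O := O)).
  by move=> m; have [] := bu m.
- have [N [cN HN]] := code_exceptional sigma nu_gt0 Op.
  have c0 := ae_countable (countable1 (0 : R)).
  apply: filterS (filterI (ae_countable cN) c0) => t [Nt t0'] It.
  have t0 : 0 < t.
    by rewrite lt_neqAle I_ge0// andbT; apply/eqP => t0; apply: t0'.
  have [f0 fc] := HN t t0 Nt.
  have := code_near_cst sigma_ge0 sigma_cvg sigma_gt1 nu_gt0 nu_cvg oO Op t0 f0 fc.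
  by apply: filterS => q cq; rewrite /coded cq.
- by exists g.
Qed.

(** The interval lengths telescope to at most 1 and the errors [2^-m] sum to at most 2. The factor 3
    is therefore independent of the number of pieces in use. *)
Lemma coded_dist p (v : R -> E) (D : R) : O p -> 0 <= D ->
  bochner_integrable lambda I v ->
  (forall m, 0 < sigma m p -> forall a b : R, 0 <= a -> a <= b -> b <= 1 ->
    (\int[lambda]_(t in I `&` oscillation (nu p) a b) `|u m t - v t|%:E <=
     (b - a + 2^-1 ^+ m)%:E * \int[lambda]_(t in I) `|u m t - v t|%:E)%E) ->
  (forall m, 0 < sigma m p ->
    (\int[lambda]_(t in I) `|u m t - v t|%:E <= D%:E)%E) ->
  (\int[lambda]_(t in I) `|coded p t - v t|%:E <= (3 * D)%:E)%E.
Proof.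
move=> Op D0 bv osc uD; pose c := code sigma nu p.
have [n /nbhs_singleton /(_ Op) cn] :=
  code_near_bounded sigma_ge0 sigma_cvg sigma_gt1 nu_gt0 Op.
have mc m : @measurable _ calR (I `&` c @^-1` [set m]).
  by apply: (measurable_code (O := O)).
have [bc _ _] := coded_locally_constant Op.
have mcv := measurable_dist clambda mI bc.1 bv.1.
have cN t : I t -> (c t < n.+1)%N by move=> /I_ge0 It; rewrite ltnS; exact: cn.
have mE : @measurable_fun _ _ calR _ I (fun t => `|coded p t - v t|%:E).
  exact/measurable_EFinP.
have E0 t : I t -> (0 <= `|coded p t - v t|%:E)%E by [].
rewrite (ge0_integral_pieces lambda mc mE E0 cN).
have piece m : (\int[lambda]_(t in I `&` c @^-1` [set m]) `|coded p t - v t|%:E <=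
    ((cumul sigma m.+1 p - cumul sigma m p + 2^-1 ^+ m) * D)%:E)%E.
  have c01 := cumul_le sigma_ge0 p (leqnSn m).
  have c1 : cumul sigma m.+1 p <= 1 by rewrite /cumul ge_min lexx.
  have c0 : 0 <= cumul sigma m p by rewrite -(cumul0 sigma p) cumul_le.
  have [s0|s0] := ltP 0 (sigma m p); last first.
    have -> : I `&` c @^-1` [set m] = set0.
      apply/seteqP; split=> // t [/I_ge0 It /= cm].
      have := code_sigma_gt0 sigma_ge0 sigma_gt1 nu_gt0 Op It.
      by rewrite -/(c t) cm ltNge s0.
    by rewrite integral_set0 lee_fin mulr_ge0// addr_ge0 ?subr_ge0 ?exprn_ge0.
  have -> : I `&` c @^-1` [set m] =
      I `&` oscillation (nu p) (cumul sigma m p) (cumul sigma m.+1 p).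
    apply/seteqP; split=> t [It] ct; split => //.
      split; first exact: I_ge0.
      by apply/(codeP sigma_ge0 sigma_gt1 nu_gt0 m Op (I_ge0 It)).
    by apply/(codeP sigma_ge0 sigma_gt1 nu_gt0 m Op (I_ge0 It)); case: ct.
  have h := osc m s0 _ _ c0 c01 c1.
  apply: (@le_trans _ _ (\int[lambda]_(t in I `&` oscillation (nu p)
    (cumul sigma m p) (cumul sigma m.+1 p)) `|u m t - v t|%:E)%E).
    rewrite le_eqVlt; apply/orP; left; apply/eqP.
    apply: eq_integral => t /set_mem[It [t0 ct]].
    have : c t = m by apply/(codeP sigma_ge0 sigma_gt1 nu_gt0 m Op t0).
    by rewrite /coded -/(c t) => ->.
  apply: le_trans h _; rewrite EFinM lee_wpmul2l//; last exact: uD.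
  by rewrite lee_fin addr_ge0 ?subr_ge0// exprn_ge0.
apply: (@le_trans _ _ (\sum_(m < n.+1)
    ((cumul sigma m.+1 p - cumul sigma m p + 2^-1 ^+ m) * D)%:E)%E).
  by apply: lee_sum => m _; exact: piece.
rewrite sumEFin lee_fin -mulr_suml ler_wpM2r// big_split/=.
rewrite -(big_mkord xpredT (fun m => cumul sigma m.+1 p - cumul sigma m p)).
rewrite telescope_sumr// cumul0 subr0.
have -> : 3 = 1 + 2 :> R by rewrite -(natrD R 1 2).
by rewrite lerD ?sum_half_le// /cumul ge_min lexx.
Qed.

End coded_families.

Section blending.
Context {R : realType} (T : R) {E : completeNormedModType R}.
Hypothesis sepE : separable E.
Local Notation I := `[0, T]%classic.
Local Notation lambda := (@completed_lebesgue_measure R).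

Let clambda := @completed_lebesgue_measure_is_complete R.

Let mI := lebesgue_measurable_itv `[0, T].

Lemma L1_of_id (v : L1 T E) : L1_of T v = v.
Proof.
apply/eqP; rewrite -subr_eq0 -normr_eq0 -(inj_eq (@EFin_inj R)) L1_distE.
apply/eqP; rewrite (integral_norm_ae clambda mI
  (f := fun t => L1_of T v t - v t) (g := fun t => v t - v t)).
- by under eq_integral do rewrite subrr normr0; rewrite integral0.
- exact: (strongly_measurableB (L1_measurable _) (L1_measurable _)).
- exact: (strongly_measurableB (L1_measurable _) (L1_measurable _)).
- by apply: filterS (L1_ofE (L1_integrable v)) => t vE It; rewrite vE.
Qed.

(** [K m] dominates the thresholds of all pairs with [j <= m]. The added [m + 1] makes the indices
    in use bounded wherever the frequency is. *)
Lemma oscillation_thresholds (u : nat -> L1 T E) : exists K : nat -> R,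
  (forall m, m.+1%:R <= K m) /\
  forall m j, (j <= m)%N -> forall nu a b : R, K m <= nu ->
    0 <= a -> a <= b -> b <= 1 ->
    (\int[lambda]_(t in I `&` oscillation nu a b) `|u m t - u j t|%:E <=
     (b - a + 2^-1 ^+ m)%:E * \int[lambda]_(t in I) `|u m t - u j t|%:E)%E.
Proof.
have ex (mj : nat * nat) : exists N : R, 0 < N /\
    forall nu a b : R, N <= nu -> 0 <= a -> a <= b -> b <= 1 ->
    (\int[lambda]_(t in I `&` oscillation nu a b) `|u mj.1 t - u mj.2 t|%:E <=
     (b - a + 2^-1 ^+ mj.1)%:E *
     \int[lambda]_(t in I) `|u mj.1 t - u mj.2 t|%:E)%E.
  have bd : bochner_integrable lambda I (fun t => u mj.1 t - u mj.2 t).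
    have := bochner_integrable_comb clambda mI (-1)
      (L1_integrable (u mj.2)) (L1_integrable (u mj.1)).
    congr bochner_integrable; apply/funext => t.
    by rewrite !fctE scaleN1r addrC.
  have h0 : 0 < 2^-1 ^+ mj.1 :> R by rewrite exprn_gt0// invr_gt0.
  by have [N N0 HN] := oscillation_le sepE bd h0; exists N; split => // *; exact: HN.
have [N HN] := choice ex.
exists (fun m => m.+1%:R + \sum_(j < m.+1) N (m, val j)).
split=> [m|m j jm nu a b Knu].
  by rewrite lerDl; apply: sumr_ge0 => j _; exact: ltW (HN (m, val j)).1.
apply: ((HN (m, j)).2); apply: le_trans Knu.
have jm1 : (j < m.+1)%N by rewrite ltnS.
rewrite (bigD1 (Ordinal jm1))//= addrCA lerDl addr_ge0//.
by apply: sumr_ge0 => i _; exact: ltW (HN (m, val i)).1.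
Qed.

Context {Y : metricType R}.
Variables (a : nat -> Y) (u : nat -> L1 T E).

Let O : set Y := [set y | 0 < adist a y].

Lemma adist_cvg y : adist a q @[q --> y] --> adist a y.
Proof.
by apply: (@lipschitz_cvg _ _ _ 1) => x z; rewrite mul1r; exact: adist_dist.
Qed.

Lemma open_adist_gt0 : open O.
Proof.
rewrite openE => y Oy; rewrite /interior.
have : \forall q \near y, 0 < adist a q.
  by apply: (cvgr_gt (adist a y)) => //; exact: adist_cvg.
exact.
Qed.

(** [B] is four times the diameter of the set of functions in use: the glued function is within 3
    diameters of one of them, hence within 4 of each. If all of them are within [eps] of [v], the
    diameter is at most [2 * eps], which gives 8 and [3 * 2 + 1 = 7]. *)
Lemma blending : exists (w : Y -> R -> E) (B : Y -> R), [/\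
  locally_constant_family T O w,
  forall y, O y -> 0 <= B y,
  forall y, O y -> exists M, \forall q \near y, B q <= M,
  forall y, O y -> forall t, I t -> exists m, w y t = u m t /\
    `|u m - L1_of T (w y)| <= B y &
  forall y (v : L1 T E) (eps : R), O y ->
    (forall m, mdist y (a m) < 2 * adist a y -> `|u m - v| <= eps) ->
    B y <= 8 * eps /\ `|L1_of T (w y) - v| <= 7 * eps].
Proof.
have [K [Kge osc]] := oscillation_thresholds u.
have K1 m : 1 <= K m by apply: le_trans (Kge m); rewrite ler1n.
pose sigma := density a K; pose nu := frequency a K.
have s0 n p : 0 <= sigma n p by exact: density_ge0.
have scvg n p : O p -> sigma n q @[q --> p] --> sigma n p by exact: density_cvg.
have s1 p : O p -> exists n, 1 < sigma n p by exact: density_gt1.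
have nu0 p : O p -> 0 < nu p by exact: frequency_gt0.
have nucvg p : O p -> nu q @[q --> p] --> nu p by exact: frequency_cvg.
have bu m : bochner_integrable lambda I (u m) by exact: L1_integrable.
pose w := coded sigma nu (fun m t => u m t).
have lw : locally_constant_family T O w.
  exact: (coded_locally_constant sepE open_adist_gt0 s0 scvg s1 nu0 nucvg bu).
have bw y : O y -> bochner_integrable lambda I (w y) by move=> /lw[].
pose active y m := 0 < sigma m y.
pose diam y := sup [set d : R | exists m j,
  [/\ active y m, active y j & d = `|u m - u j|]].
have act_near y : O y -> exists n, \forall q \near y, forall m,
    active q m -> (m <= n)%N.
  move=> Oy; exists (Num.truncn (nu y + 1)).
  have nle : \forall q \near y, nu q <= nu y + 1.
    by apply: (cvgr_le _ (nucvg y Oy)); rewrite ltrDl.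
  have Oq : \forall q \near y, O q.
    by apply: open_nbhs_nbhs; split=> //; exact: open_adist_gt0.
  apply: filterS2 nle Oq => q qle Oq m /(density_gt0 K1 Oq)[_ Kq].
  rewrite truncn_ge_nat; last by rewrite addr_ge0// ltW// nu0.
  apply: le_trans (le_trans Kq qle); apply: le_trans (Kge m).
  by rewrite ler_nat.
have diam_near y : O y -> exists M, \forall q \near y, O q -> forall m j,
    active q m -> active q j -> `|u m - u j| <= M.
  move=> Oy; have [n nact] := act_near y Oy.
  exists (2 * \sum_(i < n.+1) `|u i|); apply: filterS nact => q qn _ m j am aj.
  have le m' : active q m' -> `|u m'| <= \sum_(i < n.+1) `|u i|.
    move=> /qn m'n; have m'n1 : (m' < n.+1)%N by rewrite ltnS.
    by rewrite (bigD1 (Ordinal m'n1))//= lerDl; exact: sumr_ge0.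
  apply: le_trans (ler_normB _ _) _; rewrite mulr_natl mulr2n.
  by apply: lerD; exact: le.
have diam_ge y m j : O y -> active y m -> active y j -> `|u m - u j| <= diam y.
  move=> Oy am aj; apply: ub_le_sup; last by exists m, j.
  have [M /nbhs_singleton/(_ Oy) hM] := diam_near y Oy.
  by exists M => _ [m' [j' [am' aj' ->]]]; exact: hM.
have diam_le y M : O y ->
    (forall m j, active y m -> active y j -> `|u m - u j| <= M) -> diam y <= M.
  move=> Oy hM; have [m m1] := s1 y Oy.
  have am : active y m by exact: lt_trans m1.
  apply: ge_sup; first by exists `|u m - u m|; exists m, m.
  by move=> _ [m' [j' [am' aj' ->]]]; exact: hM.
have diam0 y : O y -> 0 <= diam y.
  move=> Oy; have [m m1] := s1 y Oy.
  have am : active y m by exact: lt_trans m1.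
  exact: le_trans (normr_ge0 _) (diam_ge y m m Oy am am).
have near_w y : O y -> exists2 j, active y j &
    `|L1_of T (w y) - u j| <= 3 * diam y.
  move=> Oy; have [m m1] := s1 y Oy.
  have ex : exists m, 0 < sigma m y by exists m; exact: lt_trans m1.
  (* The reference is the smallest active index, because the thresholds control only pairs
     [j <= m]. *)
  case: (ex_minnP ex) => j aj jmin; exists j => //.
  rewrite -(L1_of_id (u j)) -lee_fin (L1_of_distE (bw y Oy) (bu j)).
  apply: (coded_dist sepE open_adist_gt0 s0 scvg s1 nu0 nucvg bu Oy (diam0 y Oy)
    (bu j)).
    move=> m' am' a' b' a0 ab b1; apply: osc => //; first exact: jmin.
    by have [] := density_gt0 K1 Oy am'.
  by move=> m' am'; rewrite -L1_distE lee_fin; exact: diam_ge.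
exists w, (fun y => 4 * diam y); split=> //.
- by move=> y /diam0 d0; rewrite mulr_ge0.
- move=> y Oy; have [M hM] := diam_near y Oy; exists (4 * M).
  have Oq : \forall q \near y, O q.
    by apply: open_nbhs_nbhs; split=> //; exact: open_adist_gt0.
  apply: filterS2 hM Oq => q hM Oq; rewrite ler_wpM2l//.
  by apply: diam_le => // m j am aj; exact: hM.
- move=> y Oy t; rewrite /= in_itv/= => /andP[t0 _].
  exists (code sigma nu y t); split=> //.
  have am := code_sigma_gt0 s0 s1 nu0 Oy t0.
  have [j aj wj] := near_w y Oy.
  apply: le_trans (ler_distD (u j) _ _) _.
  have -> : 4 * diam y = diam y + 3 * diam y by lra.
  by rewrite lerD//; [exact: diam_ge|rewrite distrC].
move=> y v eps Oy hv.
have dle : diam y <= 2 * eps.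
  apply: diam_le => // m j am aj; apply: le_trans (ler_distD v _ _) _.
  rewrite mulr_natl mulr2n lerD//; last rewrite distrC.
    by apply: hv; have [] := density_gt0 K1 Oy am.
  by apply: hv; have [] := density_gt0 K1 Oy aj.
split; first by rewrite (_ : 8 = 4 * 2) -?mulrA ?ler_pM2l// -natrM.
have [j aj wj] := near_w y Oy.
apply: le_trans (ler_distD (u j) _ _) _.
have jv : `|u j - v| <= eps by apply: hv; have [] := density_gt0 K1 Oy aj.
by lra.
Qed.

End blending.

(** * Extension and retraction *)

Lemma nbhs_set_typeP {R : realType} {V : normedModType R} (S : set V) (x : S)
    (U : set S) : nbhs x U <->
  exists2 e, 0 < e & [set y : S | `|set_val x - set_val y| < e] `<=` U.
Proof.
split=> [[B [[A oA <-] Ax AU]]|[e e0 eU]].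
  have : nbhs (set_val x) A by apply: open_nbhs_nbhs; split.
  move=> /nbhs_ballP[e e0 eA]; exists e => // y /= xy; apply: AU; apply: eA.
  by rewrite -ball_normE.
exists (set_val @^-1` ball (set_val x) e); split=> [||y /=].
- by exists (ball (set_val x) e) => //; exact: ball_open.
- exact: ballxx.
- by rewrite -ball_normE; exact: eU.
Qed.

Section differential_inclusion.
Context {R : realType} (T : R) {E : completeNormedModType R}.
Hypothesis sepE : separable E.
Local Notation I := `[0, T]%classic.
Local Notation lambda := (@completed_lebesgue_measure R).
Local Notation calR := (caratheodory_type (@wlength R idfun)^*%mu).

Let clambda := @completed_lebesgue_measure_is_complete R.

Let mI := lebesgue_measurable_itv `[0, T].

Variables (F : R -> E -> set E) (gamma : R -> R).
Hypothesis F0 : forall t x, I t -> F t x !=set0.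
Hypothesis Fclosed : forall t x, I t -> closed (F t x).
Hypothesis Fmeasurable : forall x C, open C ->
  @measurable _ calR [set t | I t /\ F t x `<=` C].
Hypothesis Flip : {ae lambda, forall t, I t -> forall x y,
  (hausdorff_dist (F t x) (F t y) <= (gamma t * `|x - y|)%:E)%E}.
Hypothesis Fzero : {ae lambda, forall t, I t -> rdist 0 (F t 0) <= gamma t}.
Hypothesis gamma1 : forall t, 1 <= gamma t.
Hypothesis gamma_int : lambda.-integrable I (EFin \o gamma).

Variables (V : L1 T E -> cont_space T E) (K : R).
Hypothesis K0 : 0 <= K.
Hypothesis V_dist : forall (w v : L1 T E) t, I t ->
  (`|V w t - V v t|%:E <=
   K%:E * \int[lambda]_(s in `[0%R, t]) `|w s - v s|%:E)%E.

Definition inclusion_solutions (h : cont_space T E) : set (L1 T E) :=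
  [set w | {ae lambda, forall t, I t -> F t (h t + V w t) (w t)}].

Let gamma0 t : 0 <= gamma t.
Proof. exact: le_trans ler01 (gamma1 t). Qed.

Let simple0 : bochner_integrable lambda I (fun=> 0 : E).
Proof. exact: bochner_integrable0. Qed.

Lemma constant_family (P : pseudoMetricType R) (O : set P) (u : R -> E) :
  bochner_integrable lambda I u -> locally_constant_family T O (fun=> u).
Proof.
move=> bu p Op; split=> //; first by apply: aeW => t _; exact: nearW.
exists (fun t => `|u t|); first exact: (bochner_integrable_norm clambda mI).
by apply: nearW => q; exact: aeW.
Qed.

(** The iteration starts from the zero family with tolerance 1. In [B] the 1 comes from [Fzero], and
    the norms bound the state of the zero function. *)
Lemma continuous_solution_selection : exists f : cont_space T E -> L1 T E,
  continuous f /\ forall h, inclusion_solutions h (f h).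
Proof.
have [C C0 exact_sel] := exact_selection sepE F0 Fclosed Fmeasurable Flip Fzero
  gamma1 gamma_int K0 V_dist.
pose w0 (h : cont_space T E) (t : R) : E := 0.
pose B (h : cont_space T E) : R := 1 + (`|h| + `|V (L1_of T (fun=> 0 : E))|).
have lw0 : locally_constant_family T setT w0 by exact: constant_family.
have Bcvg h : B q @[q --> h] --> B h.
  have N := @norm_continuous R (cont_space T E) h.
  exact: cvgD (cvg_cst _) (cvgD N (cvg_cst _)).
have defect h : setT h -> {ae lambda, forall t, I t ->
    rdist (w0 h t) (F t (state V id w0 h t)) <= B h * gamma t}.
  move=> _; apply: filterS2 (rdist_lip_ae F0 Flip) Fzero => t Ft Fz It.
  apply: le_trans (Ft It 0 0 _) _.
  have sB : `|0 - state V id w0 h t| <= `|h| + `|V (L1_of T (fun=> 0 : E))|.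
    rewrite sub0r normrN; apply: le_trans (@le_maxnorm _ _ _ _ t It) _.
    exact: (@ler_normD _ (cont_space T E) h (V _)).
  rewrite /B mulrDl mul1r lerD ?Fz// mulrC ler_wpM2r//.
have [f [fc fs _]] := exact_sel (cont_space T E) setT id (cst 1) B w0 openT
  (fun h _ => cvg_id) (fun _ _ => ltr01) (fun _ _ => cvg_cst _)
  (fun h _ => addr_ge0 ler01 (addr_ge0 (normr_ge0 _) (normr_ge0 _)))
  (fun h _ => ex_intro _ (B h + 1)
     (cvgr_le _ (Bcvg h) _ (ltr_pwDr ltr01 (lexx (B h))))) lw0 defect.
by exists f; split=> h; [exact: fc|exact: fs].
Qed.

Lemma extension_arith (C K' e b d x y : R) : 0 <= C -> 0 <= K' -> 0 < e ->
  b <= 8 * e -> d <= e -> x <= C * (K' * b + d) -> y <= 7 * e ->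
  x + y < (C * (8 * K' + 1) + 8) * e.
Proof.
move=> C0 K'0 e0 be de xle ye.
have : C * (K' * b + d) <= C * ((8 * K' + 1) * e).
  rewrite ler_wpM2l// mulrDl mul1r lerD// [8 * K']mulrC -mulrA ler_wpM2l//.
by rewrite mulrA; lra.
Qed.

(** [phi] is continuous relative to [A] only, so continuity of [psi] at points of [A] is proved
    directly from the estimates on the blend and the correction; off [A], an open set, [psi] is the
    corrected family. *)
Lemma solution_extension (h : cont_space T E) (Y : metricType R) (A : set Y)
    (phi : Y -> L1 T E) (a : nat -> Y) : closed A ->
  (forall n, A (a n)) ->
  (forall y r, A y -> 0 < r -> exists n, mdist y (a n) < r) ->
  (forall y, A y -> inclusion_solutions h (phi y)) ->
  (forall y r, A y -> 0 < r -> exists2 s, 0 < s &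
     forall z, A z -> mdist y z < s -> `|phi y - phi z| < r) ->
  exists psi : Y -> L1 T E, [/\ continuous psi,
    forall y, inclusion_solutions h (psi y) &
    forall y, A y -> psi y = phi y].
Proof.
move=> cA Aa da sol cphi.
have [C C0 exact_sel] := exact_selection sepE F0 Fclosed Fmeasurable Flip Fzero
  gamma1 gamma_int K0 V_dist.
pose O : set Y := [set y | 0 < adist a y].
have oO : open O by exact: open_adist_gt0.
have OnA y : O y -> ~ A y.
  move=> Oy Ay; have [n yn] := da y _ Ay Oy.
  by have := le_lt_trans (adist_le a y n) yn; rewrite ltxx.
have nAO y : ~ A y -> O y.
  move=> nAy; have : nbhs y (~` A).
    by apply: open_nbhs_nbhs; split => //; exact: closed_openC.
  move=> /nbhs_ballP[r /= r0 rA]; rewrite /O /= ltNge; apply/negP => y0.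
  have [n yn] := adist_lt (le_lt_trans y0 r0).
  by apply: (rA (a n)) => //; rewrite ballEmdist.
have [w [B [lw B0 Bbnd wu wv]]] := blending sepE a (fun m => phi (a m)).
have defect y : O y -> {ae lambda, forall t, I t ->
    rdist (w y t) (F t (state V (cst h) w y t)) <= K * B y * gamma t}.
  move=> Oy; have /ae_foralln su n := sol (a n) (Aa n).
  apply: filterS2 (rdist_lip_ae F0 Flip) su => t Ft su It.
  have [m [-> wB]] := wu y Oy t It.
  (* At [t] the blend equals [phi (a m) t], which lies in [F] at the state of [phi (a m)]; passing
     to the state of the blend costs at most [gamma t * (K * B y)]. *)
  apply: le_trans (Ft It _ ((h + V (phi (a m))) t) _) _.
  have r0 : rdist (phi (a m) t) (F t ((h + V (phi (a m))) t)) <= 0.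
    by rewrite -(normr0 E) -(subrr (phi (a m) t)); apply: rdist_le; exact: su.
  apply: le_trans (lerD r0 (lexx _)) _; rewrite add0r mulrC ler_wpM2r//.
  apply: le_trans (cont_space_dist_le (h + V (phi (a m))) _ It) _.
  rewrite /state opprD addrACA subrr add0r.
  by apply: le_trans (V_lipschitz K0 V_dist _ _) _; rewrite ler_wpM2l.
have bK y : O y -> 0 <= K * B y by move=> /B0; exact: mulr_ge0.
have bKbnd y : O y -> exists M, \forall q \near y, K * B q <= M.
  move=> /Bbnd[M BM]; exists (K * M); apply: filterS BM => q.
  exact: ler_wpM2l.
have [f [fc fs fw]] := exact_sel Y O (cst h) (adist a) (fun y => K * B y) w oO
  (fun _ _ => cvg_cst _) (fun _ Oy => Oy) (fun y _ => @adist_cvg R Y a y) bK bKbnd lw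
  defect.
pose psi y := if pselect (A y) then phi y else f y.
have psiA y : A y -> psi y = phi y by rewrite /psi; case: pselect.
have psinA y : ~ A y -> psi y = f y by rewrite /psi; case: pselect.
exists psi; split; last exact: psiA.
- move=> y; have [Ay|nAy] := pselect (A y); last first.
    have Oy := nAO y nAy.
    have nO : \forall q \near y, O q by exact: open_nbhs_nbhs.
    rewrite /continuous_at psinA//; apply: cvg_trans (fc y Oy).
    by apply: near_eq_cvg; apply: filterS nO => q /OnA /psinA.
  rewrite /continuous_at psiA//.
  apply/cvgrPdist_lt => eps eps0.
  (* With all pieces within [e], the correction moves by at most [C * (K * 8 e + e)] and the blend
     is within [7 e]; the last unit makes the inequality strict. *)
  pose D := C * (8 * K + 1) + 8.
  have D0 : 0 < D by rewrite ltr_wpDl// mulr_ge0// addr_ge0// mulr_ge0.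
  pose e := eps / D; have e0 : 0 < e by rewrite divr_gt0.
  have [s s0 hs] := cphi y e Ay e0.
  (* A piece in use at [q] has [d(q, a m) < 2 d(q, A) <= 2 d(y, q)], hence
     [d(y, a m) < 3 d(y, q) < s]. The bound by [e] controls the tolerance. *)
  have r0 : 0 < Num.min (s / 3) e by rewrite lt_min e0 divr_gt0.
  apply/nbhs_ballP; exists (Num.min (s / 3) e) => //= q.
  rewrite ballEmdist /= lt_min => /andP[qs qe].
  have epsE : eps = D * e by rewrite mulrC divfK ?gt_eqF.
  have [Aq|nAq] := pselect (A q); [rewrite psiA//|rewrite psinA//].
    apply: (lt_trans (hs q Aq _)).
      by apply: lt_le_trans qs _; rewrite ler_pdivrMr// ler_peMr ?ler1n// ltW.
    rewrite epsE ltr_pMl// /D ltr_wpDl// ?ltr1n// mulr_ge0// addr_ge0// mulr_ge0//.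
  have Oq := nAO q nAq.
  have qd : adist a q <= mdist y q.
    apply/ler_addgt0Pr => x x0; have [n yn] := da y x Ay x0.
    apply: le_trans (adist_le a q n) _; apply: le_trans (metric_triangle _ y _) _.
    by rewrite metric_sym lerD// ltW.
  have um m : mdist q (a m) < 2 * adist a q -> `|phi (a m) - phi y| <= e.
    move=> qm; rewrite distrC; apply: ltW; apply: hs => //.
    apply: le_lt_trans (metric_triangle _ q _) _; rewrite ltr_pdivlMr// in qs.
    have := lt_le_trans qm (ler_wpM2l (ler0n _ 2) qd); lra.
  have [Be we] := wv q (phi y) e Oq um.
  rewrite distrC -(subrK (L1_of T (w q)) (f q)) -addrA.
  apply: le_lt_trans (ler_normD _ _) _; rewrite epsE.
  apply: (extension_arith C0 K0 e0 Be _ (fw q Oq) we).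
  by apply: le_trans qd _; exact: ltW.
- move=> y; have [Ay|nAy] := pselect (A y); first by rewrite psiA//; exact: sol.
  by rewrite psinA//; exact: fs (nAO y nAy).
Qed.

(** Points of the dense sequence of [L1] need not lie in [S]; for each of them and each precision, a
    point of [S] that close is chosen when there is one. *)
Lemma L1_dense_sequence (S : set (L1 T E)) : S !=set0 ->
  exists x : nat -> L1 T E, (forall n, S (x n)) /\
    forall v r, S v -> 0 < r -> exists n, `|v - x n| < r.
Proof.
move=> [x0 Sx0]; have [c dc] := L1_dense T sepE.
pose x n := if unpickle n is Some (j, k)
  then xget x0 [set v | S v /\ `|v - c j| < k.+1%:R^-1] else x0.
exists x; split=> [n|v r Sv r0].
  by rewrite /x; case: unpickle => // -[j k]; case: xgetP => // _ -> [].
have r2 : 0 < r / 2 by rewrite divr_gt0.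
have [k _ /(_ k (leqnn k)) /= kr] := near_infty_natSinv_lt (PosNum r2).
have k0 : 0 < k.+1%:R^-1 :> R by rewrite invr_gt0.
have [j vj] := dc v _ k0.
exists (pickle (j, k)); rewrite /x pickleK.
case: xgetP => [u _ [_ uj]|/(_ v)]; last by move=> /(_ (conj Sv vj)).
apply: le_lt_trans (ler_distD (c j) _ _) _.
by rewrite [r]splitr ltrD// ?(lt_trans vj)// distrC (lt_trans uj).
Qed.

(** The inverse of the embedding, followed by the inclusion in [L1], extends to all of [Y] with
    values in the solution set. Composing the extension with [i] is the retraction. Nonemptiness,
    needed for a dense sequence, comes from the continuous selection. *)
Lemma solutions_absolute_retract (h : cont_space T E) :
  absolute_retract R (inclusion_solutions h).
Proof.
pose S := inclusion_solutions h.
have [f0 [_ /(_ h) Sf0]] := continuous_solution_selection.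
have [x [Sx dx]] := L1_dense_sequence (ex_intro S _ Sf0).
split.
  exists (fun u v : S => `|set_val u - set_val v|); split.
  - move=> u v; split=> [/eqP|->]; last by rewrite subrr normr0.
    by rewrite normr_eq0 subr_eq0 => /eqP; exact: val_inj.
  - by move=> u v; exact: distrC.
  - by move=> u v w; exact: ler_distD.
  - by move=> u U; exact: nbhs_set_typeP.
move=> Y i [inj_i cont_i open_i closed_i].
pose phi (y : Y) : L1 T E :=
  if pselect (exists u : S, i u = y) is left e then set_val (projT1 (cid e)) else 0.
have phiE u : phi (i u) = set_val u.
  rewrite /phi; case: pselect => [e|[]]; last by exists u.
  by congr set_val; apply: inj_i; exact: (projT2 (cid e)).
pose point (v : L1 T E) (Sv : S v) : S := SigSub (mem_set Sv).
pose a n := i (point (x n) (Sx n)).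
have aA n : range i (a n) by exists (point (x n) (Sx n)).
have da y r : range i y -> 0 < r -> exists n, mdist y (a n) < r.
  move=> [u _ <-] r0.
  have /nbhs_set_typeP[e e0 eB] := cont_i u _ (nbhsx_ballx (i u) r r0).
  have [n un] := dx (set_val u) e (set_valP u) e0; exists n.
  by have := eB (point (x n) (Sx n)) un; rewrite /= ballEmdist.
have phiS y : range i y -> S (phi y).
  by move=> [u _ <-]; rewrite phiE; exact: set_valP.
have cphi y r : range i y -> 0 < r -> exists2 s, 0 < s &
    forall z, range i z -> mdist y z < s -> `|phi y - phi z| < r.
  move=> [u _ <-] r0; pose U := [set v : S | `|set_val u - set_val v| < r].
  have oU : open U.
    rewrite (_ : U = set_val @^-1` ball (set_val u) r).
      by exists (ball (set_val u) r) => //; exact: ball_open.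
    by apply/seteqP; split=> v; rewrite /= -ball_normE.
  (* Openness of [i] onto its range is continuity of the inverse. *)
  have [W oW iU] := open_i U oU.
  have Wu : nbhs (i u) W.
    apply: open_nbhs_nbhs; split=> //.
    have : (i @` U) (i u) by exists u => //; rewrite /U/= subrr normr0.
    by rewrite iU => -[].
  have /nbhs_ballP[s s0 sW] := Wu; exists s => // _ [v _ <-] uv.
  have : (i @` U) (i v).
    by rewrite iU; split; [apply: sW; rewrite ballEmdist|exists v].
  by move=> [v' Uv' /inj_i <-]; rewrite !phiE.
have [psi [cpsi Spsi psiE]] := solution_extension closed_i aA da phiS cphi.
exists (fun y => i (point (psi y) (Spsi y))); split.
- move=> y; apply: (@continuous_comp _ _ _ (fun y => point (psi y) (Spsi y)) i).
    move=> U /nbhs_set_typeP[e e0 eU].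
    have /cvgrPdist_lt/(_ e e0) := cpsi y.
    by apply: filterS => z yz; exact: eU.
  exact: cont_i.
- by move=> y; exists (point (psi y) (Spsi y)).
- move=> _ [u _ <-]; congr (i _); apply: val_inj => /=.
  by rewrite psiE ?phiE//; exists u.
Qed.

End differential_inclusion.

(** * Reduction of the hypotheses to one majorant and an abstract operator *)

Lemma integrable_majorant d (T : measurableType d) (R : realType)
    (mu : {measure set T -> \bar R}) (D : set T) (a b : T -> R) :
  measurable D -> (mu D < +oo)%E -> mu.-integrable D (EFin \o a) ->
  mu.-integrable D (EFin \o b) ->
  mu.-integrable D (EFin \o (fun t => 1 + `|a t| + `|b t|)).
Proof.
move=> mD Doo ia ib.
have i1 := integrable_const 1 mD Doo.
have := integrableD mD (integrableD mD i1 (integrable_abse ia)) (integrable_abse ib).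
by congr (_.-integrable); apply/funext => t; rewrite /= !EFinD.
Qed.

Lemma volterra_cont_space {R : realType} (T : R) {E : completeNormedModType R}
    (k : R -> R -> bounded_endo E) : separable E ->
  (forall t, `[0, T]%classic t ->
     in_Linfty (@completed_lebesgue_measure R) `[0, t] (k t)) ->
  (forall t, `[0, T]%classic t ->
     Linfty_norm (@completed_lebesgue_measure R) `[0, T]
       (kernel_ext k t' - kernel_ext k t)
       @[t' --> within `[0, T] (nbhs t)] --> 0%E) ->
  exists V : L1 T E -> cont_space T E,
    forall w t, `[0, T]%classic t -> V w t = volterra k w t.
Proof.
move=> sepE k5 k6; pose v (w : L1 T E) (t : R) : E :=
  if t \in `[0, T]%classic then volterra k w t else 0.
have vE w t : `[0, T]%classic t -> v w t = volterra k w t.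
  by move=> It; rewrite /v mem_set.
have cv w : v w \in @continuous_on R T E.
  rewrite inE; split=> [|t It]; last by rewrite /v memNset.
  have := volterra_continuous sepE k5 k6 (L1_integrable w).
  apply: subspace_eq_continuous => t /set_mem It.
  exact: (esym (vE w t It)).
exists (fun w => ContSpace (cv w)) => w t It; exact: vE.
Qed.

Theorem theorem7 (R : realType) (E : completeNormedModType R) (T : R)
  (F : R -> E -> set E) (k : R -> R -> bounded_endo E)
  (T_ge0 : 0 <= T)
  (E_separable : separable E)
  (H1 : forall t x, `[0, T]%classic t ->
     [/\ F t x !=set0, closed (F t x) & bounded_set (F t x)])
  (H2 : forall x (C : set E), open C ->
     lebesgue_measurable [set t | `[0, T]%classic t /\ F t x `<=` C])
  (H3 : exists2 alpha : R -> R,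
     (@completed_lebesgue_measure R).-integrable `[0, T] (EFin \o alpha) &
     {ae @completed_lebesgue_measure R, forall t, `[0, T]%classic t ->
        forall x y : E,
          (hausdorff_dist (F t x) (F t y) <= (alpha t * `|x - y|)%:E)%E})
  (H4 : exists2 beta : R -> R,
     (@completed_lebesgue_measure R).-integrable `[0, T] (EFin \o beta) &
     {ae @completed_lebesgue_measure R, forall t, `[0, T]%classic t ->
        (dist_set 0%R (F t 0%R) <= (beta t)%:E)%E})
  (k5 : forall t, `[0, T]%classic t ->
     in_Linfty (@completed_lebesgue_measure R) `[0, t] (k t))
  (k6 : forall t, `[0, T]%classic t ->
     Linfty_norm (@completed_lebesgue_measure R) `[0, T]
       (kernel_ext k t' - kernel_ext k t)
       @[t' --> within `[0, T] (nbhs t)] --> 0%E) :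
  (forall h : cont_space T E, absolute_retract R (solution_set F k h)) /\
  exists f : cont_space T E -> L1 T E,
    continuous f /\ forall h, solution_set F k h (f h).
Proof.
have [alpha ia Fa] := H3; have [beta ib Fb] := H4.
have mI := lebesgue_measurable_itv `[0, T].
(* One majorant for the Lipschitz constant and the distance at 0; the summand 1 lets constant
   tolerances be absorbed into multiples of [gamma]. *)
pose gamma t := 1 + `|alpha t| + `|beta t|.
have ig : (@completed_lebesgue_measure R).-integrable `[0, T] (EFin \o gamma).
  exact: integrable_majorant mI (lambda_fin T) ia ib.
have gamma1 t : 1 <= gamma t by rewrite /gamma -addrA lerDl addr_ge0.
have F0 t x : `[0, T]%classic t -> F t x !=set0 by move=> /(H1 t x)[].
have Fcl t x : `[0, T]%classic t -> closed (F t x) by move=> /(H1 t x)[].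
have Flip : {ae @completed_lebesgue_measure R, forall t, `[0, T]%classic t ->
    forall x y, (hausdorff_dist (F t x) (F t y) <= (gamma t * `|x - y|)%:E)%E}.
  apply: filterS Fa => t Ft It x y; apply: le_trans (Ft It x y) _.
  rewrite lee_fin ler_wpM2r// (le_trans (ler_norm _))// /gamma addrAC lerDr.
  by rewrite addr_ge0.
have Fzero : {ae @completed_lebesgue_measure R, forall t, `[0, T]%classic t ->
    rdist 0 (F t 0) <= gamma t}.
  apply: filterS Fb => t Ft It; rewrite -lee_fin rdistK; last exact: F0.
  apply: le_trans (Ft It) _; rewrite lee_fin (le_trans (ler_norm _))//.
  by rewrite /gamma lerDr addr_ge0.
have [V VE] := volterra_cont_space E_separable k5 k6.
have [K K0 vK] := volterra_dist E_separable k5 k6.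
have VK (w v : L1 T E) t : `[0, T]%classic t ->
    (`|V w t - V v t|%:E <= K%:E *
     \int[@completed_lebesgue_measure R]_(s in `[0%R, t]) `|w s - v s|%:E)%E.
  move=> It; rewrite !VE//; apply: vK It; exact: L1_integrable.
have solE h : solution_set F k h = inclusion_solutions F V h.
  apply/seteqP; split=> w /=.
    by apply: filterS => t Ft It; rewrite VE//; exact: Ft.
  by apply: filterS => t Ft It; have := Ft It; rewrite VE.
split=> [h|].
  by rewrite solE; exact: (solutions_absolute_retract E_separable F0 Fcl H2 Flip
    Fzero gamma1 ig K0 VK).
have [f [cf fS]] := continuous_solution_selection E_separable F0 Fcl H2 Flip
  Fzero gamma1 ig K0 VK.
by exists f; split=> // h; rewrite solE.
Qed.
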